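(* Let $k\ge1$ be an integer. Then, for every $f\in C_c^\infty(\mathbb{R})$, $$R^{(k)}f(x)=w_kf(x)+\lim_{\varepsilon\to0^+}\int_{|x-y|>\varepsilon}R^{(k)}(x,y)f(y)\,dy,\qquad\text{a.e. }x\in\mathbb{R},$$ where $$R^{(k)}(x,y)=\frac1{\Gamma(k/2)}\int_0^\infty t^{\frac k2-1}\left(\frac{d}{dx}+x\right)^kW_t(x,y)\,dt,\qquad x,y\in\mathbb{R},\ x\ne y,$$ and $w_k=0$ when $k$ is odd, $w_k=-2^{k/2}$ when $k$ is even.
   Context: The Hermite operator is $H=\frac12\left(-\frac{d^2}{dx^2}+x^2\right)$ on $\mathbb{R}$. The Hermite functions $h_n(x)=(\sqrt\pi\,2^nn!)^{-1/2}e^{-x^2/2}H_n(x)$, $n=0,1,2,\dots$ ($H_n$ the $n$-th Hermite polynomial), form an orthonormal basis of $L^2(\mathbb{R},dx)$ and $Hh_n=(n+\frac12)h_n$. Write $c_n(f)=\int_{\mathbb{R}}h_nf\,dx$. The heat kernel of the semigroup generated by $-H$ is, for $t>0$ and $x,y\in\mathbb{R}$, $$W_t(x,y)=\sum_{n=0}^\infty e^{-(n+\frac12)t}h_n(x)h_n(y)=\frac1{\sqrt\pi}\left(\frac{e^{-t}}{1-e^{-2t}}\right)^{1/2}e^{-\frac12(x^2+y^2)\frac{1+e^{-2t}}{1-e^{-2t}}+\frac{2xye^{-t}}{1-e^{-2t}}}.$$ For $\beta>0$, $H^{-\beta}f=\sum_{n\ge0}(n+\frac12)^{-\beta}c_n(f)h_n$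 for $f\in L^2(\mathbb{R},dx)$. The $k$-th Hermite Riesz transform is $$R^{(k)}f=\left(\frac{d}{dx}+x\right)^kH^{-k/2}f=\sum_{n=k}^\infty\frac{2^{k/2}\left(n(n-1)\cdots(n-k+1)\right)^{1/2}}{(n+\frac12)^{k/2}}c_n(f)h_{n-k},\qquad f\in C_c^\infty(\mathbb{R}).$$
   Formalization: For even k the constant is w_k = (-2)^{k/2}, not the printed -2^{k/2}; the printed value is false when k is divisible by 4 (the correct w_4 is +4, not -4), and both agree for the other even k. *)

(* Defs.v *)
From HB Require Import structures.
From mathcomp Require Import all_boot all_order all_algebra.
From mathcomp Require Import all_classical all_reals all_analysis.

Set Implicit Arguments.
Unset Strict Implicit.
Unset Printing Implicit Defensive.
Import Order.TTheory GRing.Theory Num.Theory.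
Import numFieldNormedType.Exports.

Local Open Scope classical_set_scope.
Local Open Scope ring_scope.

Definition Cc_infty (R : realType) (f : R -> R) : Prop :=
  (forall (n : nat) (x : R), derivable (derive1n n f) x 1) /\
  compact (closure [set x | f x != 0]).

(* Physicists' normalization: the step is Rodrigues' formula
   H_n = (-1)^n e^(x^2) (d/dx)^n e^(-x^2) differentiated once. *)
Fixpoint hermite_poly (R : realType) (n : nat) : {poly R} :=
  if n is m.+1 then
    2%:P * 'X * hermite_poly R m - (hermite_poly R m)^`()
  else 1.

Definition hermite_fun (R : realType) (n : nat) (x : R) : R :=
  (Num.sqrt (Num.sqrt pi * 2 ^+ n * (n`!)%:R))^-1
  * expR (- (x ^+ 2 / 2)) * (hermite_poly R n).[x].

Definition hermite_coef (R : realType) (n : nat) (f : R -> R) : R :=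
  \int[lebesgue_measure]_x (hermite_fun n x * f x).

Definition hermite_eigen (R : realType) (n : nat) : R := n%:R + 2^-1.

(* Defined spectrally; the closed form is Mehler's formula. *)
Definition heat_kernel (R : realType) (t x y : R) : R :=
  limn (series (fun n : nat =>
    expR (- (hermite_eigen R n * t)) * hermite_fun n x * hermite_fun n y)).

Definition hermite_npow_sum (R : realType) (b : R) (f : R -> R) (N : nat)
    (x : R) : R :=
  \sum_(n < N) hermite_eigen R n `^ (- b) * hermite_coef n f * hermite_fun n x.

(* g is a representative of the class H^(-b) f in L^2 *)
Definition is_hermite_npow (R : realType) (b : R) (f g : R -> R) : Prop :=
  measurable_fun setT g /\
  'N[lebesgue_measure]_2%:E[
     EFin \o (fun x => (hermite_npow_sum b f N x - g x)%R)]%E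
    @[N --> \oo] --> 0%E.

(* H^(-b) f is only a class modulo null sets; the classical derivatives below
   are those of its continuous representative, which is unique, and which
   exists and is smooth for f in C_c^infty.  The value is arbitrary if there is
   no continuous representative. *)
Definition hermite_npow (R : realType) (b : R) (f : R -> R) : R -> R :=
  get [set g : R -> R | continuous g /\ is_hermite_npow b f g].

Definition hermite_lower (R : realType) (g : R -> R) : R -> R :=
  fun x => derive1 g x + x * g x.

Definition hermite_riesz (R : realType) (k : nat) (f : R -> R) : R -> R :=
  iter k (@hermite_lower R) (hermite_npow (k%:R / 2) f).

Definition Gamma_fun (R : realType) (a : R) : R :=
  \int[lebesgue_measure]_(t in `]0, +oo[) (t `^ (a - 1) * expR (- t)).

Definition hermite_riesz_kernel (R : realType) (k : nat) (x y : R) : R :=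
  (Gamma_fun (k%:R / 2 : R))^-1 *
  \int[lebesgue_measure]_(t in `]0, +oo[)
    (t `^ (k%:R / 2 - 1) *
     iter k (@hermite_lower R) (fun z => heat_kernel t z y) x).

(* For k even the constant is (-2)^(k/2), the limit of the principal symbol
   (i xi)^k / (xi^2/2)^(k/2); in particular it is +4, not -4, for k = 4. *)
Definition hermite_riesz_const (R : realType) (k : nat) : R :=
  if odd k then 0 else (- 2) ^+ k./2.

Definition hermite_riesz_trunc (R : realType) (k : nat) (f : R -> R)
    (x e : R) : R :=
  \int[lebesgue_measure]_(y in [set y | e < `|x - y|])
    (hermite_riesz_kernel k x y * f y).

(* Main.v *)
(* Mehler's formula, obtained from a first-order ODE in r = e^(-t) for the
   generating series of h_n(x) h_n(y), puts the k-th derivative (d/dx + x)^k W_t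
   in the closed form
     c r^(k+1/2) rho^(-k-1) e^((y^2-x^2)/2) H_k(u) e^(-u^2),
   with rho = sqrt(1 - r^2) and u = (r x - y) / rho.  Gauss decay in u bounds the
   t-integral of |y - x| times this kernel, so Fubini applies to functions g with
   |g(y)| <= K |y - x|.  Near x, split f into such a remainder plus f(x) times
   w(y) = e^((x^2-y^2)/2).  Since (H_(k-1) e^(-u^2))' = - H_k e^(-u^2), the weight w
   makes the kernel an exact derivative in y, and its mass on |x - y| <= e is a
   difference of the values of H_(k-1)(u) e^(-u^2) at u = - q x -+ e / rho, where
   q = (1 - r) / rho.  The shift q x is O(sqrt t) and disappears in the limit; what
   remains vanishes by parity for k odd, and for k even integrates along the
   substitution v = e / rho to the integral of H_(k-1)(v) e^(-v^2) / v over the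
   half-line, which produces (-2)^(k/2) Gamma(k/2).  The argument is valid at every
   x, not just almost everywhere. *)
Require Import Defs.
From mathcomp Require Import all_boot all_order all_algebra.
From mathcomp Require Import all_classical all_reals all_analysis.
From mathcomp Require Import measurable_realfun.
From mathcomp Require Import ring lra zify.
Set Implicit Arguments.
Unset Strict Implicit.
Unset Printing Implicit Defensive.
Import Order.TTheory GRing.Theory Num.Theory.
Import numFieldNormedType.Exports.

Local Open Scope classical_set_scope.
Local Open Scope ring_scope.

(** The obstacle is that the double integral over t and y does not converge absolutely when f(x) is
    nonzero: for small t the integrand has size 1 / (t rho) on a window of width rho around x, hence
    mass of order 1 / t. One extra factor |y - x| is worth one factor rho, of order sqrt t, and
    leaves the integrable t^(-1/2). This is why f is corrected to vanish at x, by a corrector whose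
    own contribution can be computed rather than estimated. That contribution is split once more:
    the multiplier in t is only asymptotic to one that integrates exactly along v = e / rho. The two
    differ by a bounded function of t, so dominated convergence handles the difference, while the
    exact part is evaluated in closed form before e tends to 0. On the spectral side Mehler's
    formula serves a second time: at r = 1 - 1/(n+2) it bounds h_n polynomially in n. Together with
    the rapid decay of the coefficients of f, this identifies the abstractly chosen H^(-k/2) f with
    a series that can be differentiated term by term. *)

Section HermiteAlgebra.
Variable R : realType.
Implicit Types (x y : R) (n : nat).

Notation H n := (hermite_poly R n).
Notation h := (@hermite_fun R).
Notation s n := (Num.sqrt (n%:R : R)).

(** * Recurrences for Hermite polynomials and functions *)

Lemma deriv_hermite_polyS n : (H n.+1)^`() = (2 * n.+1%:R)%:P * H n.
Proof.
elim: n => [|n IH].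
  by rewrite /= -[X in (_ * X - _)]polyC1 !(derivB, derivM, derivC, derivX) polyCM; ring.
have E : H n.+1 = 2%:P * 'X * H n - (H n)^`() by [].
have Ec : (2 * n.+2%:R)%:P = (2 * n.+1%:R)%:P + 2%:P :> {poly R}.
  by rewrite -polyCD -(natr1 n.+1); congr (_%:P); ring.
rewrite -[H n.+2]/(2%:P * 'X * H n.+1 - (H n.+1)^`()) derivB IH.
rewrite !derivM IH !derivC derivX Ec; move: E.
move: (H n.+1) (H n)^`() (H n) (_%:P) => a b c d ->; ring.
Qed.

(** Trades the differential step of the definition for a recurrence without derivatives, which
    survives the normalisation of h_n and can be summed against r^n. *)
Lemma hermite_poly_rec n :
  H n.+2 = 2%:P * 'X * H n.+1 - (2 * n.+1%:R)%:P * H n.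
Proof. by rewrite -deriv_hermite_polyS. Qed.

Lemma horner_hermite_rec n x : (H n.+2).[x] =
  2 * x * (H n.+1).[x] - 2 * n.+1%:R * (H n).[x].
Proof.
by rewrite hermite_poly_rec !(hornerD, hornerN, hornerM, hornerX, hornerC).
Qed.

Lemma horner_hermiteS n x : (H n.+1).[x] = 2 * x * (H n).[x] - (H n)^`().[x].
Proof. by rewrite /= !(hornerD, hornerN, hornerM, hornerX, hornerC). Qed.

Lemma horner_hermite0 x : (H 0).[x] = 1.
Proof. by rewrite /= hornerC. Qed.

Lemma horner_hermite1 x : (H 1).[x] = 2 * x.
Proof. by rewrite horner_hermiteS /= derivC !hornerC mulr1 subr0. Qed.

Definition hermite_norm n : R := Num.sqrt (Num.sqrt pi * 2 ^+ n * (n`!)%:R).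

Lemma hermite_norm_gt0 n : 0 < hermite_norm n.
Proof.
by rewrite sqrtr_gt0 !mulr_gt0 ?sqrtr_gt0 ?pi_gt0 ?exprn_gt0 ?ltr0n ?fact_gt0.
Qed.

Lemma hermite_normS n :
  hermite_norm n.+1 = hermite_norm n * (Num.sqrt 2 * s n.+1).
Proof.
rewrite /hermite_norm -!sqrtrM //.
by congr Num.sqrt; rewrite factS natrM exprS; ring.
Qed.

Lemma hermite_funE n x :
  h n x = (hermite_norm n)^-1 * expR (- (x ^+ 2 / 2)) * (H n).[x].
Proof. by []. Qed.

Lemma sqr_sqrt_nat n : s n ^+ 2 = n%:R.
Proof. by rewrite sqr_sqrtr. Qed.

Lemma sqr_sqrt2 : Num.sqrt (2 : R) ^+ 2 = 2.
Proof. by rewrite sqr_sqrtr. Qed.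

Lemma sqrt_natS_gt0 n : 0 < s n.+1.
Proof. by rewrite sqrtr_gt0 ltr0n. Qed.

Lemma sqrt2_gt0 : 0 < Num.sqrt (2 : R).
Proof. by rewrite sqrtr_gt0. Qed.

Lemma hermite_fun_rec0 x : s 1 * h 1 x = Num.sqrt 2 * x * h 0 x.
Proof.
rewrite !hermite_funE hermite_normS horner_hermite0 horner_hermite1.
have := hermite_norm_gt0 0; have := sqrt_natS_gt0 0; have := sqrt2_gt0.
have := sqr_sqrt2.
move: (hermite_norm 0) (Num.sqrt _) (Num.sqrt _) => N a b.
move=> E a0 b0 N0; have -> : 2 * x = b ^+ 2 * x by rewrite E.
field.
by rewrite !gt_eqF.
Qed.

Lemma hermite_fun_rec n x :
  s n.+2 * h n.+2 x = Num.sqrt 2 * x * h n.+1 x - s n.+1 * h n x.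
Proof.
rewrite !hermite_funE !hermite_normS horner_hermite_rec.
have := hermite_norm_gt0 n; have := sqrt_natS_gt0 n; have := sqrt2_gt0.
have := sqr_sqrt2; have := sqrt_natS_gt0 n.+1; have := sqr_sqrt_nat n.+1.
move: (hermite_norm n) (Num.sqrt _) (Num.sqrt _) (Num.sqrt _) => N a b c.
move: (H n.+1).[x] (H n).[x] => P Q E1 b0 E2 a0 c0 N0.
have -> : 2 * x * P - 2 * n.+1%:R * Q = a ^+ 2 * x * P - a ^+ 2 * c ^+ 2 * Q.
  by rewrite E1 E2.
field.
by rewrite !gt_eqF.
Qed.

(** The raising form of the derivative: besides x h_n it involves only h_(n+1), so integrating h_n
    (f' + x f) by parts yields the single coefficient of index n+1. *)
Lemma is_derive_hermite_fun n x :
  is_derive x 1 (h n) (x * h n x - Num.sqrt 2 * s n.+1 * h n.+1 x).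
Proof.
have -> : h n = (fun x => (hermite_norm n)^-1 * expR (- (x ^+ 2 / 2)) * (H n).[x]).
  by [].
have dp := is_derive_poly (H n) x.
apply: is_derive_eq.
rewrite !hermite_funE hermite_normS horner_hermiteS /GRing.scale /=.
have := hermite_norm_gt0 n; have := sqrt_natS_gt0 n; have := sqrt2_gt0.
move: (hermite_norm n) (Num.sqrt _) (Num.sqrt _) => N b c.
move=> b0 c0 N0; field.
by rewrite !gt_eqF.
Qed.

End HermiteAlgebra.

Lemma is_derive_comp_eq (R : realType) (f g : R -> R) (x a b c : R) :
  is_derive (g x) 1 f a -> is_derive x 1 g b -> c = a * b ->
  is_derive x 1 (fun w => f (g w)) c.
Proof. by move=> df dg ->; exact: (@is_derive1_comp _ f g). Qed.

(** * Power series of radius of convergence at least 1 *)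

Section SubexponentialSeries.
Variable R : realType.
Implicit Types (c e : nat -> R) (r : R) (n : nat).

(** Equivalent to radius of convergence at least 1. Asking for boundedness at every d < 1, rather
    than summability, makes stability under products and shifts immediate. *)
Definition subexp c :=
  forall d, 0 < d -> d < 1 -> exists C, forall n, `|c n| * d ^+ n <= C.

Lemma subexpM c e : subexp c -> subexp e -> subexp (fun n => c n * e n).
Proof.
move=> hc he d d0 d1.
(* Each factor receives one of the two factors sqrt d of d. *)
have s0 : 0 < Num.sqrt d by rewrite sqrtr_gt0.
have s1 : Num.sqrt d < 1 by rewrite -[ltRHS]sqrtr1 ltr_sqrt.
have [C hC] := hc _ s0 s1; have [D hD] := he _ s0 s1.
exists (C * D) => n; rewrite normrM -{1}(sqr_sqrtr (ltW d0)) expr2 exprMn.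
by rewrite mulrACA ler_pM // mulr_ge0 // exprn_ge0 // ltW.
Qed.

Lemma subexpD c e : subexp c -> subexp e -> subexp (fun n => c n + e n).
Proof.
move=> hc he d d0 d1; have [C hC] := hc d d0 d1; have [D hD] := he d d0 d1.
exists (C + D) => n; apply: le_trans (lerD (hC n) (hD n)).
by rewrite -mulrDl ler_wpM2r ?ler_normD // exprn_ge0 // ltW.
Qed.

Lemma subexp_shift c : subexp c -> subexp (fun n => c n.+1).
Proof.
move=> hc d d0 d1; have [C hC] := hc d d0 d1.
exists (C / d) => n; rewrite ler_pdivlMr // -mulrA -exprSr; exact: hC.
Qed.

Lemma subexp_le c e : subexp e -> (forall n, `|c n| <= `|e n|) -> subexp c.
Proof.
move=> he ce d d0 d1; have [C hC] := he d d0 d1; exists C => n.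
by apply: le_trans (hC n); rewrite ler_wpM2r // exprn_ge0 // ltW.
Qed.

Lemma subexp_cst (a : R) : subexp (fun=> a).
Proof.
move=> d d0 d1; exists `|a| => n.
by rewrite ler_piMr // exprn_ile1 // ltW.
Qed.

Lemma subexp_natS : subexp (fun n => n.+1%:R).
Proof.
move=> d d0 d1; pose e := d^-1 - 1.
have e0 : 0 < e by rewrite subr_gt0 invf_gt1.
exists (1 + e^-1) => n; rewrite ger0_norm //.
(* Bernoulli's inequality for d^-1 = 1 + e. *)
have B : 1 + n%:R * e <= d^-1 ^+ n.
  elim: n => [|n IH]; first by rewrite mul0r addr0 expr0.
  have -> : d^-1 = 1 + e by rewrite /e; ring.
  rewrite exprS -natr1; have -> : 1 + e = d^-1 by rewrite /e; ring.
  apply: le_trans (_ : d^-1 * (1 + n%:R * e) <= _); last first.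
    by rewrite ler_wpM2l // invr_ge0 ltW.
  have -> : d^-1 = 1 + e by rewrite /e; ring.
  have n0 : 0 <= n%:R :> R by []. 
  have := mulr_ge0 n0 (mulr_ge0 (ltW e0) (ltW e0)); nra.
have d' : 0 < d ^+ n by rewrite exprn_gt0.
rewrite -ler_pdivlMr // -exprVn.
apply: (@le_trans _ _ ((1 + e^-1) * (1 + n%:R * e))).
  rewrite -natr1; have -> : (1 + e^-1) * (1 + n%:R * e) =
    n%:R + 1 + n%:R * e + e^-1 by field; rewrite gt_eqF.
  have : 0 <= e^-1 by rewrite invr_ge0 ltW.
  have : 0 <= n%:R * e by rewrite mulr_ge0 // ltW.
  lra.
by rewrite ler_wpM2l // addr_ge0 // invr_ge0 ltW.
Qed.

Lemma subexp_sqrt : subexp (fun n => Num.sqrt n.+1%:R).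
Proof.
apply: subexp_le subexp_natS _ => n.
rewrite !ger0_norm ?sqrtr_ge0 // -[leRHS]sqr_sqrt_nat expr2 ler_peMr ?sqrtr_ge0 //.
by rewrite -[leLHS]sqrtr1 ler_sqrt // ler1n.
Qed.

Lemma subexp_cvg c r : subexp c -> `|r| < 1 -> cvgn (pseries c r).
Proof.
move=> hc r1; pose d := (1 + `|r|) / 2.
have d0 : 0 < d by rewrite /d; have := normr_ge0 r; lra.
have d1 : d < 1 by rewrite /d; lra.
have rd : `|r| < d by rewrite /d; lra.
have [C hC] := hc _ d0 d1.
apply: normed_cvg; apply: (@series_le_cvg _ _ (geometric C (`|r| / d))) => n /=.
- by [].
- by rewrite mulr_ge0 ?exprn_ge0 ?divr_ge0 ?(ltW d0) // (le_trans _ (hC 0%N)) ?mulr_ge0.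
- rewrite normrM normrX exprMn mulrC exprVn mulrCA ler_wpM2l ?exprn_ge0 //.
  by rewrite ler_pdivlMr ?exprn_gt0.
- by apply: is_cvg_geometric_series; rewrite ger0_norm ?divr_ge0 ?(ltW d0) // ltr_pdivrMr // mul1r.
Qed.

Definition psum c r : R := limn (pseries c r).

Lemma psumD c e r : subexp c -> subexp e -> `|r| < 1 ->
  psum (fun n => c n + e n) r = psum c r + psum e r.
Proof.
move=> hc he r1; rewrite /psum -lim_seriesD; try exact: subexp_cvg.
congr (limn (series _)); apply/funext => n /=; by rewrite mulrDl.
Qed.

Lemma psumZ a c r : subexp c -> `|r| < 1 ->
  psum (fun n => a * c n) r = a * psum c r.
Proof.
move=> hc r1; rewrite /psum -[RHS]lim_seriesZ; last exact: subexp_cvg.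
congr (limn (series _)); apply/funext => n /=; by rewrite -mulrA.
Qed.

Lemma psum_shift c r : subexp c -> `|r| < 1 ->
  psum c r = c 0%N + r * psum (fun n => c n.+1) r.
Proof.
move=> hc r1.
have hc' := subexp_cvg (subexp_shift hc) r1.
have C : pseries c r n @[n --> \oo] --> c 0%N + r * psum (fun n => c n.+1) r.
  rewrite -(cvg_shiftn 1).
  rewrite (_ : (fun n => _) = fun n => c 0%N + r * pseries (fun n => c n.+1) r n).
    apply: cvgD; first exact: cvg_cst.
    by apply: cvgM; [exact: cvg_cst|exact: hc'].
  apply/funext => n; rewrite /pseries /series /= addn1 big_nat_recl //= expr0 mulr1.
  by rewrite mulr_sumr; congr (_ + _); apply: eq_bigr => i _; rewrite exprS mulrCA.
exact: cvg_lim C.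
Qed.

(** The first and second derivative series are again subexponential, so all three converge at a
    point K strictly between |r| and 1. *)
Lemma is_derive_psum c r : subexp c -> `|r| < 1 ->
  is_derive r 1 (psum c) (psum (fun n => n.+1%:R * c n.+1) r).
Proof.
move=> hc r1; pose K := (1 + `|r|) / 2.
have K1 : `|K| < 1 by rewrite ger0_norm /K; have := normr_ge0 r; lra.
have rK : `|r| < `|K| by rewrite [`|K|]ger0_norm /K; have := normr_ge0 r; lra.
have hd e : subexp e -> subexp (pseries_diffs e).
  by move=> he; apply: (subexpM subexp_natS (subexp_shift he)).
apply: (@pseries_snd_diffs _ c K r) => //; apply: subexp_cvg => //.
  exact: hd.
exact: hd (hd _ hc).
Qed.

End SubexponentialSeries.

(** * Mehler's formula *)

Section Mehler.
Variable R : realType.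
Implicit Types (x y r : R) (n : nat).
Notation h := (@hermite_fun R).
Notation s n := (Num.sqrt (n%:R : R)).

(** In the recurrence for h_(n+2) the coefficient sqrt 2 x / sqrt(n+2) tends to 0, so the larger of
    two consecutive |h_n x| eventually grows by a factor of at most 1 + e = 1/d per step. This crude
    bound is enough to set up the generating series. *)
Lemma subexp_hermite_fun x : subexp (fun n => h n x).
Proof.
move=> d d0 d1; pose e := d^-1 - 1.
have e0 : 0 < e by rewrite subr_gt0 invf_gt1.
pose U n := Num.max `|h n x| `|h n.+1 x|.
have U0 n : 0 <= U n by rewrite le_max normr_ge0.
have [N hN] : exists N : nat, Num.sqrt 2 * `|x| / e <= s N.
  exists (Num.bound ((Num.sqrt 2 * `|x| / e) ^+ 2)).
  rewrite -[leLHS]ger0_norm ?divr_ge0 ?mulr_ge0 ?sqrtr_ge0 ?(ltW e0) //.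
  rewrite -sqrtr_sqr ler_sqrt // ltW // archi_boundP //.
  by rewrite exprn_ge0 // ?divr_ge0 ?mulr_ge0 ?sqrtr_ge0 ?(ltW e0).
have step n : (N <= n)%N -> U n.+1 * d <= U n.
  move=> Nn; rewrite -ler_pdivlMr //.
  have -> : U n / d = (1 + e) * U n by rewrite /e; ring.
  rewrite ge_max; apply/andP; split.
    rewrite (@le_trans _ _ (U n)) ?le_max ?lexx ?orbT // ler_peMl // lerDl; exact: ltW.
  have sn0 := sqrt_natS_gt0 R n.+1.
  rewrite -(ler_pM2l sn0) -{1}(gtr0_norm sn0) -normrM hermite_fun_rec.
  apply: le_trans (ler_normB _ _) _.
  have -> : s n.+2 * ((1 + e) * U n) = s n.+2 * e * U n + s n.+2 * U n by ring.
  apply: lerD.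
    rewrite normrM [X in X * _ <= _]normrM ger0_norm ?sqrtr_ge0 // ler_pM ?mulr_ge0 ?sqrtr_ge0 //.
      rewrite -ler_pdivrMr //; apply: le_trans hN _.
      by rewrite ler_sqrt // ler_nat (leq_trans Nn) // -addn2 leq_addr.
    by rewrite le_max lexx orbT.
  rewrite normrM ger0_norm ?sqrtr_ge0 // ler_pM ?sqrtr_ge0 //.
    by rewrite ler_sqrt // ler_nat.
  by rewrite le_max lexx.
exists (\sum_(i < N.+1) U i) => n.
apply: (@le_trans _ _ (U n * d ^+ n)).
  by rewrite ler_wpM2r ?exprn_ge0 ?(ltW d0) // le_max lexx.
have sm m : (m <= N)%N -> U m * d ^+ m <= \sum_(i < N.+1) U i.
  move=> mN; rewrite -ltnS in mN.
  rewrite (bigD1 (Ordinal mN)) //= (@le_trans _ _ (U m)) //.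
    by rewrite ler_piMr // exprn_ile1 // ltW.
  by rewrite lerDl sumr_ge0.
elim: n => [|n IH]; first exact: sm.
have [nN|Nn] := ltnP n N; first exact: sm.
apply: le_trans IH; rewrite exprS mulrA ler_wpM2r ?exprn_ge0 ?(ltW d0) //.
exact: step.
Qed.

(** The off-diagonal products [q] close the system: the recurrences link the series of [a], its
    derivative and the series of [q], and eliminating [q] leaves an ODE for [a] alone. *)
Let a x y n := h n x * h n y.
Let q x y n := s n.+1 * (h n x * h n.+1 y).

Let sa x y : subexp (a x y).
Proof. by apply: subexpM; exact: subexp_hermite_fun. Qed.
Let sq x y : subexp (q x y).
Proof.
apply: subexpM (@subexp_sqrt R) _; apply: subexpM.
  exact: subexp_hermite_fun.
exact: (subexp_shift (@subexp_hermite_fun _)).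
Qed.

(** The recurrence in x is multiplied by h_n(y) and summed against r^n; its last term is [q x y]
    shifted by one index, hence the factor r. *)
Let psum_q x y r : `|r| < 1 ->
  psum (q y x) r = Num.sqrt 2 * x * psum (a x y) r - r * psum (q x y) r.
Proof.
move=> r1; rewrite (psum_shift (sq y x) r1) (psum_shift (sa x y) r1).
have -> : (fun n => q y x n.+1) =
    (fun n => Num.sqrt 2 * x * a x y n.+1 + (-1) * q x y n).
  apply/funext => n; rewrite /q /a mulrCA hermite_fun_rec; ring.
rewrite psumD //; last 2 first.
- exact: subexpM (subexp_cst _) (subexp_shift (sa x y)).
- exact: subexpM (subexp_cst _) (sq x y).
rewrite !psumZ //; last exact: subexp_shift (sa x y).
rewrite /q mulrCA hermite_fun_rec0 /a; ring.
Qed.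

(** Splitting n+2 into two square roots gives each of h_(n+2)(x) and h_(n+2)(y) the factor that its
    own recurrence requires. *)
Let psum_a' x y r : `|r| < 1 ->
  psum (fun n => n.+1%:R * a x y n.+1) r =
  Num.sqrt 2 * x * psum (q x y) r - r * (Num.sqrt 2 * y * psum (q x y) r)
  + r * (psum (a x y) r + r * psum (fun n => n.+1%:R * a x y n.+1) r).
Proof.
move=> r1.
have sn : subexp (fun n => n.+1%:R * a x y n) by apply: subexpM (@subexp_natS R) _.
have sd : subexp (fun n => n.+1%:R * a x y n.+1).
  exact: subexpM (@subexp_natS R) (subexp_shift (sa x y)).
have E : psum (fun n => n.+1%:R * a x y n) r =
    psum (a x y) r + r * psum (fun n => n.+1%:R * a x y n.+1) r.
  rewrite (psum_shift sn r1) (psum_shift (sa x y) r1).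
  have -> : (fun n => n.+2%:R * a x y n.+1) =
      (fun n => n.+1%:R * a x y n.+1 + a x y n.+1).
    by apply/funext => n; rewrite -(natr1 n.+1) mulrDl mul1r.
  rewrite psumD //; last exact: subexp_shift (sa x y).
  by rewrite /=; ring.
rewrite -E [LHS](psum_shift sd r1) {1}(psum_shift (sq x y) r1).
have -> : (fun n => n.+2%:R * a x y n.+2) =
   (fun n => Num.sqrt 2 * x * q x y n.+1 +
     (- (Num.sqrt 2 * y) * q x y n + n.+1%:R * a x y n)).
  apply/funext => n.
  have -> : n.+2%:R * a x y n.+2 = s n.+2 * s n.+2 * a x y n.+2.
    by rewrite -expr2 sqr_sqrt_nat.
  have -> : s n.+2 * s n.+2 * a x y n.+2 = (s n.+2 * h n.+2 x) * (s n.+2 * h n.+2 y).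
    by rewrite /a; ring.
  rewrite {1}hermite_fun_rec mulrBl.
  have -> : s n.+1 * h n x * (s n.+2 * h n.+2 y) =
     s n.+1 * h n x * (Num.sqrt 2 * y * h n.+1 y - s n.+1 * h n y).
    by rewrite hermite_fun_rec.
  have -> : n.+1%:R * a x y n = s n.+1 * s n.+1 * a x y n.
    by rewrite -expr2 sqr_sqrt_nat.
  rewrite /q /a; ring.
have s1 : subexp (fun n => Num.sqrt 2 * x * q x y n.+1).
  exact: subexpM (subexp_cst _) (subexp_shift (sq x y)).
have s2 : subexp (fun n => - (Num.sqrt 2 * y) * q x y n).
  exact: subexpM (subexp_cst _) (sq x y).
rewrite (psumD s1 (subexpD s2 sn) r1) (psumD s2 sn r1).
rewrite !psumZ //; last exact: subexp_shift (sq x y).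
have -> : 1%:R * a x y 1 = Num.sqrt 2 * x * q x y 0.
  have -> : 1%:R * a x y 1 = s 1 * s 1 * a x y 1 by rewrite -expr2 sqr_sqrt_nat.
  rewrite /q /a; transitivity ((s 1 * h 1 x) * (s 1 * h 1 y)); first by ring.
  rewrite hermite_fun_rec0; ring.
by ring.
Qed.

Let psum_a'E x y r : `|r| < 1 ->
  (1 - r ^+ 2) ^+ 2 * psum (fun n => n.+1%:R * a x y n.+1) r =
  (2 * (x - r * y) * (y - r * x) + r * (1 - r ^+ 2)) * psum (a x y) r.
Proof.
move=> r1; have E1 := psum_q x y r1; have E2 := psum_q y x r1.
have E3 := psum_a' x y r1.
have ayx : a y x = a x y by apply/funext => n; rewrite /a mulrC.
rewrite ayx in E2; rewrite E1 in E2.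
move: (psum (fun n => _) r) (psum (a x y) r) (psum (q x y) r) E2 E3 => A' A Q E2 E3.
(* The relations for [q x y] and [q y x] form a 2 by 2 linear system of determinant 1 - r^2, solved
   here for [q x y]. *)
have E4 : (1 - r ^+ 2) * Q = Num.sqrt 2 * (y - r * x) * A.
  by rewrite mulrBl {1}E2; ring.
have E5 : (1 - r ^+ 2) * A' = Num.sqrt 2 * (x - r * y) * Q + r * A.
  by rewrite mulrBl {1}E3; ring.
rewrite expr2 -mulrA E5 mulrDr.
have -> : (1 - r ^+ 2) * (Num.sqrt 2 * (x - r * y) * Q) =
  Num.sqrt 2 * (x - r * y) * ((1 - r ^+ 2) * Q) by ring.
rewrite E4.
have -> : 2 * (x - r * y) * (y - r * x) = Num.sqrt 2 ^+ 2 * (x - r * y) * (y - r * x).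
  by rewrite sqr_sqrt2.
ring.
Qed.

Definition mehler_exponent x y r : R :=
  ((x ^+ 2 + y ^+ 2) * (1 + r ^+ 2) / 2 - 2 * x * y * r) / (1 - r ^+ 2).

Theorem mehler x y r : 0 <= r -> r < 1 ->
  psum (fun n => h n x * h n y) r =
  (Num.sqrt pi * Num.sqrt (1 - r ^+ 2))^-1 * expR (- mehler_exponent x y r).
Proof.
move=> r0 r1.
(* The series divided by the claimed closed form, up to the factor sqrt pi. The ODE makes this
   quotient constant, and its value at 0 involves only h_0. *)
pose D z := psum (a x y) z * Num.sqrt (1 - z ^+ 2) * expR (mehler_exponent x y z).
have z2 (z : R) : `|z| < 1 -> 0 < 1 - z ^+ 2.
  by move=> z1; rewrite subr_gt0 -real_normK ?num_real // expr_lt1.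
have dD (z : R) : `|z| < 1 -> is_derive z 1 D 0.
  move=> z1.
  have dA := is_derive_psum (sa x y) z1.
  have z0 := z2 z z1.
  have dm : is_derive z 1 (mehler_exponent x y)
    (- (2 * (x - z * y) * (y - z * x)) / (1 - z ^+ 2) ^+ 2).
    rewrite /mehler_exponent.
    have zn : 1 - z ^+ 2 != 0 by rewrite gt_eqF.
    apply: is_derive_eq; rewrite /GRing.scale /=; field.
    by rewrite zn.
  have ds : is_derive z 1 (fun w => Num.sqrt (1 - w ^+ 2)) (- z / Num.sqrt (1 - z ^+ 2)).
    have d1 := is_derive1_sqrt z0.
    have d2 : is_derive z 1 (fun w : R => 1 - w ^+ 2) (- (2 * z)).
      by apply: is_derive_eq; rewrite /GRing.scale /=; ring.
    apply: (is_derive_comp_eq (g := fun w : R => 1 - w ^+ 2) d1 d2).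
    have : Num.sqrt (1 - z ^+ 2) != 0 by rewrite gt_eqF // sqrtr_gt0.
    by move=> ?; field.
  have de : is_derive z 1 (expR \o mehler_exponent x y)
      (expR (mehler_exponent x y z) * (- (2 * (x - z * y) * (y - z * x)) / (1 - z ^+ 2) ^+ 2)).
    exact: is_derive1_comp.
  rewrite /D; apply: is_derive_eq; rewrite /GRing.scale /=.
  have E := psum_a'E x y z1.
  have S : Num.sqrt (1 - z ^+ 2) ^+ 2 = 1 - z ^+ 2 by rewrite sqr_sqrtr // ltW.
  have s0 : Num.sqrt (1 - z ^+ 2) != 0 by rewrite gt_eqF // sqrtr_gt0.
  have -> : psum (fun n => n.+1%:R * a x y n.+1) z =
    (2 * (x - z * y) * (y - z * x) + z * (1 - z ^+ 2)) * psum (a x y) z / (1 - z ^+ 2) ^+ 2.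
    by rewrite -E mulrC mulKf // expf_neq0 // gt_eqF.
  move: (Num.sqrt _) S s0 => s <- s0.
  by field.
have D0 : D 0 = (Num.sqrt pi)^-1.
  rewrite /D (psum_shift (sa x y)) ?normr0 // mul0r addr0 /a !hermite_funE.
  rewrite /mehler_exponent expr0n /= !(subr0, mulr0, divr1, addr0, mulr1) sqrtr1 mulr1.
  rewrite !horner_hermite0 /hermite_norm expr0 !mulr1.
  set E := expR (- (x ^+ 2 / 2)); set E' := expR (- (y ^+ 2 / 2)).
  have -> : expR ((x ^+ 2 + y ^+ 2) / 2) = E^-1 * E'^-1.
    by rewrite -!expRN !opprK -expRD; congr expR; ring.
  have -> : (Num.sqrt (Num.sqrt pi))^-1 * E * ((Num.sqrt (Num.sqrt pi))^-1 * E') * (E^-1 * E'^-1) =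
     (Num.sqrt (Num.sqrt pi) ^+ 2 : R)^-1.
    have Q0 : Num.sqrt (Num.sqrt pi) != 0 :> R by rewrite gt_eqF // !sqrtr_gt0 pi_gt0.
    field; by rewrite Q0 !gt_eqF ?expR_gt0.
  by rewrite sqr_sqrtr ?sqrtr_ge0.
have Dr : D r = (Num.sqrt pi)^-1.
  rewrite -D0; have [->//|rn0] := eqVneq r 0.
  have r0' : 0 < r by rewrite lt_neqAle eq_sym rn0.
  have [||c _] := @MVT _ D (fun=> 0) 0 r r0'.
  - move=> z; rewrite in_itv /= => /andP[z0 zr]; apply: dD.
    by rewrite ger0_norm ?(ltW z0) // (lt_trans zr).
  - apply: derivable_within_continuous => z; rewrite in_itv /= => /andP[z0 zr].
    have z1 : `|z| < 1 by rewrite ger0_norm // (le_lt_trans zr).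
    by have [] := dD z z1.
  - by rewrite mul0r => /eqP; rewrite subr_eq0 => /eqP.
have r1' : `|r| < 1 by rewrite ger0_norm.
have s0 : 0 < Num.sqrt (1 - r ^+ 2) by rewrite sqrtr_gt0 z2.
rewrite invfM -Dr /D expRN; move: (expR_gt0 (mehler_exponent x y r)).
move: (expR _) => E E0; rewrite -/(a x y); field.
by rewrite !gt_eqF.
Qed.

End Mehler.

(** * Series with explicit majorants and termwise differentiation *)

Section Summability.
Variable R : realType.
Implicit Types (u : nat -> R) (x d C : R) (n : nat).

Lemma norm_cvg_le (T : Type) (F : set_system T) (FF : ProperFilter F)
  (f : T -> R) (l C : R) : f @ F --> l -> (\forall t \near F, `|f t| <= C) -> `|l| <= C.
Proof.
move=> fl fC; have fl' : (fun t => `|f t|) @ F --> `|l| by apply: cvg_norm.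
by rewrite -(cvg_lim _ fl') //; apply: limr_le => //; apply/cvg_ex; exists `|l|.
Qed.

(** A universal comparison sequence: it telescopes to total mass 1 with tail 1/(n+1), so domination
    by it gives convergence, a bound on the sum and a rate at once. *)
Definition tele n : R := (n.+1%:R * n.+2%:R)^-1.

Lemma tele_gt0 n : 0 < tele n.
Proof. by rewrite invr_gt0 mulr_gt0 // ltr0n. Qed.

Lemma sum_tele (m n : nat) : (m <= n)%N ->
  \sum_(m <= i < n) tele i = m.+1%:R^-1 - n.+1%:R^-1.
Proof.
move=> mn; rewrite (@telescope_sumr_eq _ _ _ (fun i => - i.+1%:R^-1)) //.
  by rewrite opprK addrC.
move=> k _; rewrite /tele -[k.+2%:R]natr1.
have : k.+1%:R != 0 :> R by rewrite pnatr_eq0.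
have : k.+1%:R + 1 != 0 :> R by rewrite natr1 pnatr_eq0.
by move: (k.+1%:R) => K ? ?; field; apply/andP; split.
Qed.

Lemma summable_tele u C : (forall n, `|u n| <= C * tele n) -> cvgn (series u).
Proof.
move=> uC; have C0 : 0 <= C.
  by have := le_trans (normr_ge0 _) (uC 0%N); rewrite pmulr_lge0 // tele_gt0.
apply: normed_cvg; apply: nondecreasing_is_cvgn.
  by apply: nondecreasing_series => n _ _; rewrite /=.
exists C => _ [n _ <-]; rewrite /series /=.
apply: (@le_trans _ _ (\sum_(0 <= i < n) C * tele i)).
  exact: ler_sum.
by rewrite -mulr_sumr sum_tele // ler_piMr // invr1 gerBl invr_ge0.
Qed.

Lemma series_tail u C : (forall n, `|u n| <= C * tele n) ->
  forall n, `|limn (series u) - series u n| <= C / n.+1%:R.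
Proof.
move=> uC n; have cu := summable_tele uC.
have C0 : 0 <= C.
  by have := le_trans (normr_ge0 _) (uC 0%N); rewrite pmulr_lge0 // tele_gt0.
apply: (@norm_cvg_le _ \oo _ (fun m => series u m - series u n)).
  by apply: cvgB; [exact: cu|exact: cvg_cst].
near=> m; have nm : (n <= m)%N by near: m; exact: nbhs_infty_ge.
rewrite sub_series_geq //; apply: le_trans (ler_norm_sum _ _ _) _.
apply: (@le_trans _ _ (\sum_(n <= i < m) C * tele i)); first exact: ler_sum.
by rewrite -mulr_sumr sum_tele // ler_wpM2l // gerBl invr_ge0.
Unshelve. all: by end_near. Qed.

Lemma norm_series_le u C : (forall n, `|u n| <= C * tele n) ->
  `|limn (series u)| <= C.
Proof.
by move=> uC; have := series_tail uC 0; rewrite /series /= big_geq // subr0 divr1.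
Qed.

Lemma is_derive_quadratic (f : R -> R) x d C :
  (forall y, `|f (y + x) - f x - y * d| <= C * y ^+ 2) -> is_derive x 1 f d.
Proof.
move=> fC; have C0 : 0 <= C.
  by have := le_trans (normr_ge0 _) (fC 1); rewrite expr1n mulr1.
have cv : y^-1 *: (f (y *: (1 : R) + x) - f x) @[y --> (0:R)^'] --> d.
  apply/cvgrPdist_le => e e0; near=> y.
  have y0 : y != 0 by near: y; exact: nbhs_dnbhs_neq.
  rewrite [y *: _]mulr1 /GRing.scale /=.
  have -> : d - y^-1 * (f (y + x) - f x) = - (y^-1 * (f (y + x) - f x - y * d)) by field.
  rewrite normrN normrM normfV ler_pdivrMl ?normr_gt0 //.
  apply: le_trans (fC y) _; rewrite -real_normK ?num_real // expr2 mulrCA ler_wpM2l //.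
  have : `|y| < e / (C + 1).
    near: y; apply: nbhs_dnbhs; apply: (@nbhs0_lt _ R^o); rewrite divr_gt0 // ltr_wpDl //.
  rewrite ltr_pdivlMr ?ltr_wpDl // => /ltW; apply: le_trans.
  by rewrite mulrC ler_wpM2l // lerDl.
apply: DeriveDef; first by apply/cvg_ex; exists d.
exact: cvg_lim cv.
Unshelve. all: by end_near. Qed.

Lemma mvt_lipschitz (f df : R -> R) (C : R) :
  (forall x, is_derive x 1 f (df x)) -> (forall x, `|df x| <= C) ->
  forall x y, `|f x - f y| <= C * `|x - y|.
Proof.
move=> fd dC x y; wlog xy : x y / x < y.
  move=> H; have [xy|yx|->] := ltgtP x y; first exact: H.
    by rewrite distrC [`|x - y|]distrC; exact: H.
  by rewrite !subrr normr0 mulr0.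
have [|c _ E] := @MVT _ f df x y xy.
  by apply: derivable_within_continuous => z _; have [] := fd z.
by rewrite distrC E normrM [`|x - y|]distrC ler_wpM2r.
Qed.

Lemma mvt_quadratic (f df : R -> R) (C : R) : 0 <= C ->
  (forall x, is_derive x 1 f (df x)) ->
  (forall x y, `|df x - df y| <= C * `|x - y|) ->
  forall x y, `|f (y + x) - f x - y * df x| <= C * y ^+ 2.
Proof.
move=> C0 fd dC x y.
have C' z : `|z| <= `|y| -> `|df (z + x) - df x| <= C * `|y|.
  by move=> zy; apply: le_trans (dC _ _) _; rewrite addrK ler_wpM2l.
have : `|f (y + x) - f x - y * df x| <= C * `|y| * `|y|; last first.
  by rewrite -mulrA -expr2 real_normK ?num_real.
have dz (z : R) : is_derive z 1 (fun z => f z - z * df x) (df z - df x).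
  by have := fd z => fz; apply: is_derive_eq; rewrite /GRing.scale /= mulr1; ring.
have -> : f (y + x) - f x - y * df x =
   (f (y + x) - (y + x) * df x) - (f x - x * df x) by ring.
have ct a b : {within `[a, b], continuous (fun z => f z - z * df x)}.
  by apply: derivable_within_continuous => z _; have [] := dz z.
have [y0|y0|->] := ltgtP y 0; last by rewrite add0r subrr normr0 mulr0.
  have [||c + E] := @MVT _ (fun z => f z - z * df x) (fun z => df z - df x) (y + x) x.
  - by rewrite gtrDr.
  - exact: ct.
  rewrite in_itv /= => /andP[c1 c2]; rewrite distrC E normrM.
  have -> : x - (y + x) = - y by ring.
  rewrite normrN ler_wpM2r //; have := C' (c - x); rewrite subrK; apply.
  rewrite ltr0_norm ?subr_lt0 // ltr0_norm //; lra.
have [||c + E] := @MVT _ (fun z => f z - z * df x) (fun z => df z - df x) x (y + x).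
- by rewrite ltrDr.
- exact: ct.
rewrite in_itv /= => /andP[c1 c2]; rewrite E normrM addrK.
rewrite ler_wpM2r //; have := C' (c - x); rewrite subrK; apply.
rewrite gtr0_norm ?subr_gt0 // gtr0_norm //; lra.
Qed.

(** The Lipschitz constants of the derivatives [df n] are summable, so the quadratic Taylor
    remainders of the terms add up to at most C y^2, which identifies the derivative of the sum. *)
Lemma is_derive_series (f df : nat -> R -> R) (C : R) :
  (forall n x, is_derive x 1 (f n) (df n x)) ->
  (forall n x y, `|df n x - df n y| <= C * tele n * `|x - y|) ->
  (forall x, exists K, forall n, `|f n x| <= K * tele n) ->
  (forall x, exists K, forall n, `|df n x| <= K * tele n) ->
  forall x, is_derive x 1 (fun z => limn (series (f ^~ z)))
    (limn (series (df ^~ x))).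
Proof.
move=> fd dC fK dK x; apply: (@is_derive_quadratic _ _ _ C) => y.
have C0 : 0 <= C.
  have := le_trans (normr_ge0 _) (dC 0%N 1 0).
  by rewrite subr0 normr1 mulr1 pmulr_lge0 // tele_gt0.
have [K1 h1] := fK x; have [K2 h2] := fK (y + x); have [K3 h3] := dK x.
have c1 := summable_tele h1; have c2 := summable_tele h2; have c3 := summable_tele h3.
have q n : `|f n (y + x) - f n x - y * df n x| <= C * y ^+ 2 * tele n.
  rewrite mulrAC; apply: mvt_quadratic => //.
  by rewrite mulr_ge0 // ltW // tele_gt0.
have := norm_series_le q; apply: le_trans; rewrite le_eqVlt; apply/orP; left; apply/eqP.
congr `| _ |; symmetry; apply: cvg_lim => //.
have -> : series (fun n => f n (y + x) - f n x - y * df n x) =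
   (fun n => series (f ^~ (y + x)) n - series (f ^~ x) n - y * series (df ^~ x) n).
  by apply/funext => n; rewrite /series /= mulr_sumr -!sumrB.
apply: cvgB; first by apply: cvgB.
by apply: cvgM => //; exact: cvg_cst.
Qed.

End Summability.

(** * Polynomial bounds in n for the Hermite functions *)

Section HermiteBounds.
Variable R : realType.
Implicit Types (x y r C : R) (n m : nat) (a : nat -> R).
Notation h := (@hermite_fun R).
Notation s n := (Num.sqrt (n%:R : R)).

(** On the diagonal all terms of the Mehler sum are nonnegative and the exponential is at most 1, so
    h_n(x)^2 r^n <= (pi (1 - r^2))^(-1/2). At r = 1 - 1/(n+2) the right side is at most n+2, and r^n
    >= 1/(n+2) by Bernoulli. *)
Lemma hermite_fun_le n x : `|h n x| <= n.+2%:R.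
Proof.
pose r : R := n.+1%:R / n.+2%:R.
have n2 : 0 < n.+2%:R :> R by rewrite ltr0n.
have r0 : 0 < r by rewrite divr_gt0 // ltr0n.
have r1 : r < 1 by rewrite ltr_pdivrMr // mul1r ltr_nat.
have nr : `|r| < 1 by rewrite gtr0_norm.
have rE : 1 - r = n.+2%:R^-1.
  rewrite /r; move: n2; rewrite -[n.+2%:R]natr1; move: (n.+1%:R) => z z0.
  by field; rewrite gt_eqF.
have se : subexp (fun m => h m x * h m x).
  by apply: subexpM; exact: subexp_hermite_fun.
have T0 m : 0 <= h m x * h m x * r ^+ m.
  by rewrite mulr_ge0 -?expr2 ?sqr_ge0 // exprn_ge0 // ltW.
have le1 : h n x * h n x * r ^+ n <= psum (fun m => h m x * h m x) r.
  have nd : nondecreasing_seq (pseries (fun m => h m x * h m x) r).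
    exact: (@nondecreasing_series _ _ xpredT 0 (fun m _ _ => T0 m)).
  apply: le_trans (nondecreasing_cvgn_le nd (subexp_cvg se nr) n.+1).
  by rewrite /pseries /series /= big_nat_recr //= lerDr sumr_ge0.
have e0 : 0 <= mehler_exponent x x r.
  rewrite /mehler_exponent divr_ge0 //; last by rewrite subr_ge0 exprn_ile1 // ltW.
  have -> : (x ^+ 2 + x ^+ 2) * (1 + r ^+ 2) / 2 - 2 * x * x * r = (x * (1 - r)) ^+ 2.
    by field.
  exact: sqr_ge0.
have le2 : psum (fun m => h m x * h m x) r <= n.+2%:R.
  rewrite (mehler x x (ltW r0) r1).
  have p1 : 1 <= Num.sqrt pi :> R.
    by rewrite -[leLHS]sqrtr1 ler_sqrt ?pi_ge0 // (le_trans _ (pi_ge2 R)) // ler1n.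
  have q1 : n.+2%:R^-1 <= Num.sqrt (1 - r ^+ 2).
    rewrite -rE -[leLHS]ger0_norm ?subr_ge0 ?(ltW r1) // -sqrtr_sqr ler_sqrt; last first.
      by rewrite subr_ge0 exprn_ile1 // ltW.
    by have := ltW r0; have := ltW r1; nra.
  have q0 : 0 < n.+2%:R^-1 :> R by rewrite invr_gt0.
  rewrite -[leRHS]mulr1 ler_pM ?expR_ge0 ?invr_ge0 ?mulr_ge0 ?sqrtr_ge0 //; last first.
    by rewrite -[leRHS]expR0 ler_expR oppr_le0.
  rewrite -[leRHS]invrK lef_pV2 ?posrE //; last first.
    by rewrite mulr_gt0 // ?(lt_le_trans _ p1) // (lt_le_trans _ q1).
  by rewrite -[leLHS]mul1r ler_pM // ltW.
have B : n.+2%:R^-1 <= r ^+ n.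
  have bern m : 1 - m%:R * n.+2%:R^-1 <= r ^+ m.
    elim: m => [|m IH]; first by rewrite mul0r subr0 expr0.
    rewrite exprS; apply: le_trans (_ : r * (1 - m%:R * n.+2%:R^-1) <= _); last first.
      by rewrite ler_wpM2l // ltW.
    have -> : r = 1 - n.+2%:R^-1 by rewrite -rE; ring.
    rewrite -natr1; have : 0 <= m%:R * (n.+2%:R^-1 * n.+2%:R^-1) :> R.
      by rewrite !mulr_ge0 // invr_ge0.
    move: (n.+2%:R^-1) (m%:R) => w z; nra.
  apply: le_trans (bern n); rewrite -[n.+2%:R]natr1 -natr1.
  have : 0 <= n%:R :> R by [].
  move: (n%:R) => z z0; rewrite lerBrDr -{1}[(z + 1 + 1)^-1]mul1r -mulrDl.
  by rewrite ler_pdivrMr; lra.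
rewrite -[leRHS]ger0_norm // -ler_sqr ?nnegrE // real_normK ?num_real // expr2.
have := le_trans le1 le2; rewrite -ler_pdivlMr ?exprn_gt0 // => /le_trans; apply.
rewrite real_normK ?num_real // expr2 ler_wpM2l //.
by rewrite -[leRHS]invrK lef_pV2 ?posrE ?invr_gt0 // exprn_gt0.
Qed.

(* The index shift in [h n.-1] is harmless: its coefficient vanishes at n = 0. *)
Lemma mulx_hermite_fun n x :
  x * h n x = (s n.+1 * h n.+1 x + s n * h n.-1 x) / Num.sqrt 2.
Proof.
have s0 : Num.sqrt 2 != 0 :> R by rewrite gt_eqF // sqrt2_gt0.
apply: (mulfI s0); rewrite mulrA; case: n => [|n].
  by rewrite -hermite_fun_rec0 sqrtr0 mul0r addr0; field.
by rewrite hermite_fun_rec /=; field.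
Qed.

Lemma sqrt_nat_le n : s n <= n%:R.
Proof.
case: n => [|n]; first by rewrite sqrtr0.
rewrite -[leRHS]sqr_sqrt_nat expr2 ler_peMr ?sqrtr_ge0 //.
by rewrite -[leLHS]sqrtr1 ler_sqrt // ler1n.
Qed.

Lemma sqrt2_le2 : Num.sqrt 2 <= 2 :> R.
Proof. by have := sqrt_nat_le 2. Qed.

Lemma sqrt2_ge1 : 1 <= Num.sqrt 2 :> R.
Proof. by rewrite -[leLHS]sqrtr1 ler_sqrt // ler1n. Qed.

(* Both the derivative of h_n and multiplication by x are of the form
   (+- sqrt(n+1) h_(n+1) + sqrt n h_(n-1)) / sqrt 2, so each of them costs one
   power of n. *)
Lemma ladder_bound (u v : nat -> R) C m : 
  (forall n, `|u n| <= C * n.+1%:R ^+ m) ->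
  (forall n, `|v n| <= s n.+1 * `|u n.+1| + s n * `|u n.-1|) ->
  forall n, `|v n| <= C * (2 ^+ m + 1) * n.+1%:R ^+ m.+1.
Proof.
move=> uC vu n; apply: le_trans (vu n) _.
have C0 : 0 <= C.
  by have := le_trans (normr_ge0 _) (uC 0%N); rewrite expr1n mulr1.
have n1 : 1 <= n.+1%:R :> R by rewrite ler1n.
have -> : C * (2 ^+ m + 1) * n.+1%:R ^+ m.+1 =
   n.+1%:R * (C * (2 * n.+1%:R) ^+ m) + n.+1%:R * (C * n.+1%:R ^+ m).
  by rewrite exprMn exprS; ring.
apply: lerD; apply: ler_pM; rewrite ?sqrtr_ge0 ?sqrt_nat_le //.
- apply: le_trans (uC _) _; rewrite ler_wpM2l // lerXn2r ?nnegrE ?mulr_ge0 //.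
  by rewrite -natrM ler_nat; lia.
- by apply: le_trans (sqrt_nat_le _) _; rewrite ler_nat.
- apply: le_trans (uC _) _; rewrite ler_wpM2l // lerXn2r ?nnegrE //.
  by rewrite ler_nat; lia.
Qed.

(** The ladder for multiplication by x holds for h_n(x) and again for x h_n(x), so [ladder_bound]
    can be applied twice, up to x^2 h_n(x). *)
Lemma mulx_hermite_ladder (u : nat -> R) x n :
  (u = fun n => x ^+ 0 * h n x) \/ (u = fun n => x * h n x) -> 
  `|x * u n| <= s n.+1 * `|u n.+1| + s n * `|u n.-1|.
Proof.
move=> H; have -> : x * u n = (s n.+1 * u n.+1 + s n * u n.-1) / Num.sqrt 2.
  by case: H => ->; rewrite ?expr0 ?mul1r mulx_hermite_fun //; ring.
rewrite normrM normfV [`|Num.sqrt 2|]ger0_norm ?sqrtr_ge0 // ler_pdivrMr ?sqrt2_gt0 //.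
apply: le_trans (ler_normD _ _) _; rewrite !normrM !(ger0_norm (sqrtr_ge0 _)).
by rewrite ler_peMr ?sqrt2_ge1 // addr_ge0 // mulr_ge0 ?sqrtr_ge0.
Qed.

(** 32 = 2 + 30: the constant 2 bounds |h_n|, and two ladder steps turn it into 2 (2^1 + 1) (2^2 +
    1) = 30 for x^2 h_n. *)
Definition hermite_bound : R := 32.

(** The weight makes h_n square integrable with a norm polynomial in n, which is what convergence of
    Hermite series in L^2 uses later. *)
Lemma hermite_fun_weighted n x :
  `|h n x| * (1 + x ^+ 2) <= hermite_bound * n.+1%:R ^+ 3.
Proof.
have b0 k : `|x ^+ 0 * h k x| <= 2 * k.+1%:R ^+ 1.
  rewrite expr0 mul1r expr1; apply: le_trans (hermite_fun_le k x) _.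
  by rewrite -natrM ler_nat; lia.
have b1 := ladder_bound b0 (fun n => @mulx_hermite_ladder _ x n (or_introl erefl)).
have b1' k : `|x * h k x| <= 2 * (2 ^+ 1 + 1) * k.+1%:R ^+ 2.
  by have := b1 k; rewrite expr0 mul1r.
have b2 := ladder_bound b1' (fun n => @mulx_hermite_ladder _ x n (or_intror erefl)) n.
rewrite mulrDr mulr1 -[x ^+ 2]ger0_norm ?sqr_ge0 // -normrM mulrC expr2 -mulrA.
have n1 : 1 <= n.+1%:R :> R by rewrite ler1n.
have p3 : n.+1%:R <= n.+1%:R ^+ 3 :> R by rewrite -[leLHS]expr1 ler_weXn2l.
have := b0 n; rewrite expr0 mul1r expr1 => b0n.
rewrite /hermite_bound; move: b2; rewrite !exprS !expr0 !mulr1; move: p3; rewrite !exprS !expr0; lra.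
Qed.

Lemma hermite_fun_poly n x : `|h n x| <= hermite_bound * n.+1%:R ^+ 3.
Proof.
apply: le_trans (hermite_fun_weighted n x).
by rewrite ler_peMr // lerDl sqr_ge0.
Qed.

Definition hermite_fun' n x : R :=
  (s n * h n.-1 x - s n.+1 * h n.+1 x) / Num.sqrt 2.

Lemma is_derive_hermite_fun' n x : is_derive x 1 (h n) (hermite_fun' n x).
Proof.
have := is_derive_hermite_fun n x => D; apply: is_derive_eq.
have s0 : Num.sqrt 2 != 0 :> R by rewrite gt_eqF // sqrt2_gt0.
rewrite mulx_hermite_fun /hermite_fun'.
rewrite -[Num.sqrt 2 * _ * _](mulfK s0) -mulrBl; congr (_ / _).
have -> : Num.sqrt 2 * s n.+1 * h n.+1 x * Num.sqrt 2 =
  Num.sqrt 2 ^+ 2 * s n.+1 * h n.+1 x by ring.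
rewrite sqr_sqrt2; ring.
Qed.

Lemma hermite_fun'_ladder n x y :
  `|hermite_fun' n x - hermite_fun' n y| <=
  s n.+1 * `|h n.+1 x - h n.+1 y| + s n * `|h n.-1 x - h n.-1 y|.
Proof.
rewrite /hermite_fun' -mulrBl normrM normfV [`|Num.sqrt 2|]ger0_norm ?sqrtr_ge0 //.
rewrite ler_pdivrMr ?sqrt2_gt0 //.
have -> : s n * h n.-1 x - s n.+1 * h n.+1 x - (s n * h n.-1 y - s n.+1 * h n.+1 y) =
  - (s n.+1 * (h n.+1 x - h n.+1 y)) + s n * (h n.-1 x - h n.-1 y) by ring.
apply: le_trans (ler_normD _ _) _; rewrite normrN !normrM !(ger0_norm (sqrtr_ge0 _)).
by rewrite ler_peMr ?sqrt2_ge1 // addr_ge0 // mulr_ge0 ?sqrtr_ge0.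
Qed.

Lemma hermite_fun'_poly n x : `|hermite_fun' n x| <= hermite_bound * 9 * n.+1%:R ^+ 4.
Proof.
have := @ladder_bound (h ^~ x) (hermite_fun' ^~ x) hermite_bound 3.
have -> : (9 : R) = 2 ^+ 3 + 1 by rewrite !exprS expr0; ring.
apply => {}n; first exact: hermite_fun_poly.
rewrite /hermite_fun' normrM normfV [`|Num.sqrt 2|]ger0_norm ?sqrtr_ge0 //.
rewrite ler_pdivrMr ?sqrt2_gt0 // addrC.
apply: le_trans (ler_normD _ _) _.
rewrite normrN [X in X + _]normrM [X in _ + X <= _]normrM !(ger0_norm (sqrtr_ge0 _)).
by rewrite ler_peMr ?sqrt2_ge1 // addr_ge0 // mulr_ge0 ?sqrtr_ge0.
Qed.

(** The ladder is applied to the differences h_n(x) - h_n(y), bounded by the mean value theorem. The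
    factors 9 = 2^3 + 1 and 17 = 2^4 + 1 come from the ladder steps of degree 3 and 4. *)
Lemma hermite_fun'_lipschitz n x y :
  `|hermite_fun' n x - hermite_fun' n y| <=
  hermite_bound * 9 * 17 * n.+1%:R ^+ 5 * `|x - y|.
Proof.
have L k : `|h k x - h k y| <= hermite_bound * 9 * `|x - y| * k.+1%:R ^+ 4.
  rewrite mulrAC; apply: (mvt_lipschitz (is_derive_hermite_fun' k)) => z.
  exact: hermite_fun'_poly.
have := @ladder_bound _ (fun n => hermite_fun' n x - hermite_fun' n y) _ _ L
  (fun n => hermite_fun'_ladder n x y) n.
have -> : (17 : R) = 2 ^+ 4 + 1 by rewrite !exprS expr0; ring.
by move=> /le_trans; apply; rewrite le_eqVlt; apply/orP; left; apply/eqP; ring.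
Qed.

End HermiteBounds.

(** * Hermite series with rapidly decreasing coefficients *)

Section HermiteSeries.
Variable R : realType.
Implicit Types (x y C K : R) (n m p k : nat) (a b : nat -> R).
Notation h := (@hermite_fun R).
Notation s n := (Num.sqrt (n%:R : R)).

(** The coefficient side of the Schwartz space; d/dx + x acts on it by a shift and a factor of
    polynomial growth, both of which preserve it. *)
Definition rapid a := forall m, exists C, forall n, `|a n| * n.+1%:R ^+ m <= C.

Lemma rapidM a b K p : rapid a -> (forall n, `|b n| <= K * n.+1%:R ^+ p) ->
  rapid (fun n => b n * a n).
Proof.
move=> ra bK m; have [C hC] := ra (p + m)%N; exists (K * C) => n.
have K0 : 0 <= K.
  by have := le_trans (normr_ge0 _) (bK 0%N); rewrite expr1n mulr1.
rewrite normrM -mulrA (le_trans (ler_wpM2r _ (bK n))) ?mulr_ge0 //.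
by rewrite -mulrA ler_wpM2l // mulrCA -exprD.
Qed.

Lemma rapid_shift a : rapid a -> rapid (fun n => a n.+1).
Proof.
move=> ra m; have [C hC] := ra m; exists C => n; apply: le_trans (hC n.+1).
by rewrite ler_wpM2l // lerXn2r ?nnegrE // ler_nat.
Qed.

(** C is chosen before [b], so taking b n = h_n(x) gives bounds uniform in x. *)
Lemma rapid_tele a K p : rapid a -> exists C, forall b : nat -> R,
  (forall n, `|b n| <= K * n.+1%:R ^+ p) -> forall n, `|a n * b n| <= C * tele R n.
Proof.
move=> ra; have [C hC] := ra p.+2; exists (2 * K * C) => b bK n.
have K0 : 0 <= K.
  by have := le_trans (normr_ge0 _) (bK 0%N); rewrite expr1n mulr1.
rewrite /tele ler_pdivlMr ?mulr_gt0 // normrM.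
have -> : 2 * K * C = K * (2 * C) by ring.
apply: (@le_trans _ _ (`|a n| * (K * n.+1%:R ^+ p) * (n.+1%:R * (2 * n.+1%:R)))).
  apply: ler_pM; rewrite ?mulr_ge0 //; first by rewrite ler_wpM2l.
  by rewrite ler_wpM2l // -natrM ler_nat; lia.
have -> : `|a n| * (K * n.+1%:R ^+ p) * (n.+1%:R * (2 * n.+1%:R)) =
  K * (2 * (`|a n| * n.+1%:R ^+ p.+2)) by rewrite !exprS; ring.
by rewrite !ler_wpM2l.
Qed.

Definition hermite_series a x : R := limn (series (fun n => a n * h n x)).

Definition lower_coef a n : R := Num.sqrt 2 * s n.+1 * a n.+1.

Lemma rapid_lower_coef a : rapid a -> rapid (lower_coef a).
Proof.
move=> ra; apply: (@rapidM _ _ 2 1) (rapid_shift ra) _ => n.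
rewrite ger0_norm ?mulr_ge0 ?sqrtr_ge0 // expr1 ler_pM ?sqrtr_ge0 //.
  exact: sqrt2_le2.
exact: sqrt_nat_le.
Qed.

Lemma rapid_iter_lower_coef a k : rapid a -> rapid (iter k lower_coef a).
Proof. by move=> ra; elim: k => //= k; exact: rapid_lower_coef. Qed.

Lemma hermite_series_tele a : rapid a -> exists C, forall x n,
  `|a n * h n x| <= C * tele R n.
Proof.
move=> ra; have [C hC] := rapid_tele (hermite_bound R) 3 ra.
by exists C => x; apply: hC => n; exact: hermite_fun_poly.
Qed.

Lemma is_derive_hermite_series a x : rapid a ->
  is_derive x 1 (hermite_series a) (limn (series (fun n => a n * hermite_fun' n x))).
Proof.
move=> ra; have [C0 h0] := hermite_series_tele ra.
have [C1 h1] := rapid_tele (hermite_bound R * 9) 4 ra.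
have [C2 h2] := rapid_tele (hermite_bound R * 9 * 17) 5 ra.
apply: (@is_derive_series _ (fun n x => a n * h n x) (fun n x => a n * hermite_fun' n x) C2).
- move=> n z; have := is_derive_hermite_fun' n z => D; apply: is_derive_eq.
  by rewrite /GRing.scale /=; ring.
- move=> n z w; have [->|zw] := eqVneq z w; first by rewrite !subrr normr0 mulr0.
  have zw0 : 0 < `|z - w| by rewrite normr_gt0 subr_eq0.
  have := h2 (fun n => (hermite_fun' n z - hermite_fun' n w) / `|z - w|).
  rewrite -ler_pdivrMr // => H; apply: le_trans (H _ n) => [|{}n].
    by rewrite mulrA -mulrBr !normrM normfV normr_id.
  by rewrite normrM normfV normr_id ler_pdivrMr // hermite_fun'_lipschitz.
- by move=> z; exists C0 => n; exact: h0.
- by move=> z; exists C1; apply: h1 => n; exact: hermite_fun'_poly.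
Qed.

Lemma hermite_lower_series a : rapid a ->
  hermite_lower (hermite_series a) = hermite_series (lower_coef a).
Proof.
move=> ra; apply/funext => x; rewrite /hermite_lower.
have [D DE] := is_derive_hermite_series x ra.
rewrite derive1E DE.
have [C0 h0] := hermite_series_tele ra.
have [C1 h1] := rapid_tele (hermite_bound R * 9) 4 ra.
have [C2 h2] := hermite_series_tele (rapid_lower_coef ra).
have {}h1 n : `|a n * hermite_fun' n x| <= C1 * tele R n.
  by apply: (h1 (fun n => hermite_fun' n x)) => {}n; exact: hermite_fun'_poly.
have c0 := summable_tele (h0 x); have c1 := summable_tele h1.
have c2 := summable_tele (h2 x).
(* Since h_n' + x h_n = sqrt(2n) h_(n-1), the term n = 0 drops out and N+1 terms on the left match N
   terms of the lowered series. *)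
have E N : series (fun n => a n * hermite_fun' n x) N.+1 +
    x * series (fun n => a n * h n x) N.+1 = series (fun n => lower_coef a n * h n x) N.
  rewrite /series /= mulr_sumr -big_split /= big_nat_recl //=.
  have s0 : Num.sqrt 2 != 0 :> R by rewrite gt_eqF // sqrt2_gt0.
  have T n : a n * hermite_fun' n x + x * (a n * h n x) = a n * (Num.sqrt 2 * s n * h n.-1 x).
    rewrite [x * (_ * _)]mulrCA mulx_hermite_fun /hermite_fun' -mulrDr -mulrDl.
    have -> : s n * h n.-1 x - s n.+1 * h n.+1 x +
      (s n.+1 * h n.+1 x + s n * h n.-1 x) = Num.sqrt 2 ^+ 2 * (s n * h n.-1 x).
      by rewrite sqr_sqrt2; ring.
    by field.
  rewrite T sqrtr0 mulr0 mul0r mulr0 add0r.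
  by apply: eq_bigr => i _; rewrite T /lower_coef /=; ring.
symmetry; apply: cvg_lim => //.
have -> : series (fun n => lower_coef a n * h n x) = (fun N =>
  series (fun n => a n * hermite_fun' n x) N.+1 + x * series (fun n => a n * h n x) N.+1).
  by apply/funext => N; rewrite E.
apply: cvgD; last (apply: cvgM; first exact: cvg_cst).
  by rewrite (cvg_shiftS (series _)); exact: c1.
by rewrite (cvg_shiftS (series _)); exact: c0.
Qed.

Lemma iter_hermite_lower_series a k : rapid a ->
  iter k (@hermite_lower R) (hermite_series a) = hermite_series (iter k lower_coef a).
Proof.
move=> ra; elim: k => //= k ->; apply: hermite_lower_series.
exact: rapid_iter_lower_coef.
Qed.

(** This is (2^k (n+1) ... (n+k))^(1/2), the factor by which (d/dx + x)^k sends h_(n+k) to h_n. *)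
Fixpoint lower_weight k n : R :=
  if k is k'.+1 then Num.sqrt 2 * s n.+1 * lower_weight k' n.+1 else 1.

Lemma iter_lower_coef a k n :
  iter k lower_coef a n = lower_weight k n * a (n + k)%N.
Proof.
elim: k n => [|k IH] n /=; first by rewrite mul1r addn0.
by rewrite /lower_coef IH mulrA addnS addSn.
Qed.

Lemma continuous_hermite_series a : rapid a -> continuous (hermite_series a).
Proof.
move=> ra x; have [D _] := is_derive_hermite_series x ra.
by apply: differentiable_continuous; apply/derivable1_diffP.
Qed.

(** The factor 1/(n+1) is the tail of [tele], and the square integrable factor in x comes from the
    weighted bound on h_n; together they give convergence of the partial sums in L^2. *)
Lemma hermite_series_tail a : rapid a -> exists C, forall x n,
  `|hermite_series a x - \sum_(i < n) a i * h i x| <= C / n.+1%:R / (1 + x ^+ 2).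
Proof.
move=> ra; have [C hC] := rapid_tele (hermite_bound R) 3 ra.
exists C => x n; have x1 : 0 < 1 + x ^+ 2 by rewrite ltr_wpDr // sqr_ge0.
have := @series_tail R (fun n => a n * h n x) (C / (1 + x ^+ 2)) _ n.
rewrite /series /= big_mkord [in X in _ -> X]mulrAC; apply=> {}n.
rewrite mulrAC ler_pdivlMr // -[X in _ * X]gtr0_norm // -normrM -mulrA.
apply: (hC (fun n => h n x * (1 + x ^+ 2))) => {}n.
rewrite normrM [`|1 + _|]gtr0_norm //.
exact: hermite_fun_weighted.
Qed.

End HermiteSeries.

(** * Dominated convergence for real-valued integrals *)

Section DominatedConvergence.
Context d (T : measurableType d) (R : realType) (mu : {measure set T -> \bar R}).
Implicit Types (D : set T) (f g : T -> R).

Lemma integrable_dominated D f g : measurable D -> measurable_fun D f ->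
  (forall x, D x -> `|f x| <= g x) -> mu.-integrable D (EFin \o g) ->
  mu.-integrable D (EFin \o f).
Proof.
move=> mD mf fg ig; apply: le_integrable ig => //; first exact/measurable_EFinP.
by move=> x Dx; rewrite /= lee_fin (le_trans (fg x Dx)) // ler_norm.
Qed.

Lemma integrable_scale D g (c : R) : measurable D ->
  mu.-integrable D (EFin \o g) -> mu.-integrable D (EFin \o (fun x => c * g x)).
Proof.
move=> mD ig; have := integrableZl mD c ig.
by apply: eq_integrable => // x _; rewrite /= EFinM.
Qed.

Lemma Rintegral_dominated_cvg D (f_ : nat -> T -> R) f g :
  measurable D -> (forall n, measurable_fun D (f_ n)) ->
  (forall x, D x -> f_ ^~ x @ \oo --> f x) ->
  mu.-integrable D (EFin \o g) ->
  (forall n x, D x -> `|f_ n x| <= g x) ->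
  (\int[mu]_(x in D) f_ n x) @[n --> \oo] --> \int[mu]_(x in D) f x.
Proof.
move=> mD mf ff ig fg.
have mf' : measurable_fun D f by apply: measurable_fun_cvg ff.
have fg' x : D x -> `|f x| <= g x.
  move=> Dx; apply: (norm_cvg_le _ (ff x Dx)); apply: nearW => n; exact: fg.
have fi := integrable_dominated mD mf' fg' ig.
apply: fine_cvg; rewrite fineK; last exact: integrable_fin_num.
apply: (@dominated_cvg _ _ _ mu D mD (fun n x => (f_ n x)%:E) (EFin \o f) (EFin \o g)) => //.
- by move=> n; exact/measurable_EFinP.
- by move=> x Dx /=; apply: cvg_EFin; [exact: nearW|exact: ff].
Qed.

Lemma norm_Rintegral_le D f g : measurable D -> measurable_fun D f ->
  (forall x, D x -> `|f x| <= g x) -> mu.-integrable D (EFin \o g) ->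
  `|\int[mu]_(x in D) f x| <= \int[mu]_(x in D) g x.
Proof.
move=> mD mf fg ig; have fi := integrable_dominated mD mf fg ig.
apply: le_trans (le_normr_Rintegral mD fi) _; apply: le_Rintegral => //.
by have := integrable_abse fi.
Qed.

End DominatedConvergence.

(** * Integration on the half-line *)

Section HalfLine.
Variable R : realType.
Implicit Types (f F g : R -> R) (a b c t x : R) (n : nat).
Notation mu := (@lebesgue_measure R).

Definition ray : set R := `]0, +oo[%classic.
(** Compact segments exhausting the ray. The scale c makes [ray_seg c n] the image of [ray_seg 1 n]
    under t -> c t, and the shift to n+2 keeps the endpoints distinct at n = 0. *)
Definition ray_seg c n : set R := `[c / n.+1%:R, c * n.+2%:R]%classic.

Lemma rayP t : ray t <-> 0 < t.
Proof. by rewrite /ray /= in_itv /= andbT. Qed.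

Lemma measurable_ray : measurable ray. Proof. exact: measurable_itv. Qed.

Lemma measurable_ray_fun f : (forall t, 0 < t -> {for t, continuous f}) ->
  measurable_fun ray f.
Proof.
move=> cf; apply: open_continuous_measurable_fun; first exact: interval_open.
by move=> t; rewrite inE => /rayP; exact: cf.
Qed.

Lemma ray_seg_lt c n : 0 < c -> c / n.+1%:R < c * n.+2%:R.
Proof.
move=> c0; rewrite ltr_pM2l //; apply: (@le_lt_trans _ _ 1).
  by rewrite invf_le1 // ler1n.
by rewrite ltr1n.
Qed.

Lemma ray_seg_sub c n : 0 < c -> ray_seg c n `<=` ray.
Proof.
move=> c0 t; rewrite /ray_seg /= in_itv /= => /andP[h _]; apply/rayP.
by apply: lt_le_trans h; rewrite divr_gt0.
Qed.

Lemma ray_seg_nondecreasing c : 0 < c ->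
  {homo ray_seg c : n m / (n <= m)%N >-> (n <= m)%O}.
Proof.
move=> c0 n m nm; apply/subsetPset => t; rewrite /ray_seg /= !in_itv /=.
move=> /andP[h1 h2]; apply/andP; split.
  apply: le_trans h1; rewrite ler_pM2l // lef_pV2 ?posrE //.
  by rewrite ler_nat ltnS.
by apply: le_trans h2 _; rewrite ler_pM2l // ler_nat !ltnS.
Qed.

Lemma bigcup_ray_seg c : 0 < c -> \bigcup_n ray_seg c n = ray.
Proof.
move=> c0; apply/seteqP; split => [t [n _]|t /rayP t0]; first exact: ray_seg_sub.
pose M := Num.bound (c / t); pose N := Num.bound (t / c).
have tc : 0 <= t / c by rewrite divr_ge0 // ltW.
have ct : 0 <= c / t by rewrite divr_ge0 // ltW.
exists (maxn M N) => //; rewrite /ray_seg /= in_itv /=; apply/andP; split.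
  rewrite ler_pdivrMr // mulrC -ler_pdivrMr //.
  apply: (@le_trans _ _ M%:R); first exact/ltW/archi_boundP.
  by rewrite ler_nat; lia.
rewrite mulrC -ler_pdivrMr //; apply: (@le_trans _ _ N%:R).
  exact/ltW/archi_boundP.
by rewrite ler_nat; lia.
Qed.

Lemma ge0_ray_seg_cvg c f : 0 < c -> measurable_fun ray f ->
  (forall t, 0 < t -> 0 <= f t) ->
  (\int[mu]_(t in ray_seg c n) (f t)%:E)%E @[n --> \oo] -->
    (\int[mu]_(t in ray) (f t)%:E)%E.
Proof.
move=> c0 mf f0; rewrite -(bigcup_ray_seg c0).
apply: ge0_nondecreasing_set_cvg_integral.
- exact: ray_seg_nondecreasing.
- by move=> i; exact: measurable_itv.
- move=> i; apply/measurable_EFinP; apply: measurable_funS mf; first exact: measurable_ray.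
  exact: ray_seg_sub.
- by move=> i t /(ray_seg_sub c0)/rayP t0; rewrite lee_fin f0.
Qed.

Lemma FTC2_seg f F a b : a < b ->
  (forall t, a <= t <= b -> is_derive t 1 F (f t)) ->
  (forall t, a <= t <= b -> {for t, continuous f}) ->
  (\int[mu]_(t in `[a, b]) (f t)%:E)%E = (F b - F a)%:E.
Proof.
move=> ab dF cf.
have cF t : a <= t <= b -> {for t, continuous F}.
  move=> tab; have [D _] := dF t tab.
  by apply: differentiable_continuous; apply/derivable1_diffP.
rewrite (@continuous_FTC2 _ f F) ?EFinB //.
- apply: continuous_in_subspaceT => t; rewrite inE /= in_itv /=; exact: cf.
- split.
  + move=> t; rewrite in_itv /= => /andP[ta tb].
    by have [] := dF t; rewrite ?(ltW ta) ?(ltW tb).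
  + by apply: cvg_at_right_filter; apply: cF; rewrite lexx ltW.
  + by apply: cvg_at_left_filter; apply: cF; rewrite lexx ltW.
- move=> t; rewrite in_itv /= => /andP[ta tb].
  have tab : a <= t <= b by rewrite !ltW.
  by have [_ <-] := dF t tab; rewrite derive1E.
Qed.

Lemma FTC2_ray_seg f F n : (forall t, 0 < t -> is_derive t 1 F (f t)) ->
  (forall t, 0 < t -> {for t, continuous f}) ->
  (\int[mu]_(t in ray_seg 1 n) (f t)%:E)%E = (F (1 * n.+2%:R) - F (1 / n.+1%:R))%:E.
Proof.
move=> dF cf; have p t : 1 / n.+1%:R <= t <= 1 * n.+2%:R -> 0 < t.
  by move=> /andP[h _]; apply: lt_le_trans h; rewrite divr_gt0.
apply: FTC2_seg => [|t /p|t /p]; [exact: ray_seg_lt|exact: dF|exact: cf].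
Qed.

Lemma cvg_ray_seg_left c : 0 < c -> c / n.+1%:R @[n --> \oo] --> (0 : R).
Proof.
move=> c0; rewrite -[X in _ --> X](mulr0 c).
by apply: cvgM; [exact: cvg_cst|exact: cvg_harmonic].
Qed.

Lemma cvg_ray_seg_right c : 0 < c -> c * n.+2%:R @[n --> \oo] --> +oo.
Proof.
move=> c0; apply/cvgryPge => A; near=> n.
rewrite -ler_pdivrMl //.
apply: (@le_trans _ _ n%:R); last by rewrite ler_nat; lia.
near: n; exact: nbhs_infty_ger.
Unshelve. all: by end_near. Qed.

Lemma cvg_ray_seg_FTC F (A B : R) : F t @[t --> +oo] --> A -> F t @[t --> 0^'+] --> B ->
  (F (1 * n.+2%:R) - F (1 / n.+1%:R)) @[n --> \oo] --> A - B.
Proof.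
move=> FA FB; apply: cvgB.
  by apply: cvg_comp FA; exact: cvg_ray_seg_right.
move/cvg_at_rightP : FB; apply; split; last exact: cvg_ray_seg_left.
by move=> n; rewrite divr_gt0.
Qed.

Lemma ge0_improper_FTC f F (A B : R) :
  (forall t, 0 < t -> is_derive t 1 F (f t)) ->
  (forall t, 0 < t -> {for t, continuous f}) ->
  (forall t, 0 < t -> 0 <= f t) ->
  F t @[t --> +oo] --> A -> F t @[t --> 0^'+] --> B ->
  (\int[mu]_(t in ray) (f t)%:E)%E = (A - B)%:E.
Proof.
move=> dF cf f0 FA FB.
have := ge0_ray_seg_cvg ltr01 (measurable_ray_fun cf) f0.
have -> : (fun n => \int[mu]_(t in ray_seg 1 n) (f t)%:E)%E =
    (fun n => (F (1 * n.+2%:R) - F (1 / n.+1%:R))%:E).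
  by apply/funext => n; exact: FTC2_ray_seg.
move=> /cvg_lim <- //; apply: cvg_lim => //; apply: cvg_EFin; first exact: nearW.
exact: cvg_ray_seg_FTC FA FB.
Qed.

Lemma ge0_improper_FTC_integrable f F (A B : R) :
  (forall t, 0 < t -> is_derive t 1 F (f t)) ->
  (forall t, 0 < t -> {for t, continuous f}) ->
  (forall t, 0 < t -> 0 <= f t) ->
  F t @[t --> +oo] --> A -> F t @[t --> 0^'+] --> B ->
  mu.-integrable ray (EFin \o f).
Proof.
move=> dF cf f0 FA FB; apply/integrableP; split.
  by apply/measurable_EFinP; exact: measurable_ray_fun.
have -> : (\int[mu]_(t in ray) `|(EFin \o f) t|)%E = (\int[mu]_(t in ray) (f t)%:E)%E.
  by apply: eq_integral => t; rewrite inE => /rayP t0; rewrite /= ger0_norm ?f0.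
by rewrite (ge0_improper_FTC dF cf f0 FA FB) ltry.
Qed.

(** For integrands that change sign: the restrictions to the segments are dominated by |f|
    itself. *)
Lemma improper_FTC f F (A B : R) :
  (forall t, 0 < t -> is_derive t 1 F (f t)) ->
  (forall t, 0 < t -> {for t, continuous f}) ->
  mu.-integrable ray (EFin \o f) ->
  F t @[t --> +oo] --> A -> F t @[t --> 0^'+] --> B ->
  \int[mu]_(t in ray) f t = A - B.
Proof.
move=> dF cf fi FA FB; have mf := measurable_ray_fun cf.
have H : (\int[mu]_(t in ray) (f \_ (ray_seg 1 n)) t) @[n --> \oo] -->
    \int[mu]_(t in ray) f t.
  apply: (@Rintegral_dominated_cvg _ _ _ mu ray _ _ (fun t => `|f t|)).
  - exact: measurable_ray.
  - move=> n; apply/measurable_restrict; [exact: measurable_itv|exact: measurable_ray|].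
    apply: measurable_funS mf; first exact: measurable_ray.
    exact: subIsetl.
  - move=> t rt; have := rt; rewrite -(bigcup_ray_seg ltr01) => -[N _ tN].
    apply: cvg_near_cst; near=> n; rewrite patchE mem_set //.
    have nN : (N <= n)%N by near: n; exact: nbhs_infty_ge.
    by move/(ray_seg_nondecreasing ltr01)/subsetPset : nN; exact.
  - by have := integrable_abse fi.
  - by move=> n t _; rewrite patchE; case: ifP => // _; rewrite normr0.
rewrite -(cvg_lim (@Rhausdorff R) H); apply: cvg_lim => //.
have -> : (fun n => \int[mu]_(t in ray) (f \_ (ray_seg 1 n)) t) =
   (fun n => F (1 * n.+2%:R) - F (1 / n.+1%:R)).
  apply/funext => n; rewrite -Rintegral_mkcondr.
  have -> : ray `&` ray_seg 1 n = ray_seg 1 n.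
    by apply/setIidr; exact: ray_seg_sub.
  by rewrite /Rintegral (FTC2_ray_seg n dF cf).
exact: cvg_ray_seg_FTC.
Unshelve. all: by end_near. Qed.

Lemma ge0_ray_scale f c : 0 < c ->
  (forall t, 0 < t -> {for t, continuous f}) ->
  (forall t, 0 < t -> 0 <= f t) ->
  (\int[mu]_(t in ray) (f t)%:E)%E = (\int[mu]_(t in ray) (c * f (c * t))%:E)%E.
Proof.
move=> c0 cf f0.
have cfc t : 0 < t -> {for t, continuous (fun t => c * f (c * t))}.
  move=> t0; apply: cvgM; first exact: cvg_cst.
  apply: (@continuous_comp _ _ _ (fun t => c * t) f).
    by apply: cvgM; [exact: cvg_cst|exact: cvg_id].
  by apply: cf; rewrite mulr_gt0.
have f0c t : 0 < t -> 0 <= c * f (c * t).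
  by move=> t0; rewrite mulr_ge0 ?(ltW c0) // f0 // mulr_gt0.
have H1 := ge0_ray_seg_cvg c0 (measurable_ray_fun cf) f0.
have H2 := ge0_ray_seg_cvg ltr01 (measurable_ray_fun cfc) f0c.
rewrite -(cvg_lim _ H1) // -(cvg_lim _ H2) //.
congr (limn _); apply/funext => n.
have dc : (fun t : R => c * t)^`()%classic = cst c.
  apply/funext => t; rewrite derive1E.
  by apply: derive_val; apply: is_derive_eq; rewrite /GRing.scale /= mulr1.
have -> : ray_seg c n = `[c * (1 / n.+1%:R), c * (1 * n.+2%:R)]%classic.
  by rewrite /ray_seg !mul1r.
rewrite (@integration_by_substitution_increasing _ (fun t => c * t)).
- by apply: eq_integral => t _; rewrite dc /= mulrC.
- exact/ltW/ray_seg_lt.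
- by move=> t u _ _ tu; rewrite ltr_pM2l.
- by rewrite dc => t _; exact: cvg_cst.
- by rewrite dc; exact: is_cvg_cst.
- by rewrite dc; exact: is_cvg_cst.
- have ct : continuous (fun t : R => c * t).
    by move=> t; apply: cvgM; [exact: cvg_cst|exact: cvg_id].
  split; first by move=> t _; exact: derivableM.
    exact/cvg_at_right_filter/ct.
  exact/cvg_at_left_filter/ct.
- apply: continuous_in_subspaceT => t; rewrite inE /= in_itv /= => /andP[ta _].
  by apply: cf; apply: lt_le_trans ta; rewrite mulr_gt0 // divr_gt0.
Qed.

End HalfLine.

Lemma is_derive_pow (R : realType) (n : nat) (x : R) :
  is_derive x 1 (fun z : R => z ^+ n) (n%:R * x ^+ n.-1).
Proof.
elim: n => [|n IH].
  by rewrite (_ : (fun z => z ^+ 0) = cst (1 : R)) // mul0r; exact: is_derive_cst.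
rewrite (_ : (fun z => z ^+ n.+1) = (fun z => z * z ^+ n)); last first.
  by apply/funext => z; rewrite exprS.
apply: is_derive_eq; rewrite /GRing.scale /=; case: n {IH} => [|n].
  by rewrite !expr0 mul0r mulr0 !mulr1 add0r.
by rewrite /= -[n.+2%:R]natr1 exprS; ring.
Qed.

(** * The Gamma function at half-integers *)

Section GammaIntegral.
Variable R : realType.
Implicit Types (t l C : R) (k j n : nat).
Notation mu := (@lebesgue_measure R).

(** Half-integer powers become natural powers of sqrt t, so that [field] and continuity lemmas
    apply. *)
Lemma powR_half k t : 0 < t -> t `^ (k%:R / 2 - 1) = Num.sqrt t ^+ k / t.
Proof.
move=> t0; have tn : t != 0 by rewrite gt_eqF.
rewrite powRB ?tn ?implybT // powRr1 ?(ltW t0) //; congr (_ / _).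
by rewrite mulrC powRrM powR12_sqrt ?(ltW t0) // powR_mulrn ?sqrtr_ge0.
Qed.

Lemma powR_half_opp k t : 0 < t -> t `^ (- (k%:R / 2)) = (Num.sqrt t ^+ k)^-1.
Proof.
move=> t0; rewrite powRN; congr (_^-1).
by rewrite mulrC powRrM powR12_sqrt ?(ltW t0) // powR_mulrn ?sqrtr_ge0.
Qed.

(* The derivative of 2 sqrt t / (1 + sqrt t): an explicitly integrable function
   with the singularity t^(-1/2) at 0. *)
Definition ray_dom t : R := (Num.sqrt t * (1 + Num.sqrt t) ^+ 2)^-1.

Lemma ray_dom_gt0 t : 0 < t -> 0 < ray_dom t.
Proof.
by move=> t0; rewrite invr_gt0 mulr_gt0 ?exprn_gt0 ?sqrtr_gt0 // ltr_wpDr ?sqrtr_ge0.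
Qed.

Lemma cvg_sqrt_pinfty : Num.sqrt t @[t --> +oo] --> (+oo : set_system R).
Proof.
apply/cvgryPge => A; near=> t.
have [A0|A0] := leP A 0; first by rewrite (le_trans A0) ?sqrtr_ge0.
rewrite -[leLHS](ger0_norm (ltW A0)) -sqrtr_sqr; apply: ler_wsqrtr.
near: t; exact: nbhs_pinfty_ge (num_real _).
Unshelve. all: by end_near. Qed.

Lemma integrable_ray_dom : mu.-integrable (@ray R) (EFin \o ray_dom).
Proof.
apply: (@ge0_improper_FTC_integrable R ray_dom (fun t => - (2 / (1 + Num.sqrt t))) 0 (- 2)).
- move=> t t0; have s0 : 0 < Num.sqrt t by rewrite sqrtr_gt0.
  have D := is_derive1_sqrt t0.
  have n0 : 1 + Num.sqrt t != 0 by rewrite gt_eqF // ltr_wpDr // ltW.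
  apply: is_derive_eq; rewrite /ray_dom /GRing.scale /=.
  by field; rewrite n0 gt_eqF.
- move=> t t0; have s0 : 0 < Num.sqrt t by rewrite sqrtr_gt0.
  apply: cvgV; first by rewrite gt_eqF // mulr_gt0 // exprn_gt0 // ltr_wpDr // ltW.
  apply: cvgM; first exact: sqrt_continuous.
  by apply: cvgM; (apply: cvgD; [exact: cvg_cst|exact: sqrt_continuous]).
- by move=> t t0; rewrite ltW // ray_dom_gt0.
- rewrite -[X in _ --> X]oppr0; apply: cvgN; rewrite -[X in _ --> X](mulr0 2).
  apply: cvgM; first exact: cvg_cst.
  have p : \forall t \near +oo, 0 < 1 + Num.sqrt (t : R).
    by near=> t; rewrite ltr_wpDr ?sqrtr_ge0.
  apply: (gtr0_cvgV0 p).2; apply/cvgryPge => A; near=> t; rewrite (@le_trans _ _ (Num.sqrt t)) ?lerDr //.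
  by near: t; move/cvgryPge : cvg_sqrt_pinfty; exact.
- have -> : (-2 : R) = - (2 / (1 + Num.sqrt 0)) by rewrite sqrtr0 addr0 divr1.
  apply: cvg_at_right_filter; apply: cvgN; apply: cvgM; first exact: cvg_cst.
  apply: cvgV; first by rewrite sqrtr0 addr0 oner_neq0.
  by apply: cvgD; [exact: cvg_cst|exact: sqrt_continuous].
Unshelve. all: by end_near. Qed.

(** The n-th power of 1 + s <= exp s at s = t / (2(n+1)); the common tool for absorbing polynomials
    into half of an exponential. *)
Lemma one_plus_exp_bound n t : 0 <= t ->
  (1 + t) ^+ n <= (2 * n.+1%:R) ^+ n * expR (t / 2).
Proof.
move=> t0; have n0 : 0 < 2 * n.+1%:R :> R by rewrite mulr_gt0.
have s0 : 0 <= t / (2 * n.+1%:R) by rewrite divr_ge0 // ltW.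
have b : 1 + t <= 2 * n.+1%:R * expR (t / (2 * n.+1%:R)).
  apply: (@le_trans _ _ (2 * n.+1%:R * (1 + t / (2 * n.+1%:R)))).
    rewrite mulrDr mulr1 mulrCA divff ?gt_eqF // mulr1 lerD2r.
    by rewrite -natrM ler1n.
  by rewrite ler_wpM2l ?(ltW n0) // expR_ge1Dx.
apply: (@le_trans _ _ ((2 * n.+1%:R * expR (t / (2 * n.+1%:R))) ^+ n)).
  by rewrite lerXn2r ?nnegrE ?addr_ge0 ?mulr_ge0 ?expR_ge0.
rewrite exprMn ler_wpM2l ?exprn_ge0 ?(ltW n0) // -expRM_natl ler_expR.
apply: (@le_trans _ _ (n.+1%:R * (t / (2 * n.+1%:R)))).
  by rewrite ler_wpM2r // ler_nat.
by rewrite le_eqVlt; apply/orP; left; apply/eqP; field.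
Qed.

(** After multiplying out, with s = sqrt t and k+1 in place of k, it remains to bound s^k (1 + s)^2
    <= (1 + s)^(k+2) <= (2 (1 + t))^(k+2), which [one_plus_exp_bound] compares with exp(t/2). *)
Lemma half_power_dom k : (0 < k)%N -> exists2 C, 0 < C &
  forall t, 0 < t -> Num.sqrt t ^+ k / t * expR (- (2^-1 * t)) <= C * ray_dom t.
Proof.
case: k => // k _; exists (2 ^+ k.+2 * (2 * k.+3%:R) ^+ k.+2).
  by rewrite mulr_gt0 // exprn_gt0 // mulr_gt0.
move=> t t0; rewrite /ray_dom; have s0 : 0 < Num.sqrt t by rewrite sqrtr_gt0.
have tE : t = Num.sqrt t ^+ 2 by rewrite sqr_sqrtr // ltW.
have st : 1 + Num.sqrt t <= 2 * (1 + t).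
  have := sqr_ge0 (Num.sqrt t - 1); have := tE; move: (Num.sqrt t) s0 => s s0; nra.
set s := Num.sqrt t in s0 tE st *.
have p0 : 0 < s * (1 + s) ^+ 2 by rewrite mulr_gt0 // exprn_gt0 // ltr_wpDr // ltW.
rewrite ler_pdivlMr // expRN mulrAC ler_pdivrMr ?expR_gt0 //.
have -> : s ^+ k.+1 / t * (s * (1 + s) ^+ 2) = s ^+ k * (1 + s) ^+ 2.
  by rewrite tE exprS; field; rewrite gt_eqF.
apply: (@le_trans _ _ ((1 + s) ^+ k.+2)).
  rewrite -[k.+2]addn2 exprD ler_wpM2r ?exprn_ge0 ?addr_ge0 ?(ltW s0) //.
  by rewrite lerXn2r ?nnegrE ?addr_ge0 ?(ltW s0) // lerDr.
apply: (@le_trans _ _ ((2 * (1 + t)) ^+ k.+2)).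
  by rewrite lerXn2r ?nnegrE ?mulr_ge0 ?addr_ge0 ?(ltW s0) ?(ltW t0).
rewrite exprMn -[leRHS]mulrA [2^-1 * t]mulrC; apply: ler_wpM2l; first exact: exprn_ge0.
exact: one_plus_exp_bound (ltW t0).
Qed.

(** The integrand t^(k/2-1) e^(-l t). With l = 1/2 it also supplies the majorants of the sequel:
    t^(-1/2) e^(-t/2) for k = 1 and e^(-t/2) for k = 2. *)
Definition gamma_integrand k l t : R := Num.sqrt t ^+ k / t * expR (- (l * t)).

Lemma gamma_integrand_ge0 k l t : 0 < t -> 0 <= gamma_integrand k l t.
Proof.
by move=> t0; rewrite mulr_ge0 ?expR_ge0 // divr_ge0 ?exprn_ge0 ?sqrtr_ge0 // ltW.
Qed.

Lemma continuous_gamma_integrand k l t : 0 < t ->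
  {for t, continuous (gamma_integrand k l)}.
Proof.
move=> t0; apply: cvgM.
  apply: cvgM; last by apply: cvgV; [rewrite gt_eqF|exact: cvg_id].
  apply: (@continuous_comp _ _ _ (@Num.sqrt R) (fun x => x ^+ k)).
    exact: sqrt_continuous.
  exact: exprn_continuous.
apply: (@continuous_comp _ _ _ (fun t => - (l * t)) expR).
  by apply: cvgN; apply: cvgM; [exact: cvg_cst|exact: cvg_id].
exact: continuous_expR.
Qed.

Lemma gamma_integrand_mono k l l' t : 0 < t -> l <= l' ->
  gamma_integrand k l' t <= gamma_integrand k l t.
Proof.
move=> t0 ll; rewrite ler_wpM2l ?divr_ge0 ?exprn_ge0 ?sqrtr_ge0 ?(ltW t0) //.
by rewrite ler_expR lerN2 ler_wpM2r // ltW.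
Qed.

Lemma integrable_gamma_integrand k l : (0 < k)%N -> 2^-1 <= l ->
  mu.-integrable (@ray R) (EFin \o gamma_integrand k l).
Proof.
move=> k0 l2; have [C C0 hC] := half_power_dom k0.
apply: (@integrable_dominated _ _ _ mu (@ray R) _ (fun t => C * ray_dom t)).
- exact: measurable_ray.
- by apply: measurable_ray_fun => t; exact: continuous_gamma_integrand.
- move=> t /rayP t0; rewrite ger0_norm ?gamma_integrand_ge0 //.
  by apply: le_trans (hC t t0); exact: gamma_integrand_mono.
- by apply: integrable_scale integrable_ray_dom; exact: measurable_ray.
Qed.

Lemma Gamma_half k : Gamma_fun (k%:R / 2 : R) = \int[mu]_(t in @ray R) gamma_integrand k 1 t.
Proof.
apply: eq_Rintegral => t; rewrite inE => /rayP t0.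
by rewrite /gamma_integrand powR_half // mul1r.
Qed.

(** The formula l^(-k/2) = Gamma(k/2)^(-1) times the integral of t^(k/2-1) e^(-l t): it turns the
    spectral power of H into an integral of the heat semigroup. The bound 1/2 on l is the bottom of
    the spectrum. *)
Lemma Gamma_half_scale k l : (0 < k)%N -> 2^-1 <= l ->
  Gamma_fun (k%:R / 2 : R) = Num.sqrt l ^+ k * \int[mu]_(t in @ray R) gamma_integrand k l t.
Proof.
move=> k0 l2; have l0 : 0 < l by apply: lt_le_trans l2; rewrite invr_gt0.
rewrite Gamma_half /Rintegral (ge0_ray_scale l0); first last.
- by move=> t; exact: gamma_integrand_ge0.
- by move=> t; exact: continuous_gamma_integrand.
rewrite -[LHS]/(\int[mu]_(t in @ray R) (l * gamma_integrand k 1 (l * t))).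
rewrite -RintegralZl; [|exact: measurable_ray|exact: integrable_gamma_integrand].
apply: eq_Rintegral => t; rewrite inE => /rayP t0.
rewrite /gamma_integrand sqrtrM ?(ltW l0) // exprMn mul1r; field.
by rewrite !gt_eqF.
Qed.

Lemma Gamma_half_gt0 k : (0 < k)%N -> 0 < Gamma_fun (k%:R / 2 : R).
Proof.
move=> k0; rewrite Gamma_half.
have i1 : mu.-integrable (@ray R) (EFin \o gamma_integrand k 1).
  by apply: integrable_gamma_integrand => //; rewrite invf_le1 // ler1n.
have s12 : `[1, 2]%classic `<=` @ray R.
  by move=> t /=; rewrite in_itv /= => /andP[h _]; apply/rayP; apply: lt_le_trans h.
rewrite -lte_fin fineK; last by apply: integrable_fin_num => //; exact: measurable_ray.
(* On [1, 2] the integrand is at least e^(-2) / 2, since sqrt t >= 1, 1/t >= 1/2 and e^(-t) >=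
   e^(-2). *)
have c0 : (0%:E < \int[mu]_(t in `[1%R, 2%R]) (cst (expR (- 2) / 2)%:E t))%E.
  rewrite integral_cst //= lebesgue_measure_itv /= lte_fin ltr1n -EFinD -EFinM lte_fin.
  by rewrite mulr_gt0 ?divr_gt0 ?expR_gt0 // subr_gt0 ltr1n.
apply: (lt_le_trans c0).
have sub : (\int[mu]_(t in `[1%R, 2%R]) (gamma_integrand k 1 t)%:E <=
    \int[mu]_(t in @ray R) (gamma_integrand k 1 t)%:E)%E.
  apply: ge0_subset_integral => //.
  - exact: measurable_ray.
  - by case/integrableP : i1.
  - by move=> t /rayP t0; rewrite lee_fin gamma_integrand_ge0.
apply: le_trans sub.
apply: ge0_le_integral => //.
- by move=> t _; rewrite lee_fin divr_ge0 // expR_ge0.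
- by case/integrableP : i1 => m1 _; apply: measurable_funS m1 => //; exact: measurable_ray.
move=> t /= /[!in_itv]/= /andP[t1 t2]; rewrite lee_fin /gamma_integrand mul1r.
have t0 : 0 < t by apply: lt_le_trans t1.
rewrite mulrC ler_pM ?invr_ge0 ?expR_ge0 //.
  rewrite -[leLHS]mul1r ler_pM ?invr_ge0 //.
    by apply: exprn_ege1; rewrite -[leLHS]sqrtr1; exact: ler_wsqrtr.
  by rewrite lef_pV2 ?posrE.
by rewrite ler_expR lerN2.
Qed.

Lemma expn_exp_cvg0 j : t ^+ j * expR (- t) @[t --> +oo] --> (0 : R).
Proof.
apply: (@squeeze_cvgr _ _ _ _ (cst 0) (fun t => (2 * j.+1%:R) ^+ j * expR (- (2^-1 * t))) _).
- near=> t; have t0 : 0 < t by near: t; exact: nbhs_pinfty_gt (num_real _).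
  rewrite mulr_ge0 ?exprn_ge0 ?expR_ge0 ?(ltW t0) //=.
  have -> : expR (- t) = expR (- (t / 2)) * expR (- (2^-1 * t)).
    by rewrite -expRD; congr expR; field.
  rewrite mulrA ler_wpM2r ?expR_ge0 // expRN ler_pdivrMr ?expR_gt0 //.
  apply: le_trans (one_plus_exp_bound j (ltW t0)).
  by rewrite lerXn2r ?nnegrE ?addr_ge0 ?(ltW t0) // lerDr.
- exact: cvg_cst.
- rewrite -[X in _ --> X](mulr0 ((2 * j.+1%:R) ^+ j)); apply: cvgM; first exact: cvg_cst.
  apply: (@cvg_comp _ _ _ (fun t => 2^-1 * t) (fun u => expR (- u)) _ +oo); last exact: cvgr_expR.
  by apply/cvgryPge => A; near=> t; rewrite -ler_pdivrMl ?invr_gt0.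
Unshelve. all: by end_near. Qed.

Fixpoint gamma_primitive j t : R :=
  if j is i.+1 then j%:R * gamma_primitive i t - t ^+ j * expR (- t)
  else - expR (- t).

(** The value Gamma(k/2) for even k = 2(j+1), to be matched with the factorial in the local mass. *)
Lemma Gamma_fact j : Gamma_fun ((2 * j.+1)%:R / 2 : R) = j`!%:R.
Proof.
rewrite Gamma_half.
have E t : 0 < t -> gamma_integrand (2 * j.+1) 1 t = t ^+ j * expR (- t).
  move=> t0; rewrite /gamma_integrand mul1r exprM sqr_sqrtr ?ltW // exprSr.
  by rewrite mulfK // gt_eqF.
have dP i t : is_derive t 1 (gamma_primitive i) (t ^+ i * expR (- t)).
  elim: i => [|i IH] /=.
    by apply: is_derive_eq; rewrite /GRing.scale /= expr0; ring.
  have d := is_derive_pow i.+1 t; apply: is_derive_eq; rewrite /GRing.scale /=.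
  by ring.
have H : (\int[mu]_(t in @ray R) (gamma_integrand (2 * j.+1) 1 t)%:E)%E =
    (0 - - j`!%:R)%:E; last by rewrite /Rintegral H sub0r opprK.
apply: (@ge0_improper_FTC R _ (gamma_primitive j)).
- move=> t t0; rewrite E //; exact: dP.
- by move=> t; exact: continuous_gamma_integrand.
- by move=> t; exact: gamma_integrand_ge0.
- elim: j {E} => [|j IH] /=.
    by rewrite -oppr0; apply: cvgN; exact: cvgr_expR.
  rewrite -[X in _ --> X]subr0 -[X in _ --> X - _](mulr0 j.+1%:R).
  apply: cvgB; last exact: (@expn_exp_cvg0 j.+1).
  by apply: cvgM => //; exact: cvg_cst.
- have -> : - j`!%:R = gamma_primitive j 0.
    elim: j {E} => [|j IH] /=; first by rewrite oppr0 expR0 fact0.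
    by rewrite -IH expr0n mul0r subr0 factS natrM mulrN.
  apply: cvg_at_right_filter; have [D _] := dP j 0.
  by apply: differentiable_continuous; apply/derivable1_diffP.
Qed.

End GammaIntegral.

(** * Hermite coefficients of test functions and the representative of H^(-k/2) f *)

Section TestFunctions.
Variable R : realType.
Implicit Types (f g : R -> R) (x y A B C : R) (n m k : nat).
Notation mu := (@lebesgue_measure R).
Notation h := (@hermite_fun R).
Notation s n := (Num.sqrt (n%:R : R)).

Lemma derivable_continuous f x : derivable f x 1 -> {for x, continuous f}.
Proof. by move=> D; apply: differentiable_continuous; apply/derivable1_diffP. Qed.

Lemma is_derive_continuous f x d : is_derive x 1 f d -> {for x, continuous f}.
Proof. by case=> D _; exact: derivable_continuous. Qed.

Lemma derivable_is_derive1 f x : derivable f x 1 -> is_derive x 1 f (f^`()%classic x).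
Proof. by move=> D; apply: DeriveDef => //; rewrite derive1E. Qed.

Lemma derive1_is_derive f x d : is_derive x 1 f d -> f^`()%classic x = d.
Proof. by case=> D <-; rewrite derive1E. Qed.

Definition smooth f := forall n x, derivable (derive1n n f) x 1.
Definition vanish_out A f := forall x, A < `|x| -> f x = 0.

Lemma smooth_lower f : smooth f -> smooth (hermite_lower f).
Proof.
move=> sf n x.
(* Leibniz' rule for x f; at m = 0 the predecessor index is harmless because its coefficient is
   0. *)
have E m : derive1n m (hermite_lower f) = fun x => derive1n m.+1 f x +
    (x * derive1n m f x + m%:R * derive1n m.-1 f x).
  elim: m => [|m IH].
    by apply/funext => z; rewrite mul0r addr0 /= /hermite_lower.
  apply/funext => z; rewrite derive1nS IH; apply: derive1_is_derive.
  have d1 := derivable_is_derive1 (sf m.+1 z).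
  have d2 := derivable_is_derive1 (sf m z).
  have d3 := derivable_is_derive1 (sf m.-1 z).
  rewrite -!derive1nS in d1 d2 d3.
  have Em : m%:R * derive1n m.-1.+1 f z = m%:R * derive1n m f z.
    by case: m {IH d1 d2 d3} => [|m]; rewrite ?mul0r.
  apply: is_derive_eq; rewrite /GRing.scale /= -!derive1nS Em -[m.+1%:R]natr1.
  move: (derive1n m.+2 f z) (derive1n m.+1 f z) (derive1n m f z) => a b c; ring.
rewrite E; apply: derivableD; first exact: (sf n.+1).
apply: derivableD; apply: derivableM => //; exact: sf.
Qed.

Lemma vanish_lower A f : vanish_out A f -> vanish_out A (hermite_lower f).
Proof.
move=> vf x Ax; rewrite /hermite_lower vf // mulr0 addr0.
have N : \forall y \near (0:R)^', f (y + x) = 0.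
  apply: nbhs_dnbhs; exists (`|x| - A) => /=; first by rewrite subr_gt0.
  move=> y /=; rewrite sub0r normrN => yx; apply: vf.
  have := ler_normB (y + x) y; rewrite [y + x]addrC addrK; lra.
rewrite /derive1; apply: cvg_lim => //; apply: cvg_near_cst; near=> y.
by rewrite (vf x Ax) subr0 (near N) ?scaler0.
Unshelve. all: by end_near. Qed.

Lemma Cc_infty_smooth f : Cc_infty f -> smooth f. Proof. by case. Qed.

Lemma Cc_infty_vanish f : Cc_infty f -> exists2 A, 0 < A & vanish_out A f.
Proof.
move=> [_ /compact_bounded [M [Mr HM]]]; exists (`|M| + 1); first by rewrite ltr_pwDr.
move=> x xM; apply/eqP; apply: contraTT xM => fx; rewrite -leNgt.
have M1 : M < `|M| + 1 by rewrite (le_lt_trans (ler_norm M)) // ltrDl.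
exact: (HM _ M1 x (@subset_closure _ _ x fx)).
Qed.

Lemma smooth_continuous f : smooth f -> continuous f.
Proof. by move=> sf x; apply: derivable_continuous; exact: (sf 0%N x). Qed.

Lemma continuous_hermite_fun n : continuous (h n).
Proof. by move=> x; apply: is_derive_continuous (is_derive_hermite_fun' n x). Qed.

Lemma integrable_seg f A B : continuous f -> mu.-integrable `[A, B] (EFin \o f).
Proof.
move=> cf; apply: continuous_compact_integrable; first exact: segment_compact.
exact: continuous_subspaceT.
Qed.

Lemma Rintegral_vanish A f : vanish_out A f ->
  \int[mu]_x f x = \int[mu]_(x in `[- A, A]) f x.
Proof.
move=> vf; rewrite [RHS]Rintegral_mkcond; apply: eq_Rintegral => x _.
rewrite patchE; case: ifPn => //; rewrite notin_setE /= in_itv /= => /negP.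
by rewrite -ler_norml -ltNge; exact: vf.
Qed.

Lemma integrable_vanish A f : continuous f -> vanish_out A f ->
  mu.-integrable setT (EFin \o f).
Proof.
move=> cf vf; have := @integrable_seg f (- A) A cf.
rewrite integrable_mkcond; last exact: measurable_itv.
apply: eq_integrable => // x _; rewrite patchE; case: ifPn => //.
rewrite notin_setE /= in_itv /= => /negP.
by rewrite -ler_norml -ltNge => /vf ->.
Qed.

Lemma vanish_mull A f g : vanish_out A g -> vanish_out A (fun x => f x * g x).
Proof. by move=> vg x Ax; rewrite vg // mulr0. Qed.

Lemma hermite_coef_bound A f n : continuous f -> vanish_out A f ->
  `|hermite_coef n f| <= (hermite_bound R * \int[mu]_x `|f x|) * n.+1%:R ^+ 3.
Proof.
move=> cf vf; have fi := integrable_vanish cf vf.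
have afi : mu.-integrable setT (EFin \o (fun x => `|f x|)) by exact: (integrable_abse fi).
rewrite mulrAC -RintegralZl //; apply: norm_Rintegral_le => //.
- apply: continuous_measurable_fun => x; apply: cvgM; last exact: cf.
  exact: continuous_hermite_fun.
- by move=> x _; rewrite normrM ler_wpM2r // hermite_fun_poly.
- exact: integrable_scale.
Qed.

(** The adjoint of d/dx + x is the raising operator, so each application of d/dx + x to f exposes a
    factor of order sqrt n in front of a coefficient of f. *)
Lemma hermite_coef_lower A f n : smooth f -> vanish_out A f ->
  hermite_coef n (hermite_lower f) = Num.sqrt 2 * s n.+1 * hermite_coef n.+1 f.
Proof.
move=> sf vf; have vl := vanish_lower vf.
have cf := smooth_continuous sf.
have cl := smooth_continuous (smooth_lower sf).
wlog A0 : A vf vl / 0 < A.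
  move=> H; apply: (H (Num.max A 1)); last by rewrite lt_max ltr01 orbT.
    by move=> x; rewrite gt_max => /andP[h1 _]; exact: vf.
  by move=> x; rewrite gt_max => /andP[h1 _]; exact: vl.
set c := Num.sqrt 2 * s n.+1.
(* [vanish_out A] says nothing at |x| = A, so the endpoints are moved strictly outside, where the
   boundary terms vanish. *)
pose B := A + 1; have B0 : 0 < B by rewrite /B; lra.
have vB g : vanish_out A g -> vanish_out B g.
  by move=> vg x Bx; apply: vg; apply: lt_trans Bx; rewrite /B; lra.
rewrite /hermite_coef (Rintegral_vanish (vanish_mull (h n) (vB _ vl))).
rewrite (Rintegral_vanish (vanish_mull (h n.+1) (vB _ vf))).
have chn := @continuous_hermite_fun n.
have chn1 := @continuous_hermite_fun n.+1.
have i1 : mu.-integrable `[- B, B] (EFin \o (fun x => h n x * hermite_lower f x)).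
  by apply: integrable_seg => x; apply: cvgM; [exact: chn|exact: cl].
have i2 : mu.-integrable `[- B, B] (EFin \o (fun x => h n.+1 x * f x)).
  by apply: integrable_seg => x; apply: cvgM; [exact: chn1|exact: cf].
rewrite -RintegralZl //; apply/eqP; rewrite -subr_eq0 -RintegralB //; last first.
  exact: integrable_scale.
have dF x : is_derive x 1 (fun x => h n x * f x)
    (h n x * hermite_lower f x - c * (h n.+1 x * f x)).
  have d1 := is_derive_hermite_fun n x.
  have d2 := derivable_is_derive1 (sf 0%N x); rewrite /= in d2.
  by apply: is_derive_eq; rewrite /GRing.scale /= /hermite_lower /c; ring.
have F := @FTC2_seg R _ _ (- B) B _ (fun t _ => dF t).
rewrite /Rintegral F; last 2 first.
- by rewrite gtrN.
- move=> t _; apply: cvgB; first by apply: cvgM; [exact: chn|exact: cl].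
  by apply: cvgM; [exact: cvg_cst|apply: cvgM; [exact: chn1|exact: cf]].
by rewrite /= !(vf _ _) ?mulr0 ?subrr // ?normrN gtr0_norm // /B; lra.
Qed.

(** Lowering f repeatedly gains a factor sqrt(n+1) each time, while smoothness and support persist;
    hence the induction over all such f. *)
Lemma rapid_hermite_coef f : smooth f -> (exists A, vanish_out A f) ->
  rapid (fun n => hermite_coef n f).
Proof.
move=> sf vf.
have Q m : forall f, smooth f -> (exists A, vanish_out A f) ->
    exists C, forall n, `|hermite_coef n f| * s n.+1 ^+ m <= C * n.+1%:R ^+ 3.
  elim: m => [|m IH] {sf vf}f sf [A vf].
    exists (hermite_bound R * \int[mu]_x `|f x|) => n; rewrite expr0 mulr1.
    exact: hermite_coef_bound (smooth_continuous sf) vf.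
  have [C hC] := IH _ (smooth_lower sf) (ex_intro _ A (vanish_lower vf)).
  have C0 : 0 <= C.
    have := hC 0%N; rewrite expr1n mulr1; apply: le_trans.
    by rewrite mulr_ge0 // exprn_ge0 // sqrtr_ge0.
  (* Lowering relates the index n+1 of f to the index n, so index 0 needs its own constant. *)
  exists (`|hermite_coef 0 f| + 2 ^+ m * C) => -[|n].
    by rewrite sqrtr1 !expr1n !mulr1 lerDl mulr_ge0 ?exprn_ge0.
  have s2 : s n.+2 <= Num.sqrt 2 * s n.+1.
    by rewrite -sqrtrM // ler_wsqrtr // -natrM ler_nat; lia.
  have s22 : s n.+2 <= 2 * s n.+1.
    by apply: le_trans s2 _; rewrite ler_wpM2r ?sqrtr_ge0 // sqrt2_le2.
  apply: (@le_trans _ _ (`|hermite_coef n (hermite_lower f)| * (2 * s n.+1) ^+ m)).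
    rewrite (hermite_coef_lower n sf vf) normrM ger0_norm ?mulr_ge0 ?sqrtr_ge0 //.
    rewrite exprS mulrA [X in _ <= X * _]mulrC.
    apply: ler_pM; rewrite ?mulr_ge0 ?exprn_ge0 ?sqrtr_ge0 //.
      by rewrite ler_wpM2l.
    by rewrite lerXn2r ?nnegrE ?mulr_ge0 ?sqrtr_ge0.
  rewrite exprMn mulrCA mulrDl.
  have n3 : n.+1%:R ^+ 3 <= n.+2%:R ^+ 3 :> R by rewrite lerXn2r ?nnegrE // ler_nat.
  apply: (@le_trans _ _ (2 ^+ m * (C * n.+1%:R ^+ 3))); first by rewrite ler_wpM2l ?exprn_ge0.
  rewrite ler_wpDl ?mulr_ge0 ?exprn_ge0 // -mulrA.
  by rewrite ler_wpM2l ?exprn_ge0 // ler_wpM2l.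
(* Factor 2 because each step gains only half a power, and 3 more powers to pay for the n^3 of the
   basic coefficient bound. *)
move=> m; have [C hC] := Q (2 * (m + 3))%N f sf vf; exists C => n.
have := hC n; rewrite exprM sqr_sqrt_nat exprD mulrA ler_pM2r ?exprn_gt0 //.
Qed.

Lemma continuous_ae0 g : continuous g -> {ae mu, forall x, g x = 0} -> forall x, g x = 0.
Proof.
move=> cg [N [mN N0 gN]] x; apply/eqP/negPn/negP => gx.
have [e /= e0 he] : nbhs x (fun y => g y != 0).
  have : open [set y | y != (0 : R)] by exact: open_neq.
  by move=> /(_ (g x) gx) U; exact: (cg x _ U).
have : (mu (ball x e) <= mu N)%E.
  apply: le_measure; rewrite ?inE //; first exact: measurable_ball.
  move=> y xy; apply: gN => /= gy.
  by have := he y xy; rewrite gy eqxx.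
rewrite N0 lebesgue_measure_ball ?(ltW e0) // lee_fin leNgt => /negP; apply.
by rewrite mulrn_wgt0.
Qed.

Lemma integrable_weight2 : mu.-integrable setT (EFin \o (fun x : R => (1 + x ^+ 2)^-1 ^+ 2)).
Proof.
have p1 x : 0 < 1 + x ^+ 2 :> R by rewrite ltr_wpDr // sqr_ge0.
have p0 x : 0 <= (1 + x ^+ 2)^-1 :> R by rewrite invr_ge0 ltW.
have c1 : continuous (fun x : R => (1 + x ^+ 2)^-1) := @continuous_oneDsqrV R.
have I : mu.-integrable setT (EFin \o (fun x : R => (1 + x ^+ 2)^-1)).
  apply/integrableP; split.
    by apply/measurable_EFinP; exact: continuous_measurable_fun.
  have -> : (\int[mu]_x `|(EFin \o (fun x : R => (1 + x ^+ 2)^-1)%R) x|)%E =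
     (\int[mu]_x ((1 + x ^+ 2)^-1)%:E)%E.
    by apply: eq_integral => x _; rewrite /= ger0_norm.
  rewrite ge0_symfun_integralT //; last by move=> x /=; rewrite sqrrN.
  rewrite -set_itvcy -[X in (_ * X)%E]/(\int[mu]_(x in `[0%R, +oo[) (oneDsqr x)^-1%:E)%E.
  by rewrite integral0y_oneDsqr -EFinM ltry.
apply: integrable_dominated I => //.
- apply: continuous_measurable_fun => x.
  apply: (@continuous_comp _ _ _ (fun x : R => (1 + x ^+ 2)^-1) (fun z => z ^+ 2)).
    exact: c1.
  exact: exprn_continuous.
- move=> x _; rewrite ger0_norm ?exprn_ge0 // expr2 ler_piMr //.
  by rewrite invf_le1 // lerDl sqr_ge0.
Qed.

Lemma Lnorm2_le f w (C : R) : 0 <= C -> measurable_fun setT f ->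
  mu.-integrable setT (EFin \o (fun x => w x ^+ 2)) ->
  (forall x, `|f x| <= C * w x) ->
  ('N[mu]_2%:E[EFin \o f] <= (C * Num.sqrt (\int[mu]_x (w x ^+ 2)))%:E)%E.
Proof.
move=> C0 mf iw fw.
have V0 : 0 <= \int[mu]_x (w x ^+ 2) by apply: Rintegral_ge0 => x _; exact: sqr_ge0.
rewrite unlock /Lnorm.
have -> : (C * Num.sqrt (\int[mu]_x (w x ^+ 2)))%:E =
   ((C ^+ 2 * \int[mu]_x (w x ^+ 2))%:E `^ 2^-1)%E.
  rewrite poweR_EFin powR12_sqrt ?mulr_ge0 ?sqr_ge0 //.
  by rewrite sqrtrM ?sqr_ge0 // sqrtr_sqr ger0_norm.
have iw2 : mu.-integrable setT (EFin \o (fun x => C ^+ 2 * w x ^+ 2)).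
  exact: integrable_scale.
apply: gt0_ler_poweR.
- by rewrite invr_ge0.
- by rewrite in_itv /= leey andbT integral_ge0 // => x _; exact: poweR_ge0.
- by rewrite in_itv /= leey andbT lee_fin mulr_ge0 // sqr_ge0.
rewrite -RintegralZl // fineK; last exact: integrable_fin_num.
apply: ge0_le_integral => //.
- by move=> x _; exact: poweR_ge0.
- apply/(@measurableT_comp _ _ _ _ _ _ (fun z => z `^ 2)%E); first exact: measurable_poweR.
  by apply: measurableT_comp => //; exact/measurable_EFinP.
- by case/integrableP : iw2.
move=> x _; rewrite -[(EFin \o f) x]/((f x)%:E) abse_EFin poweR_EFin lee_fin -[2]/(2%:R) powR_mulrn //.
by rewrite -exprMn lerXn2r ?nnegrE // (le_trans _ (fw x)).
Qed.

Definition npow_coef k f n : R := hermite_eigen R n `^ (- (k%:R / 2)) * hermite_coef n f.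

Lemma hermite_eigen_ge n : 2^-1 <= hermite_eigen R n.
Proof. by rewrite /hermite_eigen lerDr. Qed.

Lemma hermite_eigen_gt0 n : 0 < hermite_eigen R n.
Proof. by apply: lt_le_trans (hermite_eigen_ge n); rewrite invr_gt0. Qed.

Lemma rapid_npow_coef k f : smooth f -> (exists A, vanish_out A f) ->
  rapid (npow_coef k f).
Proof.
move=> sf vf; apply: (@rapidM _ _ _ (2 ^+ k) 0 (rapid_hermite_coef sf vf)) => n.
have l0 := hermite_eigen_gt0 n; have l2 := hermite_eigen_ge n.
rewrite expr0 mulr1 powR_half_opp // ger0_norm ?invr_ge0 ?exprn_ge0 ?sqrtr_ge0 //.
rewrite -exprVn lerXn2r ?nnegrE ?invr_ge0 ?sqrtr_ge0 //.
rewrite -[leRHS]invrK lef_pV2 ?posrE ?invr_gt0 ?sqrtr_gt0 //.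
rewrite -[leLHS]ger0_norm ?invr_ge0 // -sqrtr_sqr; apply: ler_wsqrtr.
by apply: le_trans l2; rewrite expr2 ler_piMr ?invr_ge0 // invf_le1 // ler1n.
Qed.

Lemma measurable_npow_sum (b : R) f N : measurable_fun setT (hermite_npow_sum b f N).
Proof.
apply: measurable_sum => i; apply: continuous_measurable_fun => x.
by apply: cvgM; [exact: cvg_cst|exact: continuous_hermite_fun].
Qed.

(** By Minkowski two L^2 limits of the same partial sums agree almost everywhere, and continuous
    functions agreeing almost everywhere are equal. This pins down the value picked by [get]. *)
Lemma is_hermite_npow_unique (b : R) f g1 g2 : continuous g1 -> continuous g2 ->
  is_hermite_npow b f g1 -> is_hermite_npow b f g2 -> g1 = g2.
Proof.
move=> c1 c2 [m1 l1] [m2 l2].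
pose S := hermite_npow_sum b f.
have mS N := measurable_npow_sum b f N.
have N0 : ('N[mu]_2%:E[EFin \o (fun x => g1 x - g2 x)%R] = 0)%E.
  apply/eqP; rewrite eq_le Lnorm_ge0 andbT.
  have l12 : ('N[mu]_2%:E[EFin \o (fun x => S N x - g1 x)%R] +
      'N[mu]_2%:E[EFin \o (fun x => S N x - g2 x)%R])%E @[N --> \oo] --> 0%E.
    rewrite -[X in _ --> X](adde0 0%E); exact: cvgeD.
  rewrite -(cvg_lim _ l12) //; apply: lime_ge; first by apply/cvg_ex; exists 0%E.
  apply: nearW => N.
  have -> : (fun x => g1 x - g2 x) = ((fun x => g1 x - S N x) \+ (fun x => S N x - g2 x))%R.
    by apply/funext => x /=; ring.
  have E : ('N[mu]_2%:E[EFin \o (fun x => S N x - g1 x)%R] =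
      'N[mu]_2%:E[EFin \o (fun x => g1 x - S N x)%R])%E.
    rewrite -oppe_Lnorm; congr Lnorm; apply/funext => x /=.
    by rewrite opprB.
  rewrite E; apply: minkowski_EFin.
  - by apply: measurable_funB; [exact: m1|exact: mS].
  - by apply: measurable_funB; [exact: mS|exact: m2].
  - by rewrite ler1n.
apply/funext => x; apply/eqP; rewrite -subr_eq0; apply/eqP.
apply: (@continuous_ae0 (fun x => g1 x - g2 x)); first by move=> z; apply: cvgB; [exact: c1|exact: c2].
have H : (EFin \o (fun x => g1 x - g2 x)) = \0 %[ae mu].
  apply: Lnorm_eq0_eq0 N0 => //; apply/measurable_EFinP.
  by apply: measurable_funB; [exact: m1|exact: m2].
case: H => N [mN N0' sub]; exists N; split => // z nz; apply: sub => /= Hz; apply: nz.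
by have [] := Hz I.
Qed.

(** The explicit series is continuous and its partial sums converge in L^2 at rate 1/(N+1), so it is
    an admissible choice and, by uniqueness, the one made. *)
Lemma hermite_npowE k f : smooth f -> (exists A, vanish_out A f) ->
  hermite_npow (k%:R / 2) f = hermite_series (npow_coef k f).
Proof.
move=> sf vf; have ra := rapid_npow_coef k sf vf.
have cg := continuous_hermite_series ra.
have H : is_hermite_npow (k%:R / 2) f (hermite_series (npow_coef k f)).
  split; first exact: continuous_measurable_fun.
  have [C hC] := hermite_series_tail ra.
  have C0 : 0 <= C.
    have := le_trans (normr_ge0 _) (hC 0 0%N).
    by rewrite divr1 expr0n addr0 divr1.
  set V := Num.sqrt (\int[mu]_x ((1 + x ^+ 2)^-1 ^+ 2)).
  apply: (@squeeze_cvge _ _ _ _ (cst 0%E) _ (fun N => (C / N.+1%:R * V)%:E)).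
  - apply: nearW => N; rewrite Lnorm_ge0 /=; apply: Lnorm2_le.
    + by rewrite divr_ge0.
    + apply: measurable_funB; first exact: measurable_npow_sum.
      exact: continuous_measurable_fun.
    + exact: integrable_weight2.
    + by move=> x; rewrite distrC; exact: hC.
  - exact: cvg_cst.
  - apply: cvg_EFin; first exact: nearW.
    rewrite /= -[X in _ --> X](mul0r V); apply: cvgM; last exact: cvg_cst.
    rewrite -[X in _ --> X](mulr0 C); apply: cvgM; first exact: cvg_cst.
    exact: cvg_harmonic.
rewrite /hermite_npow.
have [c1 H1] := @getPex _ [set g : R -> R | continuous g /\ is_hermite_npow (k%:R / 2) f g]
  (ex_intro _ _ (conj cg H)).
exact: is_hermite_npow_unique c1 cg H1 H.
Qed.

End TestFunctions.

(** * Integrals of finite sums *)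

Section FiniteSums.
Context d (T : measurableType d) (R : realType) (mu : {measure set T -> \bar R}).

Lemma Rintegral_sum (D : set T) (g : nat -> T -> R) (N : nat) : measurable D ->
  (forall n, mu.-integrable D (EFin \o g n)) ->
  mu.-integrable D (EFin \o (fun x => \sum_(0 <= n < N) g n x)) /\
  \int[mu]_(x in D) (\sum_(0 <= n < N) g n x) =
    \sum_(0 <= n < N) \int[mu]_(x in D) g n x.
Proof.
move=> mD gi; elim: N => [|N [IH1 IH2]].
  split; first by have := integrable0 mu D; apply: eq_integrable => // x _; rewrite /= big_geq.
  rewrite big_geq // (@eq_Rintegral _ _ _ _ D (cst 0)); last by move=> x _; rewrite big_geq.
  by rewrite Rintegral_cst // mul0r.
split.
  have := integrableD mD IH1 (gi N); apply: eq_integrable => // x _ /=.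
  by rewrite big_nat_recr //= EFinD.
rewrite big_nat_recr //= -IH2 -RintegralD //.
by apply: eq_Rintegral => x _; rewrite big_nat_recr.
Qed.

End FiniteSums.

(** * The Riesz transform as an integral of the heat semigroup *)

Section HeatRepresentation.
Variable R : realType.
Implicit Types (f g : R -> R) (x y t A C : R) (n k : nat).
Notation mu := (@lebesgue_measure R).
Notation h := (@hermite_fun R).

Definition heat_decay t n : R := expR (- (hermite_eigen R n * t)).

Lemma rapid_heat_decay t : 0 < t -> rapid (heat_decay t).
Proof.
(* K is chosen so that n+1 <= K (1 + 2nt); then [one_plus_exp_bound] at 2nt costs only exp(nt). *)
move=> t0 m; pose K : R := 1 + (2 * t)^-1.
have K0 : 0 < K by rewrite ltr_wpDr // invr_ge0 mulr_ge0 // ltW.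
exists (K ^+ m * (2 * m.+1%:R) ^+ m) => n.
have nt : 0 <= 2 * n%:R * t by rewrite !mulr_ge0 // ltW.
have b : n.+1%:R <= K * (1 + 2 * n%:R * t).
  have -> : K * (1 + 2 * n%:R * t) = n.+1%:R + (2 * n%:R * t + (2 * t)^-1).
    rewrite /K -natr1; have t1 : t != 0 by rewrite gt_eqF.
    by field.
  by rewrite lerDl addr_ge0 // invr_ge0 mulr_ge0 // ltW.
rewrite /heat_decay ger0_norm ?expR_ge0 // expRN mulrC ler_pdivrMr ?expR_gt0 //.
apply: (@le_trans _ _ (K ^+ m * (1 + 2 * n%:R * t) ^+ m)).
  rewrite -exprMn lerXn2r ?nnegrE //; apply: mulr_ge0; first exact: ltW.
  by rewrite addr_ge0.
rewrite -[leRHS]mulrA; apply: ler_wpM2l; first by rewrite exprn_ge0 // ltW.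
apply: le_trans (one_plus_exp_bound m nt) _.
rewrite ler_wpM2l ?exprn_ge0 ?mulr_ge0 // ler_expR.
have -> : 2 * n%:R * t / 2 = n%:R * t by field.
by rewrite ler_wpM2r ?(ltW t0) // lerDl invr_ge0.
Qed.

Lemma hermite_fun_shift_poly k y n :
  `|h (n + k) y| <= hermite_bound R * k.+1%:R ^+ 3 * n.+1%:R ^+ 3.
Proof.
apply: le_trans (hermite_fun_poly _ _) _; rewrite -mulrA -exprMn ler_wpM2l //.
by rewrite lerXn2r ?nnegrE ?mulr_ge0 // -natrM ler_nat; lia.
Qed.

Lemma rapid_heat_coef t y : 0 < t -> rapid (fun n => h n y * heat_decay t n).
Proof.
by move=> t0; apply: rapidM (rapid_heat_decay t0) _ => n; exact: hermite_fun_poly.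
Qed.

Lemma heat_kernelE t y : heat_kernel t ^~ y = hermite_series (fun n => h n y * heat_decay t n).
Proof.
apply/funext => z; congr (limn (series _)); apply/funext => n.
by rewrite /heat_decay; ring.
Qed.

Definition heat_kernel_lower k t x y : R := iter k (@hermite_lower R) (heat_kernel t ^~ y) x.

Lemma heat_kernel_lowerE k t x y : 0 < t -> heat_kernel_lower k t x y =
  limn (series (fun n => iter k (@lower_coef R) (heat_decay t) n * (h (n + k) y * h n x))).
Proof.
move=> t0; rewrite /heat_kernel_lower heat_kernelE iter_hermite_lower_series.
  congr (limn (series _)); apply/funext => n.
  by rewrite !iter_lower_coef; ring.
exact: rapid_heat_coef.
Qed.

(** Sum and integral are exchanged by dominated convergence: for fixed t and x the partial sums of
    the kernel are bounded uniformly in y, so C |f| is a majorant. *)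
Lemma heat_semigroup_lower k t x f : 0 < t -> smooth f -> (exists A, vanish_out A f) ->
  \int[mu]_y (heat_kernel_lower k t x y * f y) =
  limn (series (fun n => iter k (@lower_coef R) (heat_decay t) n * (hermite_coef (n + k) f * h n x))).
Proof.
move=> t0 sf [A vf]; have cf := smooth_continuous sf.
have fi := integrable_vanish cf vf.
set a := iter k _ _.
have ra : rapid a by apply: rapid_iter_lower_coef; exact: rapid_heat_decay.
have [C hC] := rapid_tele (hermite_bound R * k.+1%:R ^+ 3 * hermite_bound R) 6 ra.
have bnd y n : `|a n * (h (n + k) y * h n x)| <= C * tele R n.
  apply: (hC (fun n => h (n + k) y * h n x)) => {}n; rewrite normrM.
  have -> : hermite_bound R * k.+1%:R ^+ 3 * hermite_bound R * n.+1%:R ^+ 6 =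
     (hermite_bound R * k.+1%:R ^+ 3 * n.+1%:R ^+ 3) * (hermite_bound R * n.+1%:R ^+ 3).
    by ring.
  by apply: ler_pM => //; [exact: hermite_fun_shift_poly|exact: hermite_fun_poly].
have ch n : continuous (h n) := @continuous_hermite_fun R n.
pose S N y := series (fun n => a n * (h (n + k) y * h n x)) N * f y.
have H : (\int[mu]_y S N y) @[N --> \oo] --> \int[mu]_y (heat_kernel_lower k t x y * f y).
  apply: (@Rintegral_dominated_cvg _ _ _ mu setT _ _ (fun y => C * `|f y|)) => //.
  - move=> N; apply: measurable_funM; last exact: continuous_measurable_fun.
    apply: measurable_sum => i; apply: continuous_measurable_fun => y.
    apply: cvgM; first exact: cvg_cst.
    by apply: cvgM; [exact: ch|exact: cvg_cst].
  - move=> y _; apply: cvgM; last exact: cvg_cst.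
    rewrite heat_kernel_lowerE //; exact: (summable_tele (bnd y)).
  - by apply: integrable_scale => //; exact: (integrable_abse fi).
  - move=> N y _; rewrite normrM ler_wpM2r //.
    apply: le_trans (ler_norm_sum _ _ _) _.
    apply: (@le_trans _ _ (\sum_(0 <= i < N) C * tele R i)); first exact: ler_sum.
    rewrite -mulr_sumr sum_tele // ler_piMr //; last by rewrite invr1 gerBl invr_ge0.
    by have := le_trans (normr_ge0 _) (bnd y 0%N); rewrite pmulr_lge0 // tele_gt0.
rewrite -(cvg_lim (@Rhausdorff R) H); congr (limn _); apply/funext => N.
have ihf n : mu.-integrable setT (EFin \o (fun y => h n y * f y)).
  apply: (@integrable_vanish _ A) => [y|]; last exact: vanish_mull.
  by apply: cvgM; [exact: ch|exact: cf].
have gi n : mu.-integrable setT (EFin \o (fun y => a n * h n x * (h (n + k) y * f y))).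
  exact: integrable_scale.
transitivity (\int[mu]_y \sum_(0 <= n < N) a n * h n x * (h (n + k) y * f y)).
  apply: eq_Rintegral => y _; rewrite /S /series /= mulr_suml.
  by apply: eq_bigr => n _; ring.
rewrite (Rintegral_sum N measurableT gi).2 /series /=; apply: eq_bigr => n _.
by rewrite RintegralZl // /hermite_coef; ring.
Qed.

(** Each eigenvalue power is replaced by its Gamma integral. Summation passes inside because the
    coefficients are rapidly decreasing and every heat factor is at most e^(-t/2), which gives the
    majorant C t^(k/2-1) e^(-t/2). *)
Lemma hermite_riesz_heat k x f : (0 < k)%N -> smooth f -> (exists A, vanish_out A f) ->
  Gamma_fun (k%:R / 2 : R) * hermite_riesz k f x =
  \int[mu]_(t in @ray R) (Num.sqrt t ^+ k / t * \int[mu]_y (heat_kernel_lower k t x y * f y)).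
Proof.
move=> k0 sf vf; set G := Gamma_fun _.
rewrite /hermite_riesz hermite_npowE // iter_hermite_lower_series; last exact: rapid_npow_coef.
pose d n := lower_weight R k n * (hermite_coef (n + k) f * h n x).
have [C hC] : exists C, forall n, `|d n| <= C * tele R n.
  have rc := rapid_iter_lower_coef k (rapid_hermite_coef sf vf).
  have [C hC] := hermite_series_tele rc; exists C => n.
  by have := hC x n; rewrite iter_lower_coef /d mulrA.
have C0 : 0 <= C.
  by have := le_trans (normr_ge0 _) (hC 0%N); rewrite pmulr_lge0 // tele_gt0.
pose S N t := Num.sqrt t ^+ k / t * series (fun n => heat_decay t (n + k) * d n) N.
have dec t n : 0 < t -> heat_decay t n <= expR (- (2^-1 * t)).
  by move=> t0; rewrite ler_expR lerN2 ler_wpM2r ?(ltW t0) // hermite_eigen_ge.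
have dec0 t n : 0 <= heat_decay t n by exact: expR_ge0.
have dec1 t n : 0 < t -> heat_decay t n <= 1.
  by move=> t0; rewrite -[leRHS]expR0 ler_expR oppr_le0 mulr_ge0 ?(ltW t0) // ltW ?hermite_eigen_gt0.
have gi n : mu.-integrable (@ray R) (EFin \o gamma_integrand k (hermite_eigen R n)).
  by apply: integrable_gamma_integrand => //; exact: hermite_eigen_ge.
have mray : measurable (@ray R : set (measurableTypeR R)) := measurable_itv _.
have SE N : S N = fun t => \sum_(0 <= n < N) d n * gamma_integrand k (hermite_eigen R (n + k)) t.
  apply/funext => t; rewrite /S /series /= mulr_sumr; apply: eq_bigr => n _.
  by rewrite /gamma_integrand /heat_decay; ring.
have H : (\int[mu]_(t in @ray R) S N t) @[N --> \oo] -->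
    \int[mu]_(t in @ray R) (Num.sqrt t ^+ k / t * \int[mu]_y (heat_kernel_lower k t x y * f y)).
  apply: (@Rintegral_dominated_cvg _ _ _ mu (@ray R) _ _ (fun t => C * gamma_integrand k 2^-1 t)) => //.
  - move=> N; rewrite SE; apply: measurable_sum => n; apply: measurable_ray_fun => t t0.
    by apply: cvgM; [exact: cvg_cst|exact: continuous_gamma_integrand].
  - move=> t /rayP t0; apply: cvgM; first exact: cvg_cst.
    rewrite heat_semigroup_lower //.
    have -> : (fun n => iter k (@lower_coef R) (heat_decay t) n * (hermite_coef (n + k) f * h n x)) =
       (fun n => heat_decay t (n + k) * d n).
      by apply/funext => n; rewrite iter_lower_coef /d; ring.
    apply: (@summable_tele _ _ C) => n; rewrite normrM ger0_norm //.
    by apply: le_trans (hC n); rewrite ler_piMl // dec1.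
  - by apply: integrable_scale => //; apply: integrable_gamma_integrand.
  - move=> N t /rayP t0.
    have q0 : 0 <= Num.sqrt t ^+ k / t by rewrite divr_ge0 ?exprn_ge0 ?sqrtr_ge0 ?(ltW t0).
    rewrite /S normrM ger0_norm // /gamma_integrand mulrCA ler_wpM2l //.
    apply: le_trans (ler_norm_sum _ _ _) _.
    apply: (@le_trans _ _ (\sum_(0 <= i < N) (C * expR (- (2^-1 * t))) * tele R i)).
      apply: ler_sum => i _; rewrite normrM ger0_norm // mulrAC mulrC.
      by apply: ler_pM => //; exact: dec.
    rewrite -mulr_sumr sum_tele // ler_piMr ?mulr_ge0 ?expR_ge0 //.
    by rewrite invr1 gerBl invr_ge0.
rewrite -(cvg_lim (@Rhausdorff R) H) /hermite_series.
have cv : cvgn (series (fun n => iter k (@lower_coef R) (npow_coef k f) n * h n x)).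
  have [C' hC'] := hermite_series_tele (rapid_iter_lower_coef k (rapid_npow_coef k sf vf)).
  exact: summable_tele (hC' x).
symmetry; apply: cvg_lim => //.
have -> : (fun N => \int[mu]_(t in @ray R) S N t) = (fun N =>
    G * series (fun n => iter k (@lower_coef R) (npow_coef k f) n * h n x) N).
  apply/funext => N; rewrite SE /series /= mulr_sumr.
  have iT n : mu.-integrable (@ray R) (EFin \o (fun t => d n * gamma_integrand k (hermite_eigen R (n + k)) t)).
    exact: integrable_scale.
  rewrite (Rintegral_sum N mray iT).2; apply: eq_bigr => n _.
  rewrite RintegralZl // /G (@Gamma_half_scale _ k (hermite_eigen R (n + k))) //; last first.
    exact: hermite_eigen_ge.
  rewrite iter_lower_coef /npow_coef powR_half_opp ?hermite_eigen_gt0 // /d.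
  have s0 : Num.sqrt (hermite_eigen R (n + k)) ^+ k != 0.
    by rewrite expf_neq0 // gt_eqF // sqrtr_gt0 hermite_eigen_gt0.
  by field.
by apply: cvgM; [exact: cvg_cst|exact: cv].
Qed.

End HeatRepresentation.

Lemma is_derive_expR_comp (R : realType) (g : R -> R) (x d : R) :
  is_derive x 1 g d -> is_derive x 1 (fun w => expR (g w)) (expR (g x) * d).
Proof. by move=> dg; apply: (is_derive_comp_eq (is_derive_expR (g x)) dg). Qed.

(** * Closed form of the lowered heat kernel *)

Section KernelClosedForm.
Variable R : realType.
Implicit Types (t x y u : R) (k n : nat).

(** By Rodrigues' formula this is (-1)^k times the k-th derivative of e^(-u^2). *)
Definition gauss_hermite k u : R := (hermite_poly R k).[u] * expR (- u ^+ 2).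

Lemma is_derive_gauss_hermite k u :
  is_derive u 1 (gauss_hermite k) (- gauss_hermite k.+1 u).
Proof.
rewrite /gauss_hermite; have dp := is_derive_poly (hermite_poly R k) u.
have de : is_derive u 1 (fun v : R => expR (- v ^+ 2)) (- (2 * u) * expR (- u ^+ 2)).
  have d2 : is_derive u 1 (fun v : R => - v ^+ 2) (- (2 * u)).
    by apply: is_derive_eq; rewrite /GRing.scale /=; ring.
  by rewrite mulrC; exact: (is_derive_expR_comp d2).
apply: is_derive_eq; rewrite horner_hermiteS /GRing.scale /=; ring.
Qed.

Lemma continuous_gauss_hermite k : continuous (gauss_hermite k).
Proof. by move=> u; apply: is_derive_continuous (is_derive_gauss_hermite k u). Qed.

Lemma hermite_poly_growth k : exists2 C, 0 <= C &
  forall u, `|(hermite_poly R k).[u]| <= C * (1 + u ^+ 2) ^+ k.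
Proof.
have step (a b : R) u n : 0 <= a -> 0 <= b -> 
    `|(hermite_poly R n.+1).[u]| <= a * (1 + u ^+ 2) ^+ n.+1 ->
    `|(hermite_poly R n).[u]| <= b * (1 + u ^+ 2) ^+ n ->
    `|(hermite_poly R n.+2).[u]| <= (2 * a + 2 * n.+1%:R * b) * (1 + u ^+ 2) ^+ n.+2.
  move=> a0 b0 ha hb; rewrite horner_hermite_rec.
  have w1 : 1 <= 1 + u ^+ 2 by rewrite lerDl sqr_ge0.
  have w0 : 0 <= 1 + u ^+ 2 by apply: le_trans w1.
  have uw : `|u| <= 1 + u ^+ 2.
    have := sqr_ge0 (`|u| - 1); have := real_normK (num_real u); nra.
  apply: le_trans (ler_normB _ _) _; rewrite [leRHS]mulrDl; apply: lerD.
    have -> : 2 * a * (1 + u ^+ 2) ^+ n.+2 = 2 * (1 + u ^+ 2) * (a * (1 + u ^+ 2) ^+ n.+1).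
      by rewrite [in LHS]exprS; ring.
    rewrite !normrM [`|2|]ger0_norm //.
    by apply: ler_pM; rewrite ?mulr_ge0 // ler_wpM2l.
  rewrite !normrM [`|2|]ger0_norm // [`|n.+1%:R|]ger0_norm // -mulrA.
  rewrite [leRHS](_ : _ = 2 * n.+1%:R * (b * (1 + u ^+ 2) ^+ n.+2)); last by ring.
  rewrite mulrA; apply: ler_wpM2l; first exact: mulr_ge0.
  by apply: le_trans hb _; rewrite ler_wpM2l // ler_weXn2l // -addn2 leq_addr.
(* The recurrence has two terms, so the induction carries the bounds for k and k+1 together. *)
suff [C [D [C0 D0 h]]] : exists C D, [/\ 0 <= C, 0 <= D & forall u,
   `|(hermite_poly R k).[u]| <= C * (1 + u ^+ 2) ^+ k /\
   `|(hermite_poly R k.+1).[u]| <= D * (1 + u ^+ 2) ^+ k.+1].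
  by exists C => // u; have [] := h u.
elim: k => [|k [C [D [C0 D0 IH]]]].
  exists 1, 2; split => // u; rewrite horner_hermite0 horner_hermite1 !expr0 normr1 mulr1.
  split => //; rewrite expr1 normrM [`|2|]ger0_norm // ler_wpM2l //.
  have := sqr_ge0 (`|u| - 1); have := real_normK (num_real u); nra.
exists D, (2 * D + 2 * k.+1%:R * C); split => //.
  by rewrite addr_ge0 // !mulr_ge0.
by move=> u; have [h1 h2] := IH u; split => //; exact: step.
Qed.

(** Half of the Gaussian absorbs all polynomial factors; the other half is kept for integration in
    y. *)
Lemma gauss_hermite_bound k n : exists2 C, 0 <= C &
  forall u, (1 + u ^+ 2) ^+ n * `|gauss_hermite k u| <= C * expR (- (u ^+ 2 / 2)).
Proof.
have [C C0 hC] := hermite_poly_growth k.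
exists (C * (2 * (n + k).+1%:R) ^+ (n + k)); first by rewrite mulr_ge0 ?exprn_ge0 ?mulr_ge0.
move=> u; rewrite /gauss_hermite normrM [`|expR _|]ger0_norm ?expR_ge0 // mulrA.
have -> : expR (- u ^+ 2) = expR (- (u ^+ 2 / 2)) * expR (- (u ^+ 2 / 2)).
  by rewrite -expRD; congr expR; field.
rewrite mulrA ler_wpM2r ?expR_ge0 // expRN ler_pdivrMr ?expR_gt0 //.
have w0 : 0 <= 1 + u ^+ 2 by rewrite addr_ge0 ?sqr_ge0.
apply: (@le_trans _ _ ((1 + u ^+ 2) ^+ n * (C * (1 + u ^+ 2) ^+ k))).
  by rewrite ler_wpM2l ?exprn_ge0.
rewrite mulrCA -exprD -mulrA ler_wpM2l //.
by apply: one_plus_exp_bound; exact: sqr_ge0.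
Qed.

(** The length scale of the heat kernel in y: asymptotic to sqrt(2t) at 0 and tending to 1 at
    infinity. *)
Definition rho t : R := Num.sqrt (1 - expR (- t) ^+ 2).
Definition kernel_arg x t y : R := (expR (- t) * x - y) / rho t.

Lemma expRN_lt1 t : 0 < t -> expR (- t) < 1.
Proof. by move=> t0; rewrite -[ltRHS]expR0 ltr_expR oppr_lt0. Qed.

Lemma rho2_gt0 t : 0 < t -> 0 < 1 - expR (- t) ^+ 2.
Proof. by move=> t0; rewrite subr_gt0 exprn_ilt1 ?expR_ge0 ?expRN_lt1. Qed.

Lemma rho_gt0 t : 0 < t -> 0 < rho t.
Proof. by move=> t0; rewrite sqrtr_gt0 rho2_gt0. Qed.

Lemma sqr_rho t : 0 < t -> rho t ^+ 2 = 1 - expR (- t) ^+ 2.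
Proof. by move=> t0; rewrite sqr_sqrtr // ltW // rho2_gt0. Qed.

(** Completing the square in Mehler's formula: its exponent is (y^2 - x^2)/2 - u^2 with u =
    [kernel_arg x t y]. *)
Lemma heat_kernel_mehler t x y : 0 < t -> heat_kernel t x y =
  expR (- (t / 2)) / (Num.sqrt pi * rho t) * expR (y ^+ 2 / 2) *
  (expR (- (x ^+ 2 / 2)) * gauss_hermite 0 (kernel_arg x t y)).
Proof.
move=> t0; have r0 := expR_gt0 (- t); have r1 := expRN_lt1 t0.
have -> : heat_kernel t x y =
    expR (- (t / 2)) * psum (fun n => hermite_fun n x * hermite_fun n y) (expR (- t)).
  rewrite -psumZ; last 2 first.
  - by apply: subexpM; exact: subexp_hermite_fun.
  - by rewrite gtr0_norm.
  congr (limn (series _)); apply/funext => n.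
  have -> : expR (- (hermite_eigen R n * t)) = expR (- (t / 2)) * expR (- t) ^+ n.
    by rewrite -expRM_natl -expRD /hermite_eigen; congr expR; field.
  by rewrite /=; ring.
rewrite (mehler x y (ltW r0) r1) -/(rho t) /gauss_hermite horner_hermite0 mul1r.
rewrite -!mulrA; congr (_ * (_ * _)); rewrite -!expRD; congr expR.
rewrite /mehler_exponent /kernel_arg expr_div_n sqr_rho //.
by field; rewrite gt_eqF // rho2_gt0.
Qed.

(** The operator d/dx + x annihilates e^(-x^2/2), so it acts as a plain derivative on the remaining
    factor, where each step gives -r/rho and raises the Hermite index. *)
Lemma heat_kernel_lower_mehler k t x y : 0 < t -> heat_kernel_lower k t x y =
  expR (- (t / 2)) / (Num.sqrt pi * rho t) * expR (y ^+ 2 / 2) *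
  ((- (expR (- t) / rho t)) ^+ k * (expR (- (x ^+ 2 / 2)) * gauss_hermite k (kernel_arg x t y))).
Proof.
move=> t0; rewrite /heat_kernel_lower.
set c := _ * expR (y ^+ 2 / 2).
suff -> : iter k (@hermite_lower R) (heat_kernel t ^~ y) = fun x =>
  c * ((- (expR (- t) / rho t)) ^+ k * (expR (- (x ^+ 2 / 2)) * gauss_hermite k (kernel_arg x t y))).
  by [].
elim: k => [|k IH] /=; apply/funext => z.
  by rewrite expr0 mul1r /c heat_kernel_mehler.
rewrite IH /hermite_lower; set b := _ ^+ k.
have rn : rho t != 0 by rewrite gt_eqF // rho_gt0.
have da : is_derive z 1 (fun w => kernel_arg w t y) (expR (- t) / rho t).
  by rewrite /kernel_arg; apply: is_derive_eq; rewrite /GRing.scale /=; field.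
have dg : is_derive z 1 (fun w => gauss_hermite k (kernel_arg w t y))
    (- gauss_hermite k.+1 (kernel_arg z t y) * (expR (- t) / rho t)).
  exact: (@is_derive_comp_eq R (gauss_hermite k) (fun w => kernel_arg w t y) z _ _ _
    (is_derive_gauss_hermite k (kernel_arg z t y)) da).
have de : is_derive z 1 (fun w : R => expR (- (w ^+ 2 / 2))) (- z * expR (- (z ^+ 2 / 2))).
  have d2 : is_derive z 1 (fun w : R => - (w ^+ 2 / 2)) (- z).
    by apply: is_derive_eq; rewrite /GRing.scale /=; field.
  by rewrite mulrC; exact: (is_derive_expR_comp d2).
have D : is_derive z 1 (fun w => c * (b * (expR (- (w ^+ 2 / 2)) *
    gauss_hermite k (kernel_arg w t y)))) (c * (b * (expR (- (z ^+ 2 / 2)) *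
   (- gauss_hermite k.+1 (kernel_arg z t y) * (expR (- t) / rho t)) +
   gauss_hermite k (kernel_arg z t y) * (- z * expR (- (z ^+ 2 / 2)))))).
  by apply: is_derive_eq.
rewrite (derive1_is_derive D) [(- (expR (- t) / rho t)) ^+ k.+1]exprS -/b.
move: (gauss_hermite k _) (gauss_hermite k.+1 _) (expR (- (z ^+ 2 / 2))) (expR (- t) / rho t) => P Q E q.
by clearbody b c; ring.
Qed.

End KernelClosedForm.

(** * Majorants for the kernel in t and y *)

Section KernelDomination.
Variable R : realType.
Implicit Types (t x y u A K C : R) (k n : nat) (g : R -> R).
Notation mu := (@lebesgue_measure R).

(** The factor t^(k/2-1) is merged with the powers of r/rho: [ray_ratio] stays between 0 and
    2^(-1/2), its limit at 0, so [ray_mult k] behaves like 2^(-k/2) / t there. *)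
Definition ray_ratio t : R := Num.sqrt t * expR (- t) / rho t.
Definition ray_mult k t : R := ray_ratio t ^+ k * expR (- (t / 2)) / t.

(** Both sides come from 1 + s <= exp s, at s = 2t and at s = -2t. *)
Lemma rho2_bounds t : 0 < t ->
  2 * t * expR (- t) ^+ 2 <= 1 - expR (- t) ^+ 2 <= 2 * t.
Proof.
move=> t0; rewrite expRN exprVn -expRM_natl; apply/andP; split.
  rewrite lerBrDr -{2}[_^-1]mul1r -mulrDl ler_pdivrMr ?expR_gt0 // mul1r addrC.
  exact: expR_ge1Dx.
by rewrite -expRN lerBlDr -lerBlDl; exact: expR_ge1Dx.
Qed.

Lemma rho_le t : 0 < t -> rho t <= Num.sqrt 2 * Num.sqrt t.
Proof.
move=> t0; rewrite -sqrtrM //; apply: ler_wsqrtr.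
by have /andP[_] := rho2_bounds t0.
Qed.

Lemma ray_ratio_ge0 t : 0 <= ray_ratio t.
Proof. by rewrite divr_ge0 ?mulr_ge0 ?sqrtr_ge0 ?expR_ge0. Qed.

Lemma ray_ratio_bounds t : 0 < t ->
  expR (- t) / Num.sqrt 2 <= ray_ratio t <= (Num.sqrt 2)^-1.
Proof.
move=> t0; have /andP[b1 b2] := rho2_bounds t0; have r0 := rho_gt0 t0.
have s2 : 0 < Num.sqrt 2 :> R := sqrt2_gt0 R.
apply/andP; split; rewrite /ray_ratio.
  rewrite ler_pdivlMr // mulrAC ler_pdivrMr // mulrC -mulrA [_ * Num.sqrt 2]mulrC mulrCA.
  by rewrite mulrA; apply: ler_wpM2r; [exact: expR_ge0|exact: rho_le].
rewrite ler_pdivrMr // -[leLHS]ger0_norm ?mulr_ge0 ?sqrtr_ge0 ?expR_ge0 //.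
rewrite -[leRHS]ger0_norm ?mulr_ge0 ?invr_ge0 ?sqrtr_ge0 // ?(ltW r0) //.
rewrite -ler_sqr ?nnegrE // !real_normK ?num_real // !exprMn exprVn sqr_rho // sqr_sqrt2.
by rewrite sqr_sqrtr ?(ltW t0) // ler_pdivlMl // mulrA.
Qed.

Lemma ray_ratio_le1 t : 0 < t -> ray_ratio t <= 1.
Proof.
move=> t0; have /andP[_ /le_trans] := ray_ratio_bounds t0; apply.
by rewrite invf_le1 ?sqrt2_gt0 // sqrt2_ge1.
Qed.

Lemma ray_mult_ge0 k t : 0 < t -> 0 <= ray_mult k t.
Proof.
by move=> t0; rewrite !mulr_ge0 ?exprn_ge0 ?ray_ratio_ge0 ?expR_ge0 ?invr_ge0 // ltW.
Qed.

Lemma ray_mult_le k t : 0 < t -> ray_mult k t <= expR (- (t / 2)) / t.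
Proof.
move=> t0; rewrite /ray_mult ler_wpM2r ?invr_ge0 ?(ltW t0) // ler_piMl ?expR_ge0 //.
by rewrite exprn_ile1 ?ray_ratio_ge0 // ray_ratio_le1.
Qed.

(** For t > 0, the integrand t^(k/2-1) (d/dx + x)^k W_t(x,y) in closed form. *)
Definition riesz_heat k x t y : R := (-1) ^+ k / Num.sqrt pi *
  (ray_mult k t / rho t) * expR ((y ^+ 2 - x ^+ 2) / 2) * gauss_hermite k (kernel_arg x t y).

Lemma riesz_heatE k x t y : 0 < t ->
  Num.sqrt t ^+ k / t * heat_kernel_lower k t x y = riesz_heat k x t y.
Proof.
move=> t0; rewrite heat_kernel_lower_mehler // /riesz_heat /ray_mult /ray_ratio.
have -> : expR ((y ^+ 2 - x ^+ 2) / 2) = expR (y ^+ 2 / 2) * expR (- (x ^+ 2 / 2)).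
  by rewrite -expRD; congr expR; ring.
rewrite [(- (expR (- t) / rho t)) ^+ k]exprNn !expr_div_n !exprMn.
have r0 : rho t != 0 by rewrite gt_eqF // rho_gt0.
have p0 : Num.sqrt pi != 0 :> R by rewrite gt_eqF // sqrtr_gt0 pi_gt0.
have rk : rho t ^+ k != 0 by rewrite expf_neq0.
move: (rho t ^+ k) rk (Num.sqrt t ^+ k) (expR (- t) ^+ k) ((-1) ^+ k) => a a0 b c e.
field; by rewrite r0 p0 a0 gt_eqF.
Qed.

Lemma norm_riesz_heat k x t y : 0 < t -> `|riesz_heat k x t y| = (Num.sqrt pi)^-1 *
  (ray_mult k t / rho t) * expR ((y ^+ 2 - x ^+ 2) / 2) * `|gauss_hermite k (kernel_arg x t y)|.
Proof.
move=> t0; have r0 := rho_gt0 t0; have m0 := ray_mult_ge0 k t0; rewrite /riesz_heat.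
move: (ray_mult k t) (rho t) (gauss_hermite k _) m0 r0 => m r G m0 r0.
rewrite !normrM normrX normrN1 expr1n mul1r !normfV.
by rewrite [`|Num.sqrt _|]ger0_norm ?sqrtr_ge0 // (ger0_norm m0) (gtr0_norm r0) [`|expR _|]ger0_norm ?expR_ge0.
Qed.

(** From y - x = - rho u - (1 - r) x and 1 - r <= rho: a factor |y - x| gains one rho at the price
    of a polynomial in u. *)
Lemma kernel_arg_bound x t y : 0 < t ->
  `|y - x| <= rho t * ((1 + `|x|) * (1 + kernel_arg x t y ^+ 2)).
Proof.
move=> t0; have r0 := rho_gt0 t0; set u := kernel_arg x t y.
have e1 := expRN_lt1 t0; have e0 := expR_gt0 (- t).
have q : 1 - expR (- t) <= rho t.
  rewrite -[leLHS]ger0_norm ?subr_ge0 ?(ltW e1) // -sqrtr_sqr; apply: ler_wsqrtr; nra.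
have E : y - x = - (rho t * u) - (1 - expR (- t)) * x.
  by rewrite /u /kernel_arg; field; rewrite gt_eqF.
have un : `|u| <= 1 + u ^+ 2.
  have := sqr_ge0 (`|u| - 1); have := real_normK (num_real u); nra.
clearbody u; rewrite E; apply: le_trans (ler_normB _ _) _; rewrite normrN !normrM.
rewrite (gtr0_norm r0) [`|1 - _|]ger0_norm ?subr_ge0 ?(ltW e1) //.
apply: (@le_trans _ _ (rho t * `|u| + rho t * `|x|)); first by rewrite lerD2l ler_wpM2r.
rewrite -mulrDr ler_pM2l //; have := normr_ge0 x; have := sqr_ge0 u; nra.
Qed.

Definition ray_gauss x t y : R := expR (- (kernel_arg x t y ^+ 2 / 2)).

(** As a function of y the Gaussian has mean r x and standard deviation rho, so the normal density
    supplies its integral. *)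
Lemma ray_gaussE x t y : 0 < t ->
  ray_gauss x t y = normal_fun (expR (- t) * x) (rho t) y.
Proof.
move=> t0; rewrite /ray_gauss /normal_fun /kernel_arg; congr expR.
rewrite -mulr_natr; field; by rewrite gt_eqF // rho_gt0.
Qed.

Lemma integral_ray_gauss x t : 0 < t ->
  (\int[mu]_y (ray_gauss x t y)%:E)%E = (rho t * Num.sqrt (pi *+ 2))%:E.
Proof.
move=> t0; have r0 := rho_gt0 t0; have rn : rho t != 0 by rewrite gt_eqF.
have N := @integral_normal_pdf R (expR (- t) * x) (rho t).
have p0 : 0 < normal_peak (rho t) by exact: normal_peak_gt0.
have pE : (normal_peak (rho t))^-1 = rho t * Num.sqrt (pi *+ 2).
  rewrite /normal_peak invrK -mulrnAr sqrtrM ?sqr_ge0 // sqrtr_sqr gtr0_norm //.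
rewrite (normal_pdfE _ rn) in N.
rewrite -pE -[RHS]mule1 -N -ge0_integralZl //.
- apply: eq_integral => y _; rewrite -EFinM ray_gaussE // mulrA mulVf ?mul1r //.
  by rewrite gt_eqF.
- apply/measurable_EFinP; apply: measurable_funM => //; exact: measurable_normal_fun.
- by move=> y _; rewrite lee_fin mulr_ge0 ?(ltW p0) // normal_fun_ge0.
- by rewrite lee_fin invr_ge0 ltW.
Qed.

Lemma measurable_kernel_arg x t : measurable_fun setT (kernel_arg x t).
Proof.
apply: continuous_measurable_fun => y; rewrite /kernel_arg.
by apply: cvgM; [apply: cvgB; [exact: cvg_cst|exact: cvg_id]|exact: cvg_cst].
Qed.

Lemma integrable_ray_gauss x t : 0 < t ->
  mu.-integrable setT (EFin \o ray_gauss x t).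
Proof.
move=> t0; apply/integrableP; split.
  apply/measurable_EFinP; apply: measurableT_comp => //.
  apply: measurableT_comp => //; apply: measurable_funM => //.
  by apply: measurable_funX; exact: measurable_kernel_arg.
have -> : (\int[mu]_y `|(EFin \o ray_gauss x t) y|)%E = (\int[mu]_y (ray_gauss x t y)%:E)%E.
  by apply: eq_integral => y _; rewrite /= ger0_norm // expR_ge0.
by rewrite integral_ray_gauss // ltry.
Qed.

Lemma measurable_riesz_heat k x t : measurable_fun setT (riesz_heat k x t).
Proof.
apply: measurable_funM.
  apply: measurable_funM => //; apply: measurableT_comp => //.
  apply: measurable_funM => //; apply: measurable_funB => //; exact: measurable_funX.
apply: measurableT_comp; last exact: measurable_kernel_arg.
by apply: continuous_measurable_fun; exact: continuous_gauss_hermite.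
Qed.

(** The rho gained from |y - x| cancels the 1/rho of the kernel. The growing factor e^(y^2/2) is
    harmless because y stays in a bounded set. *)
Lemma riesz_heat_dom k x A : exists2 C, 0 <= C & forall t y, 0 < t -> `|y| <= A ->
  `|riesz_heat k x t y| * `|y - x| <= C * (expR (- (t / 2)) / t) * ray_gauss x t y.
Proof.
have [C C0 hC] := gauss_hermite_bound R k 1.
have p0 : 0 < Num.sqrt pi :> R by rewrite sqrtr_gt0 pi_gt0.
have D0 : 0 <= (Num.sqrt pi)^-1 * expR (A ^+ 2 / 2) * ((1 + `|x|) * C).
  by rewrite !mulr_ge0 ?invr_ge0 ?(ltW p0) ?expR_ge0 ?addr_ge0.
exists ((Num.sqrt pi)^-1 * expR (A ^+ 2 / 2) * ((1 + `|x|) * C)) => // t y t0 yA.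
have r0 := rho_gt0 t0; have m0 := ray_mult_ge0 k t0.
set u := kernel_arg x t y.
have eA : expR ((y ^+ 2 - x ^+ 2) / 2) <= expR (A ^+ 2 / 2).
  rewrite ler_expR ler_pM2r //; apply: (@le_trans _ _ (y ^+ 2)); first by rewrite gerBl sqr_ge0.
  by rewrite -(real_normK (num_real y)) lerXn2r ?nnegrE // (le_trans _ yA).
rewrite norm_riesz_heat // -/u.
have ml := ray_mult_le k t0; move: (ray_mult k t) m0 ml => m m0 ml.
apply: (@le_trans _ _ ((Num.sqrt pi)^-1 * ((expR (- (t / 2)) / t) / rho t) * expR (A ^+ 2 / 2) *
   `|gauss_hermite k u| * (rho t * ((1 + `|x|) * (1 + u ^+ 2))))).
  apply: ler_pM; rewrite ?mulr_ge0 ?invr_ge0 ?sqrtr_ge0 ?expR_ge0 ?(ltW r0) //.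
    apply: ler_wpM2r => //.
    apply: ler_pM; rewrite ?mulr_ge0 ?invr_ge0 ?sqrtr_ge0 ?expR_ge0 ?(ltW r0) //.
    apply: ler_wpM2l; first by rewrite invr_ge0 ltW.
    by apply: ler_wpM2r => //; rewrite invr_ge0 ltW.
  exact: kernel_arg_bound.
have h := hC u; rewrite expr1 in h.
have -> : (Num.sqrt pi)^-1 * ((expR (- (t / 2)) / t) / rho t) * expR (A ^+ 2 / 2) *
   `|gauss_hermite k u| * (rho t * ((1 + `|x|) * (1 + u ^+ 2))) =
   (Num.sqrt pi)^-1 * expR (A ^+ 2 / 2) * (1 + `|x|) * (expR (- (t / 2)) / t) *
   ((1 + u ^+ 2) * `|gauss_hermite k u|).
  by field; rewrite !gt_eqF.
have -> : (Num.sqrt pi)^-1 * expR (A ^+ 2 / 2) * ((1 + `|x|) * C) * (expR (- (t / 2)) / t) * ray_gauss x t y =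
  (Num.sqrt pi)^-1 * expR (A ^+ 2 / 2) * (1 + `|x|) * (expR (- (t / 2)) / t) * (C * ray_gauss x t y).
  by ring.
apply: ler_wpM2l => //.
by rewrite !mulr_ge0 ?invr_ge0 ?sqrtr_ge0 ?expR_ge0 ?addr_ge0 ?(ltW t0).
Qed.

(* The test functions for which the double integral converges absolutely. *)
Definition lip_at x A K g :=
  [/\ measurable_fun setT g, vanish_out A g & forall y, `|g y| <= K * `|y - x|].

Lemma lip_at_ge0 x A K g : lip_at x A K g -> 0 <= K.
Proof.
move=> [_ _ h]; have := le_trans (normr_ge0 _) (h (x + 1)).
by rewrite [x + 1]addrC addrK normr1 mulr1.
Qed.

(** Integrating the Gaussian in y yields another rho <= sqrt(2t), so the 1/t becomes t^(-1/2). C is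
    chosen before g, which later makes the bound uniform in the truncation radius. *)
Lemma riesz_heat_pairing k x A K : exists2 C, 0 <= C & forall g, lip_at x A K g ->
  forall t, 0 < t ->
   mu.-integrable setT (EFin \o (fun y => riesz_heat k x t y * g y)) /\
   \int[mu]_y `|riesz_heat k x t y * g y| <= C * ray_dom t.
Proof.
have [C C0 hC] := riesz_heat_dom k x A.
have [D D0 hD] := @half_power_dom R 1 isT.
(* The absolute value is there because K >= 0 is known only once some g is given. *)
pose E := `|K| * C * Num.sqrt (pi *+ 2) * Num.sqrt 2.
have E0 : 0 <= E by rewrite !mulr_ge0 ?sqrtr_ge0.
exists (E * D); first by rewrite mulr_ge0 // ltW.
move=> g lg t t0; have K0 := lip_at_ge0 lg; case: lg => mg vg hg.
have bnd y : `|riesz_heat k x t y * g y| <= K * (C * (expR (- (t / 2)) / t)) * ray_gauss x t y.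
  have T0 : 0 <= K * (C * (expR (- (t / 2)) / t)) * ray_gauss x t y.
    by rewrite !mulr_ge0 ?expR_ge0 ?invr_ge0 ?(ltW t0).
  have [yA|yA] := leP `|y| A; last by rewrite vg // mulr0 normr0.
  rewrite normrM; apply: (@le_trans _ _ (`|riesz_heat k x t y| * (K * `|y - x|))).
    by rewrite ler_wpM2l.
  by rewrite mulrCA -mulrA ler_wpM2l //; exact: hC.
have gi := integrable_ray_gauss x t0.
have sgi : mu.-integrable setT (EFin \o (fun y => K * (C * (expR (- (t / 2)) / t)) * ray_gauss x t y)).
  exact: integrable_scale.
have mf : measurable_fun setT (fun y => riesz_heat k x t y * g y).
  by apply: measurable_funM => //; exact: measurable_riesz_heat.
have fi : mu.-integrable setT (EFin \o (fun y => riesz_heat k x t y * g y)).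
  exact: integrable_dominated sgi.
split => //.
apply: (@le_trans _ _ (\int[mu]_y (K * (C * (expR (- (t / 2)) / t)) * ray_gauss x t y))).
  by apply: le_Rintegral => //; exact: (integrable_abse fi).
rewrite RintegralZl // /Rintegral integral_ray_gauss //=.
have h := hD t t0; rewrite expr1 in h.
apply: (@le_trans _ _ (E * (Num.sqrt t / t * expR (- (2^-1 * t))))); last first.
  by rewrite -[leRHS]mulrA; apply: ler_wpM2l.
rewrite /E (ger0_norm K0) [2^-1 * t]mulrC.
have -> : K * C * Num.sqrt (pi *+ 2) * Num.sqrt 2 * (Num.sqrt t / t * expR (- (t / 2))) =
   K * (C * (expR (- (t / 2)) / t)) * ((Num.sqrt 2 * Num.sqrt t) * Num.sqrt (pi *+ 2)) by ring.
apply: ler_wpM2l; first by rewrite !mulr_ge0 ?expR_ge0 ?invr_ge0 ?(ltW t0).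
by apply: ler_wpM2r; [exact: sqrtr_ge0|exact: rho_le].
Qed.

Lemma continuous_rho t : {for t, continuous (@rho R)}.
Proof.
apply: (@continuous_comp _ _ _ (fun t : R => 1 - expR (- t) ^+ 2) (@Num.sqrt R)).
  apply: cvgB; first exact: cvg_cst.
  apply: (@continuous_comp _ _ _ (fun t : R => expR (- t)) (fun z => z ^+ 2)).
    apply: (@continuous_comp _ _ _ (fun t : R => - t) expR); first exact: cvgN.
    exact: continuous_expR.
  exact: exprn_continuous.
exact: sqrt_continuous.
Qed.

Lemma continuous_rhoV t : 0 < t -> {for t, continuous (fun t => (rho t)^-1)}.
Proof.
by move=> t0; apply: cvgV; [rewrite gt_eqF // rho_gt0|exact: continuous_rho].
Qed.

Lemma continuous_expRN (c t : R) : {for t, continuous (fun t : R => expR (- (t * c)))}.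
Proof.
apply: (@continuous_comp _ _ _ (fun t : R => - (t * c)) expR).
  by apply: cvgN; apply: cvgM; [exact: cvg_id|exact: cvg_cst].
exact: continuous_expR.
Qed.

Lemma continuous_ray_mult k t : 0 < t -> {for t, continuous (ray_mult k)}.
Proof.
move=> t0; apply: cvgM; last by apply: cvgV; [rewrite gt_eqF|exact: cvg_id].
apply: cvgM; last exact: continuous_expRN.
apply: (@continuous_comp _ _ _ ray_ratio (fun z => z ^+ k)); last exact: exprn_continuous.
apply: cvgM; last exact: continuous_rhoV.
apply: cvgM; first exact: sqrt_continuous.
apply: (@continuous_comp _ _ _ (fun t : R => - t) expR); first exact: cvgN.
exact: continuous_expR.
Qed.

End KernelDomination.

(** * Exchanging the t-integral and the y-integral *)

Section KernelFubini.
Variable R : realType.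
Implicit Types (t x y u A K C : R) (k n : nat) (g : R -> R).
Notation mu := (@lebesgue_measure R).

Let mray : measurable (@ray R : set (measurableTypeR R)) := measurable_itv _.

Definition riesz_kernel k x y : R := \int[mu]_(t in @ray R) riesz_heat k x t y.

Lemma hermite_riesz_kernelE k x y :
  hermite_riesz_kernel k x y = (Gamma_fun (k%:R / 2 : R))^-1 * riesz_kernel k x y.
Proof.
congr (_ * _); apply: eq_Rintegral => t; rewrite inE => /rayP t0.
by rewrite -riesz_heatE // powR_half.
Qed.

(** The kernel is written through functions of t alone and of y alone, from which joint
    measurability follows by composition. *)
Definition riesz_amp k t : R := (-1) ^+ k / Num.sqrt pi * (ray_mult k t / rho t).
Definition riesz_shift x t : R := expR (- t) * x / rho t.

Lemma riesz_heat_factor k x t y : riesz_heat k x t y =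
  riesz_amp k t * expR ((y ^+ 2 - x ^+ 2) / 2) *
  gauss_hermite k (riesz_shift x t - y * (rho t)^-1).
Proof. by rewrite /riesz_shift -mulrBl. Qed.

Lemma continuous_riesz_amp k t : 0 < t -> {for t, continuous (riesz_amp k)}.
Proof.
move=> t0; apply: cvgM; first exact: cvg_cst.
by apply: cvgM; [exact: continuous_ray_mult|exact: continuous_rhoV].
Qed.

Lemma continuous_riesz_shift x t : 0 < t -> {for t, continuous (riesz_shift x)}.
Proof.
move=> t0; apply: cvgM; last exact: continuous_rhoV.
apply: cvgM; last exact: cvg_cst.
apply: (@continuous_comp _ _ _ (fun t : R => - t) expR); first exact: cvgN.
exact: continuous_expR.
Qed.

Lemma continuous_riesz_heat k x y t : 0 < t ->
  {for t, continuous (fun t => riesz_heat k x t y)}.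
Proof.
move=> t0; rewrite (_ : (fun t => _) = (fun t => riesz_amp k t * expR ((y ^+ 2 - x ^+ 2) / 2) *
  gauss_hermite k (riesz_shift x t - y * (rho t)^-1))); last first.
  by apply/funext => z; exact: riesz_heat_factor.
apply: cvgM; first by apply: cvgM; [exact: continuous_riesz_amp|exact: cvg_cst].
apply: (@continuous_comp _ _ _ (fun t => riesz_shift x t - y * (rho t)^-1) (gauss_hermite k)).
  apply: cvgB; first exact: continuous_riesz_shift.
  by apply: cvgM; [exact: cvg_cst|exact: continuous_rhoV].
exact: continuous_gauss_hermite.
Qed.

(** Off the diagonal u is of order 1/rho, and e^(-u^2/2) <= 2 / (1 + u^2) already gives a factor
    rho. *)
Lemma ray_gauss_le x t y : 0 < t -> x != y ->
  ray_gauss x t y <= 2 * (1 + `|x|) / `|y - x| * rho t.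
Proof.
move=> t0 xy; have d0 : 0 < `|y - x| by rewrite normr_gt0 subr_eq0 eq_sym.
have := kernel_arg_bound x y t0; rewrite /ray_gauss; move: (kernel_arg x t y) => u hu.
have u0 : 0 < 1 + u ^+ 2 by rewrite ltr_wpDr // sqr_ge0.
have r0 := rho_gt0 t0.
apply: (@le_trans _ _ (2 / (1 + u ^+ 2))).
  rewrite expRN -[leRHS]invrK lef_pV2 ?posrE ?expR_gt0 ?invr_gt0 ?divr_gt0 //.
  rewrite invf_div; apply: le_trans (expR_ge1Dx _); have := sqr_ge0 u; lra.
rewrite ler_pdivrMr //.
rewrite [leRHS](_ : _ = 2 * (rho t * ((1 + `|x|) * (1 + u ^+ 2))) / `|y - x|); last by ring.
by rewrite ler_pdivlMr // ler_wpM2l.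
Qed.

(** Dividing the bound on |kernel| |y - x| by |y - x| leaves e^(-t/2) / t times the Gaussian, whose
    factor rho brings this down to t^(-1/2) e^(-t/2). *)
Lemma integrable_riesz_heat k x y : x != y ->
  mu.-integrable (@ray R) (EFin \o (fun t => riesz_heat k x t y)).
Proof.
move=> xy; have d0 : 0 < `|y - x| by rewrite normr_gt0 subr_eq0 eq_sym.
have [C C0 hC] := riesz_heat_dom k x `|y|.
pose D := C * (2 * (1 + `|x|) / `|y - x| * Num.sqrt 2) / `|y - x|.
apply: (@integrable_dominated _ _ _ mu (@ray R) _ (fun t => D * gamma_integrand 1 2^-1 t)) => //.
- by apply: measurable_ray_fun => t; exact: continuous_riesz_heat.
- move=> t /rayP t0; rewrite /gamma_integrand expr1 /D [X in expR (- X)]mulrC.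
  rewrite [leRHS](_ : _ = C * (expR (- (t / 2)) / t) *
     (2 * (1 + `|x|) / `|y - x| * (Num.sqrt 2 * Num.sqrt t)) / `|y - x|).
    rewrite ler_pdivlMr //; apply: le_trans (hC t y t0 (lexx _)) _.
    apply: ler_wpM2l; first by rewrite !mulr_ge0 ?expR_ge0 ?invr_ge0 ?(ltW t0).
    apply: le_trans (ray_gauss_le t0 xy) _; apply: ler_wpM2l; last exact: rho_le.
    by rewrite !mulr_ge0 ?invr_ge0 ?addr_ge0 ?(ltW d0).
  by ring.
- by apply: integrable_scale => //; exact: integrable_gamma_integrand.
Qed.

Lemma measurable_patch (f : R -> R) : (forall t, 0 < t -> {for t, continuous f}) ->
  measurable_fun setT (f \_ (@ray R)).
Proof.
move=> cf; apply: (proj1 (measurable_restrictT f mray)); exact: measurable_ray_fun cf.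
Qed.

Lemma kernel_fubini k x A K g : lip_at x A K g ->
  [/\ mu.-integrable setT (EFin \o (fun y => riesz_kernel k x y * g y)),
      mu.-integrable (@ray R) (EFin \o (fun t => \int[mu]_y (riesz_heat k x t y * g y))) &
      \int[mu]_(t in @ray R) (\int[mu]_y (riesz_heat k x t y * g y)) =
      \int[mu]_y (riesz_kernel k x y * g y)].
Proof.
move=> lg; have [C C0 hC] := riesz_heat_pairing k x A K.
have {}hC := hC g lg; case: lg => mg vg hg.
(* The integrand extended by 0 to t <= 0, so that Fubini is applied on the whole plane; each
   function of t is extended separately to remain measurable. *)
pose FF (z : measurableTypeR R * measurableTypeR R) : R :=
  (riesz_amp k \_ (@ray R)) z.1 * (expR ((z.2 ^+ 2 - x ^+ 2) / 2) * g z.2) *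
  gauss_hermite k ((riesz_shift x \_ (@ray R)) z.1 - z.2 * ((fun t => (rho t)^-1) \_ (@ray R)) z.1).
have FF1 t y : 0 < t -> FF (t, y) = riesz_heat k x t y * g y.
  move=> t0; have rt : t \in @ray R by rewrite inE; apply/rayP.
  by rewrite /FF /= !patchE rt riesz_heat_factor; ring.
have FF0 t y : ~ ray t -> FF (t, y) = 0.
  by move=> rt; rewrite /FF /= patchE memNset // !mul0r.
have mFF : measurable_fun setT FF.
  apply: measurable_funM.
    apply: measurable_funM.
      apply: (@measurableT_comp _ _ _ _ _ _ (riesz_amp k \_ (@ray R)) _ fst) => //.
      by apply: measurable_patch => t; exact: continuous_riesz_amp.
    apply: (@measurableT_comp _ _ _ _ _ _ (fun y : R => expR ((y ^+ 2 - x ^+ 2) / 2) * g y) _ snd) => //.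
    apply: measurable_funM => //; apply: measurableT_comp => //.
    by apply: measurable_funM => //; apply: measurable_funB => //; exact: measurable_funX.
  apply: (@measurableT_comp _ _ _ _ _ _ (gauss_hermite k)).
    by apply: continuous_measurable_fun; exact: continuous_gauss_hermite.
  apply: measurable_funB.
    apply: (@measurableT_comp _ _ _ _ _ _ (riesz_shift x \_ (@ray R)) _ fst) => //.
    by apply: measurable_patch => t; exact: continuous_riesz_shift.
  apply: measurable_funM => //.
  apply: (@measurableT_comp _ _ _ _ _ _ ((fun t => (rho t)^-1) \_ (@ray R)) _ fst) => //.
  by apply: measurable_patch => t; exact: continuous_rhoV.
have mFE : measurable_fun setT (EFin \o FF) by exact/measurable_EFinP.
have iray : mu.-integrable (@ray R) (EFin \o (fun t => C * ray_dom t)).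
  by apply: integrable_scale => //; exact: integrable_ray_dom.
have iFF : (mu \x mu)%E.-integrable setT (EFin \o FF).
  apply/integrable12ltyP => //.
  apply: (@le_lt_trans _ _ (\int[mu]_(t in @ray R) (C * ray_dom t)%:E)%E); last first.
    by have := integrable_lty mray iray.
  rewrite [leRHS]integral_mkcond; apply: ge0_le_integral => //.
  - by move=> t _; apply: integral_ge0.
  - apply: (@measurable_fun_fubini_tonelli_F _ _ _ _ _ mu (fun z => `|(FF z)%:E|%E)) => //.
    exact: measurableT_comp.
  - have [m1 _] := integrableP _ _ _ iray.
    exact: (proj1 (measurable_restrictT _ mray)) m1.
  move=> t _; rewrite patchE; case: ifPn => [|nt].
    rewrite inE => /rayP t0; have [fi le1] := hC t t0.
    rewrite [leLHS](_ : _ = (\int[mu]_y `|riesz_heat k x t y * g y|)%:E).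
      by rewrite lee_fin.
    rewrite fineK; last first.
      by apply: integrable_fin_num => //; exact: (integrable_abse fi).
    by apply: eq_integral => y _; rewrite /= FF1.
  rewrite integral0_eq // => y _; rewrite /= FF0 ?normr0 //.
  by move: nt; rewrite notin_setE.
have inE1 y : (\int[mu]_t (FF (t, y))%:E)%E = (riesz_kernel k x y * g y)%:E.
  have -> : (\int[mu]_t (FF (t, y))%:E)%E = (\int[mu]_(t in @ray R) (riesz_heat k x t y * g y)%:E)%E.
    rewrite [RHS]integral_mkcond; apply: eq_integral => t _; rewrite patchE.
    case: ifPn => [|nt]; first by rewrite inE => /rayP t0; rewrite FF1.
    by rewrite FF0 //; move: nt; rewrite notin_setE.
  (* On the diagonal the t-integral of the kernel is not controlled, but g x = 0 there. *)
  have [->|xy] := eqVneq y x.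
    have gx : g x = 0.
      by apply/eqP; rewrite -normr_le0; have := hg x; rewrite subrr normr0 mulr0.
    by rewrite gx mulr0 integral0_eq // => t _; rewrite mulr0.
  have ih := @integrable_riesz_heat k x y; rewrite eq_sym in ih; have {}ih := ih xy.
  rewrite /riesz_kernel -RintegralZr // fineK //; apply: integrable_fin_num => //.
  have := integrable_scale (g y) mray ih; apply: eq_integrable => // t _ /=.
  by rewrite mulrC.
have inE2 t : (\int[mu]_y (FF (t, y))%:E)%E =
    (((fun t => \int[mu]_y (riesz_heat k x t y * g y)) \_ (@ray R)) t)%:E.
  rewrite patchE; case: ifPn => [|nt].
    rewrite inE => /rayP t0; have [fi _] := hC t t0.
    rewrite fineK; last exact: integrable_fin_num.
    by apply: eq_integral => y _; rewrite FF1.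
  rewrite integral0_eq // => y _; rewrite /= FF0 //.
  by move: nt; rewrite notin_setE.
split.
  have iG : mu.-integrable setT (fun y => \int[mu]_t (FF (t, y))%:E)%E.
    have mG := measurable_fubini_G iFF.
    apply/integrableP; split => //.
    apply: le_lt_trans ((integrable21ltyP _ _ mFE).1 iFF).
    apply: ge0_le_integral => //.
    - exact: measurableT_comp.
    - apply: (@measurable_fun_fubini_tonelli_G _ _ _ _ _ mu (fun z => `|(FF z)%:E|%E)) => //.
      exact: measurableT_comp.
    move=> y _; exact: (@le_abse_integral _ _ _ mu setT (fun t => (FF (t, y))%:E)
      measurableT (measurable_fun_pair1 y mFE)).
  by apply: eq_integrable iG => // y _; exact: inE1.
  rewrite (integrable_mkcond _ mray).
  have := integrable_fubini_F iFF; apply: eq_integrable => // t _.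
  by rewrite [LHS]inE2 !patchE; case: ifP.
rewrite Rintegral_mkcond; congr fine.
transitivity (\int[mu]_t \int[mu]_y (FF (t, y))%:E)%E.
  by apply: eq_integral => t _; rewrite inE2.
transitivity (\int[mu]_y \int[mu]_t (FF (t, y))%:E)%E; first exact: (Fubini iFF).
by apply: eq_integral => y _; exact: inE1.
Qed.

End KernelFubini.

(** * The integral of H_(k-1)(v) e^(-v^2) / v *)

Section GaussHermitePrimitive.
Variable R : realType.
Implicit Types (t x y u v e : R) (j k n : nat).
Notation mu := (@lebesgue_measure R).
Notation gh := (@gauss_hermite R).

Lemma gauss_hermite_rec n v :
  gh n.+2 v = 2 * v * gh n.+1 v - 2 * n.+1%:R * gh n v.
Proof. by rewrite /gauss_hermite horner_hermite_rec; ring. Qed.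

Lemma gauss_hermiteN n v : gh n (- v) = (-1) ^+ n * gh n v.
Proof.
rewrite /gauss_hermite sqrrN mulrA; congr (_ * _).
suff [] : (hermite_poly R n).[- v] = (-1) ^+ n * (hermite_poly R n).[v] /\
  (hermite_poly R n.+1).[- v] = (-1) ^+ n.+1 * (hermite_poly R n.+1).[v] by [].
elim: n => [|n [IH1 IH2]].
  by rewrite !horner_hermite0 !horner_hermite1 expr0 expr1; split; ring.
split => //; rewrite !horner_hermite_rec IH1 IH2 !exprS; ring.
Qed.

Lemma gauss_hermite_odd0 j : gh (2 * j).+1 0 = 0.
Proof.
have := gauss_hermiteN (2 * j).+1 0; rewrite oppr0 exprS exprM sqrrN expr1n expr1n.
by rewrite mulr1 mulN1r => /eqP; rewrite -addr_eq0 -mulr2n mulrn_eq0 /= => /eqP.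
Qed.

Lemma gauss_hermite_le n : exists2 C, 0 <= C &
  forall u, `|gh n u| <= C / (1 + u ^+ 2).
Proof.
have [C C0 hC] := gauss_hermite_bound R n 1; exists C => // u.
have u0 : 0 < 1 + u ^+ 2 by rewrite ltr_wpDr // sqr_ge0.
rewrite ler_pdivlMr // mulrC; have := hC u; rewrite expr1 => /le_trans; apply.
by rewrite ler_piMr // -[leRHS]expR0 ler_expR oppr_le0 divr_ge0 // sqr_ge0.
Qed.

Lemma gauss_hermite_bounded n : exists2 C, 0 <= C & forall u, `|gh n u| <= C.
Proof.
have [C C0 hC] := gauss_hermite_le n; exists C => // u; apply: le_trans (hC u) _.
by rewrite ler_piMr // invf_le1 ?lerDl ?sqr_ge0 // ltr_wpDr // sqr_ge0.
Qed.

Lemma gauss_hermite_cvg0 n : gh n u @[u --> +oo] --> 0.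
Proof.
have [C C0 hC] := gauss_hermite_le n.
apply: cvg_zero; rewrite (_ : _ - _ = gh n); last by apply/funext => u /=; rewrite fctE subr0.
apply/cvgrPdist_le => e e0; near=> u.
have u1 : 1 <= u by near: u; exact: nbhs_pinfty_ge (num_real _).
have uC : C / e <= u by near: u; exact: nbhs_pinfty_ge (num_real _).
rewrite sub0r normrN; apply: le_trans (hC u) _.
rewrite ler_pdivrMr ?ltr_wpDr ?sqr_ge0 //.
rewrite ler_pdivrMr // in uC; apply: (le_trans uC); rewrite mulrC ler_pM2l //; nra.
Unshelve. all: by end_near. Qed.

Definition erf_integral v : R := \int[mu]_(s in `[0, v]) gauss_fun s.

Lemma erf_integral_cvg : erf_integral v @[v --> +oo] --> (Num.sqrt pi / 2 : R).
Proof.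
have H : Num.sqrt (erf_integral v ^+ 2) @[v --> +oo] --> Num.sqrt (pi / 4 : R).
  apply: continuous_cvg; first exact: sqrt_continuous.
  exact: gauss_integral_proof.cvg_integral0_gauss_sqr.
have -> : Num.sqrt pi / 2 = Num.sqrt (pi / 4) :> R.
  rewrite sqrtrM ?pi_ge0 // sqrtrV // (_ : 4 = 2 ^+ 2) ?sqrtr_sqr ?ger0_norm //.
  by rewrite expr2 -natrM.
rewrite (_ : erf_integral = fun v => Num.sqrt (erf_integral v ^+ 2)) //.
apply/funext => v; rewrite sqrtr_sqr ger0_norm //.
by apply: Rintegral_ge0 => s _; exact: gauss_fun_ge0.
Qed.

Lemma integrable_gauss_seg v : mu.-integrable `[0, v] (EFin \o (@gauss_fun R)).
Proof. by apply: integrable_seg; exact: continuous_gauss_fun. Qed.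

Lemma is_derive_erf_integral v : 0 < v ->
  is_derive v 1 erf_integral (expR (- v ^+ 2)).
Proof.
move=> v0; have v1 : v < v + 1 by rewrite ltrDl.
have [D E] := continuous_FTC1_closed v1 (integrable_gauss_seg (v + 1)) v0 (@continuous_gauss_fun R v).
by have := derivable_is_derive1 D; rewrite E.
Qed.

Lemma erf_integral_le v : 0 < v -> 0 <= erf_integral v <= v.
Proof.
move=> v0; apply/andP; split.
  by apply: Rintegral_ge0 => s _; exact: gauss_fun_ge0.
rewrite [leRHS](_ : _ = \int[mu]_(s in `[0, v]) 1); last first.
  rewrite /Rintegral integral_cst //= mul1e lebesgue_measure_itv /= lte_fin v0.
  by rewrite -EFinD /= subr0.
apply: le_Rintegral => //.
- exact: integrable_gauss_seg.
- by apply: integrable_seg => s; exact: cvg_cst.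
- by move=> s _; exact: gauss_fun_le1.
Qed.

(* The primitive of gh (2 j + 1) v / v on the positive axis; it comes from the
   three-term recurrence and reduces the constant to the Gauss integral. *)
Fixpoint odd_primitive j v : R :=
  if j is i.+1 then - 2 * gh (2 * i).+1 v - 4 * i.+1%:R * odd_primitive i v
  else 2 * erf_integral v.

(** Dividing the recurrence by v gives gh_(2i+3) / v = 2 gh_(2i+2) - 4 (i+1) gh_(2i+1) / v, and
    gh_(2i+2) is minus the derivative of gh_(2i+1). *)
Lemma is_derive_odd_primitive j v : 0 < v ->
  is_derive v 1 (odd_primitive j) (gh (2 * j).+1 v / v).
Proof.
move=> v0; have vn : v != 0 by rewrite gt_eqF.
elim: j => [|i IH] /=.
  have D := is_derive_erf_integral v0; apply: is_derive_eq; rewrite /GRing.scale /=.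
  by rewrite /gauss_hermite horner_hermite1; field.
have D := is_derive_gauss_hermite (2 * i).+1 v.
apply: is_derive_eq; rewrite /GRing.scale /=.
rewrite mulnS !addSn add0n [gh (2 * i).+3 v]gauss_hermite_rec.
have -> : (2 * i).+2%:R = 2 * i.+1%:R :> R by rewrite -natrM mulnS.
by field.
Qed.

(** The base case is the full Gauss integral sqrt pi; each step multiplies by -4 (i+1), as the
    boundary term decays. *)
Lemma odd_primitive_cvg_pinfty j : odd_primitive j v @[v --> +oo] -->
  ((-4) ^+ j * j`!%:R * Num.sqrt pi : R).
Proof.
elim: j => [|i IH] /=.
  rewrite expr0 fact0 !mul1r (_ : Num.sqrt pi = 2 * (Num.sqrt pi / 2)); last by field.
  by apply: cvgM; [exact: cvg_cst|exact: erf_integral_cvg].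
rewrite (_ : _ * _ * _ = - 2 * 0 - 4 * i.+1%:R * ((-4) ^+ i * i`!%:R * Num.sqrt pi)); last first.
  by rewrite factS natrM exprS; ring.
apply: cvgB; first by apply: cvgM; [exact: cvg_cst|exact: gauss_hermite_cvg0].
by apply: cvgM; [exact: cvg_cst|exact: IH].
Qed.

Lemma odd_primitive_cvg0 j : odd_primitive j v @[v --> 0^'+] --> (0 : R).
Proof.
elim: j => [|i IH] /=.
  rewrite -[X in _ --> X](mulr0 2); apply: cvgM; first exact: cvg_cst.
  apply: (@squeeze_cvgr _ _ _ _ (cst 0) id).
  - by near=> v; apply: erf_integral_le; near: v; exact: nbhs_right_gt.
  - exact: cvg_cst.
  - exact: cvg_at_right_filter.
have E : 0 = - 2 * gh (2 * i).+1 0 - 4 * i.+1%:R * 0 :> R.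
  by rewrite gauss_hermite_odd0; ring.
rewrite [X in _ --> X]E.
apply: cvgB; last by apply: cvgM; [exact: cvg_cst|exact: IH].
apply: cvgM; first exact: cvg_cst.
by apply: cvg_at_right_filter; exact: continuous_gauss_hermite.
Unshelve. all: by end_near. Qed.

Lemma is_derive_rho t : 0 < t -> is_derive t 1 (@rho R) (expR (- t) ^+ 2 / rho t).
Proof.
move=> t0; have r0 := rho_gt0 t0.
have d1 := is_derive1_sqrt (rho2_gt0 t0).
have d3 : is_derive t 1 (fun s : R => expR (- s)) (expR (- t) * -1).
  by apply: (@is_derive_expR_comp R (fun s => - s)); apply: is_derive_eq.
have d2 : is_derive t 1 (fun s : R => 1 - expR (- s) ^+ 2) (2 * expR (- t) ^+ 2).
  by apply: is_derive_eq; rewrite /GRing.scale /=; ring.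
apply: (@is_derive_comp_eq R (@Num.sqrt R) (fun s : R => 1 - expR (- s) ^+ 2) t _ _ _ d1 d2).
by rewrite -/(rho t); field; rewrite gt_eqF.
Qed.

Lemma rho_cvg_pinfty : rho t @[t --> +oo] --> (1 : R).
Proof.
rewrite -[X in _ --> X]sqrtr1; apply: continuous_cvg; first exact: sqrt_continuous.
rewrite -[X in _ --> X]subr0; apply: cvgB; first exact: cvg_cst.
rewrite -[X in _ --> X](mulr0 0); apply: cvgM; exact: cvgr_expR.
Qed.

Lemma rhoV_cvg_pinfty e : 0 < e -> e / rho t @[t --> 0^'+] --> +oo.
Proof.
move=> e0; apply/cvgryPge => A; near=> t.
have t0 : 0 < t by near: t; exact: nbhs_right_gt.
have A0 : 0 < `|A| + 1 by rewrite ltr_wpDl.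
have : rho t <= e / (`|A| + 1).
  apply: le_trans (rho_le t0) _; rewrite -sqrtrM //.
  rewrite -[leRHS]ger0_norm ?divr_ge0 ?(ltW e0) ?(ltW A0) // -sqrtr_sqr; apply: ler_wsqrtr.
  rewrite mulrC -ler_pdivlMr //; near: t; apply: nbhs_right_le.
  by rewrite divr_gt0 // exprn_gt0 // divr_gt0.
rewrite ler_pdivlMr // mulrC -ler_pdivlMr ?rho_gt0 //; apply: le_trans.
by rewrite (le_trans (ler_norm A)) // lerDl.
Unshelve. all: by end_near. Qed.

End GaussHermitePrimitive.

(** * Mass of the weighted kernel near the diagonal *)

Section LocalMass.
Variable R : realType.
Implicit Types (t x y u v e : R) (j k n : nat).
Notation mu := (@lebesgue_measure R).
Notation gh := (@gauss_hermite R).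

Let mray : measurable (@ray R : set (measurableTypeR R)) := measurable_itv _.

Definition drift t : R := (1 - expR (- t)) / rho t.

(** From (1 - r)^2 <= t (1 - r) <= t (1 - r^2), as 1 - r <= t. *)
Lemma drift_bounds t : 0 < t -> 0 <= drift t <= Num.sqrt t.
Proof.
move=> t0; have r0 := rho_gt0 t0; have e1 := expRN_lt1 t0; have e0 := expR_gt0 (- t).
have et : 1 - expR (- t) <= t by have := expR_ge1Dx (- t); lra.
apply/andP; split; first by rewrite divr_ge0 ?subr_ge0 ?(ltW e1) ?(ltW r0).
rewrite ler_pdivrMr // -sqrtrM ?(ltW t0) // -[leLHS]ger0_norm ?subr_ge0 ?(ltW e1) //.
rewrite -sqrtr_sqr; apply: ler_wsqrtr.
move: (expR (- t)) e0 e1 et => s s0 s1 st.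
have h1 : (1 - s) * (1 - s) <= t * (1 - s) by rewrite ler_wpM2r // subr_ge0 ltW.
have h2 : 0 <= t * s * (1 - s) by rewrite !mulr_ge0 ?subr_ge0 ?(ltW t0) ?(ltW s0) ?(ltW s1).
by rewrite expr2; apply: le_trans h1 _; nra.
Qed.

Lemma continuous_drift t : 0 < t -> {for t, continuous drift}.
Proof.
move=> t0; apply: cvgM; last exact: continuous_rhoV.
apply: cvgB; first exact: cvg_cst.
apply: (@continuous_comp _ _ _ (fun t : R => - t) expR); first exact: cvgN.
exact: continuous_expR.
Qed.

Lemma continuous_gh_comp k (f : R -> R) t : {for t, continuous f} ->
  {for t, continuous (fun t => gh k (f t))}.
Proof.
move=> cf; apply: (@continuous_comp _ _ _ f (gh k)) => //.
exact: continuous_gauss_hermite.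
Qed.

(** The effect of the drift q x, that is, the local mass minus its value without drift. The index k
    belongs to the transform of order k+1, whose kernel has gh_k as primitive. *)
Definition shifted_mass k x e t : R := ray_mult k.+1 t *
  ((gh k (- (drift t * x) - e / rho t) - gh k (- (e / rho t))) -
   (gh k (- (drift t * x) + e / rho t) - gh k (e / rho t))).

Definition centred_mass k e t : R :=
  ray_mult k.+1 t * (gh k (- (e / rho t)) - gh k (e / rho t)).

Lemma continuous_scaled e t : 0 < t -> {for t, continuous (fun t => e / rho t)}.
Proof. by move=> t0; apply: cvgM; [exact: cvg_cst|exact: continuous_rhoV]. Qed.

Lemma continuous_shifted_mass k x e t : 0 < t -> {for t, continuous (shifted_mass k x e)}.
Proof.
move=> t0; have ce := @continuous_scaled e t t0; have cd := continuous_drift t0.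
have cdx : {for t, continuous (fun t => - (drift t * x))}.
  by apply: cvgN; apply: cvgM; [exact: cd|exact: cvg_cst].
apply: cvgM; first exact: continuous_ray_mult.
have cg (h : R -> R) : {for t, continuous h} -> gh k (h s) @[s --> t] --> gh k (h t).
  exact: continuous_gh_comp.
apply: cvgB; apply: cvgB.
- by apply: (cg (fun t => - (drift t * x) - e / rho t)); exact: cvgB.
- by apply: (cg (fun t => - (e / rho t))); exact: cvgN.
- by apply: (cg (fun t => - (drift t * x) + e / rho t)); exact: cvgD.
- exact: (cg (fun t => e / rho t)).
Qed.

(** gh_k is Lipschitz and both of its arguments move by q x = O(sqrt t), which reduces 1/t to
    t^(-1/2), uniformly in e. *)
Lemma shifted_mass_dom k x : exists2 C, 0 <= C & forall e t, 0 < t ->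
  `|shifted_mass k x e t| <= C * gamma_integrand 1 2^-1 t.
Proof.
have [M M0 hM] := @gauss_hermite_bounded R k.+1.
have lip u v : `|gh k u - gh k v| <= M * `|u - v|.
  apply: (mvt_lipschitz (is_derive_gauss_hermite k)) => z.
  by rewrite normrN.
exists (2 * M * `|x|); first by rewrite !mulr_ge0.
move=> e t t0; have /andP[d0 d1] := drift_bounds t0.
have m0 := ray_mult_ge0 k.+1 t0; have m1 := ray_mult_le k.+1 t0.
rewrite /shifted_mass; move: (ray_mult k.+1 t) m0 m1 => m m0 m1.
have dx : M * `|drift t * x| <= M * (Num.sqrt t * `|x|).
  by rewrite ler_wpM2l // normrM ger0_norm // ler_wpM2r.
set a := e / rho t.
have l1 := lip (- (drift t * x) - a) (- a).
have l2 := lip (- (drift t * x) + a) a.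
have E1 : - (drift t * x) - a - - a = - (drift t * x) by ring.
have E2 : - (drift t * x) + a - a = - (drift t * x) by ring.
rewrite E1 normrN in l1; rewrite E2 normrN in l2.
rewrite normrM (ger0_norm m0) /gamma_integrand expr1 [2^-1 * t]mulrC.
have -> : 2 * M * `|x| * (Num.sqrt t / t * expR (- (t / 2))) =
   (expR (- (t / 2)) / t) * (M * (Num.sqrt t * `|x|) + M * (Num.sqrt t * `|x|)) by ring.
apply: ler_pM => //; apply: le_trans (ler_normB _ _) _.
by apply: lerD; [exact: le_trans l1 dx|exact: le_trans l2 dx].
Qed.

Lemma integrable_shifted_mass k x e :
  mu.-integrable (@ray R) (EFin \o shifted_mass k x e).
Proof.
have [C C0 hC] := shifted_mass_dom k x.
apply: (@integrable_dominated _ _ _ mu (@ray R) _ (fun t => C * gamma_integrand 1 2^-1 t)) => //.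
- by apply: measurable_ray_fun => t; exact: continuous_shifted_mass.
- by move=> t /rayP t0; exact: hC.
- by apply: integrable_scale => //; exact: integrable_gamma_integrand.
Qed.

Section ShrinkingRadius.
Variable e_ : nat -> R.
Hypothesis e_cvg : e_ n @[n --> \oo] --> (0 : R).

Lemma scaled_radius_cvg t : e_ n / rho t @[n --> \oo] --> (0 : R).
Proof. by rewrite -[X in _ --> X](mul0r (rho t)^-1); apply: cvgM => //; exact: cvg_cst. Qed.

Lemma gh_radius_cvg k (a : R) t :
  gh k (a + e_ n / rho t) @[n --> \oo] --> gh k a.
Proof.
have H : a + e_ n / rho t @[n --> \oo] --> a.
  by rewrite -[X in _ --> X]addr0; apply: cvgD; [exact: cvg_cst|exact: scaled_radius_cvg].
by apply: (cvg_comp _ _ H); exact: continuous_gauss_hermite.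
Qed.

Lemma gh_radius_cvgN k (a : R) t :
  gh k (a - e_ n / rho t) @[n --> \oo] --> gh k a.
Proof.
have H : a - e_ n / rho t @[n --> \oo] --> a.
  by rewrite -[X in _ --> X]subr0; apply: cvgB; [exact: cvg_cst|exact: scaled_radius_cvg].
by apply: (cvg_comp _ _ H); exact: continuous_gauss_hermite.
Qed.

Lemma shifted_mass_cvg0 k x :
  (\int[mu]_(t in @ray R) shifted_mass k x (e_ n) t) @[n --> \oo] --> (0 : R).
Proof.
have [C C0 hC] := shifted_mass_dom k x.
rewrite [X in _ --> X](_ : _ = \int[mu]_(t in @ray R) 0); last by rewrite Rintegral_cst // mul0r.
apply: (@Rintegral_dominated_cvg _ _ _ mu (@ray R) _ _ (fun t => C * gamma_integrand 1 2^-1 t)) => //.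
- by move=> n; apply: measurable_ray_fun => t; exact: continuous_shifted_mass.
- move=> t /rayP t0.
  have E : 0 = ray_mult k.+1 t * ((gh k (- (drift t * x)) - gh k 0) - (gh k (- (drift t * x)) - gh k 0)).
    by rewrite subrr mulr0.
  rewrite [X in _ --> X]E; apply: cvgM; first exact: cvg_cst.
  apply: cvgB; apply: cvgB.
  + exact: gh_radius_cvgN.
  + by have := @gh_radius_cvgN k 0 t; under eq_fun do rewrite sub0r.
  + exact: gh_radius_cvg.
  + by have := @gh_radius_cvg k 0 t; under eq_fun do rewrite add0r.
- by apply: integrable_scale => //; exact: integrable_gamma_integrand.
- by move=> n t /rayP t0; exact: hC.
Qed.

End ShrinkingRadius.

(* Asymptotically equal to ray_mult k at 0, but with an exact primitive along
   the curve t |-> e / rho t. *)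
Definition exact_mult k t : R := (Num.sqrt 2)^-1 ^+ k * (2 * expR (- t) ^+ 2 / rho t ^+ 2).

(** With s = e^(-t/2) this is 2 t s^4 <= s (1 - s^4), which follows from t s^2 <= 1 - s^2 and 2 s <=
    1 + s^2. *)
Lemma exact_mult_le k t : 0 < t -> exact_mult k t <= (Num.sqrt 2)^-1 ^+ k * (expR (- (t / 2)) / t).
Proof.
move=> t0; rewrite /exact_mult ler_wpM2l ?exprn_ge0 ?invr_ge0 ?sqrtr_ge0 //.
have r2 : 0 < rho t ^+ 2 by rewrite exprn_gt0 // rho_gt0.
rewrite ler_pdivrMr // mulrAC ler_pdivlMr // sqr_rho //.
have -> : expR (- t) = expR (- (t / 2)) ^+ 2.
  by rewrite -expRM_natl; congr expR; field.
have s0 := expR_gt0 (- (t / 2)).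
have h : t * expR (- (t / 2)) ^+ 2 <= 1 - expR (- (t / 2)) ^+ 2.
  have -> : expR (- (t / 2)) ^+ 2 = (expR t)^-1.
    by rewrite -expRM_natl -expRN; congr expR; field.
  rewrite lerBrDr -{2}[(expR t)^-1]mul1r -mulrDl ler_pdivrMr ?expR_gt0 // mul1r addrC.
  exact: expR_ge1Dx.
move: (expR (- (t / 2))) s0 h => s s0 h.
have h2 : 2 * s <= 1 + s ^+ 2 by have := sqr_ge0 (1 - s); nra.
have h3 : t * s ^+ 2 * (2 * s) <= (1 - s ^+ 2) * (1 + s ^+ 2).
  by apply: ler_pM => //; rewrite ?mulr_ge0 ?exprn_ge0 ?(ltW t0) ?(ltW s0).
have -> : 2 * s ^+ 2 ^+ 2 * t = s * (t * s ^+ 2 * (2 * s)) by ring.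
have -> : s * (1 - s ^+ 2 ^+ 2) = s * ((1 - s ^+ 2) * (1 + s ^+ 2)) by ring.
by rewrite ler_pM2l.
Qed.

Lemma exact_mult_ge k t : (1 < k)%N -> 0 < t ->
  (Num.sqrt 2)^-1 ^+ k * (expR (- (t / 2)) / t) * expR (- t) ^+ k <= exact_mult k t.
Proof.
move=> k1 t0; rewrite /exact_mult -mulrA ler_wpM2l ?exprn_ge0 ?invr_ge0 ?sqrtr_ge0 //.
have r2 : 0 < rho t ^+ 2 by rewrite exprn_gt0 // rho_gt0.
have e0 := expR_gt0 (- t); have e1 := expRN_lt1 t0.
have /andP[_ b2] := rho2_bounds t0.
apply: (@le_trans _ _ (expR (- t) ^+ 2 / t)).
  rewrite mulrAC ler_wpM2r ?invr_ge0 ?(ltW t0) // -[leRHS]mul1r; apply: ler_pM.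
  - exact: expR_ge0.
  - by rewrite exprn_ge0 ?(ltW e0).
  - by rewrite -[leRHS]expR0 ler_expR oppr_le0 divr_ge0 // ltW.
  - by rewrite ler_wiXn2l ?(ltW e0) ?(ltW e1).
rewrite ler_pdivlMr // mulrAC ler_pdivrMr // sqr_rho //.
rewrite [leRHS](_ : _ = expR (- t) ^+ 2 * (2 * t)); last by ring.
by rewrite ler_wpM2l // exprn_ge0 // ltW.
Qed.

(** Both multipliers lie between c T r^k and c T, where T = e^(-t/2) / t, so they differ by at most
    T (1 - r^k) <= k e^(-t/2): the singularity 1/t cancels. *)
Lemma ray_mult_exact k t : (1 < k)%N -> 0 < t ->
  `|ray_mult k t - exact_mult k t| <= k%:R * gamma_integrand 2 2^-1 t.
Proof.
move=> k1 t0; pose c : R := (Num.sqrt 2)^-1 ^+ k; pose T : R := expR (- (t / 2)) / t.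
have c0 : 0 <= c by rewrite exprn_ge0 // invr_ge0 sqrtr_ge0.
have c1 : c <= 1 by rewrite exprn_ile1 ?invr_ge0 ?sqrtr_ge0 // invf_le1 ?sqrt2_gt0 // sqrt2_ge1.
have T0 : 0 <= T by rewrite divr_ge0 ?expR_ge0 ?(ltW t0).
have /andP[w1 w2] := ray_ratio_bounds t0.
have u1 : ray_mult k t <= c * T.
  rewrite /ray_mult -mulrA -/T; apply: ler_wpM2r => //.
  by rewrite lerXn2r ?nnegrE ?ray_ratio_ge0 ?invr_ge0 ?sqrtr_ge0.
have l1 : c * T * expR (- t) ^+ k <= ray_mult k t.
  rewrite /ray_mult -[leRHS]mulrA -/T mulrAC; apply: ler_wpM2r => //.
  rewrite /c -exprMn lerXn2r ?nnegrE ?ray_ratio_ge0 ?mulr_ge0 ?invr_ge0 ?sqrtr_ge0 ?expR_ge0 //.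
  by rewrite mulrC.
have u2 := exact_mult_le k t0; have l2 := exact_mult_ge k1 t0.
rewrite -/c -/T in u2 l2.
have ek : 1 - expR (- t) ^+ k <= k%:R * t.
  rewrite -expRM_natl; have := expR_ge1Dx (k%:R * - t); lra.
have e0 : 0 <= expR (- t) ^+ k by rewrite exprn_ge0 // expR_ge0.
apply: (@le_trans _ _ (c * T * (1 - expR (- t) ^+ k))).
  rewrite mulrBr mulr1 ler_norml; move: l1 l2 u1 u2.
  move: (expR (- t) ^+ k) (ray_mult k t) (exact_mult k t) (c * T) => r m m' B.
  by move: (B * r) => A; lra.
apply: (@le_trans _ _ (1 * T * (k%:R * t))).
  have r1 : 0 <= 1 - expR (- t) ^+ k.
    by rewrite subr_ge0 exprn_ile1 ?expR_ge0 //; exact: ltW (expRN_lt1 t0).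
  by apply: ler_pM; [exact: mulr_ge0|exact: r1|exact: ler_wpM2r|].
rewrite /T /gamma_integrand sqr_sqrtr ?(ltW t0) // [2^-1 * t]mulrC divff ?gt_eqF //.
by rewrite le_eqVlt; apply/orP; left; apply/eqP; field; rewrite gt_eqF.
Qed.

Lemma continuous_exact_mult k t : 0 < t -> {for t, continuous (exact_mult k)}.
Proof.
move=> t0; apply: cvgM; first exact: cvg_cst.
apply: cvgM.
  apply: cvgM; first exact: cvg_cst.
  apply: (@continuous_comp _ _ _ (fun t : R => expR (- t)) (fun z => z ^+ 2)).
    apply: (@continuous_comp _ _ _ (fun t : R => - t) expR); first exact: cvgN.
    exact: continuous_expR.
  exact: exprn_continuous.
apply: cvgV; first by rewrite expf_neq0 // gt_eqF // rho_gt0.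
apply: (@continuous_comp _ _ _ (@rho R) (fun z => z ^+ 2)); first exact: continuous_rho.
exact: exprn_continuous.
Qed.

(** For fixed e the decay gh_j(e/rho) = O(rho^2 / e^2) compensates 1/t. The majorant blows up as e
    tends to 0, so this part is evaluated exactly before the limit. *)
Lemma integrable_exact_mass j k e : 0 < e ->
  mu.-integrable (@ray R) (EFin \o (fun t => exact_mult k t * gh j (e / rho t))).
Proof.
move=> e0; have [C C0 hC] := @gauss_hermite_le R j.
have c1 : (Num.sqrt 2)^-1 ^+ k <= 1 :> R.
  by rewrite exprn_ile1 ?invr_ge0 ?sqrtr_ge0 // invf_le1 ?sqrt2_gt0 // sqrt2_ge1.
apply: (@integrable_dominated _ _ _ mu (@ray R) _ (fun t => (2 * C / e ^+ 2) * gamma_integrand 2 2^-1 t)) => //.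
- apply: measurable_ray_fun => t t0; apply: cvgM; first exact: continuous_exact_mult.
  by apply: (@continuous_gh_comp _ (fun t => e / rho t) t); exact: continuous_scaled.
- move=> t /rayP t0.
  have m0 : 0 <= exact_mult k t.
    rewrite !mulr_ge0 ?exprn_ge0 ?invr_ge0 ?sqrtr_ge0 ?expR_ge0 //.
    by rewrite exprn_ge0 // sqrtr_ge0.
  rewrite normrM (ger0_norm m0).
  apply: (@le_trans _ _ ((expR (- (t / 2)) / t) * (C * (2 * t / e ^+ 2)))).
    apply: ler_pM => //.
      apply: le_trans (exact_mult_le k t0) _; apply: ler_piMl => //.
      by rewrite divr_ge0 ?expR_ge0 ?(ltW t0).
    apply: le_trans (hC _) _; apply: ler_wpM2l => //.
    have /andP[_ b2] := rho2_bounds t0; rewrite -sqr_rho // in b2.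
    have r2 : 0 < rho t ^+ 2 by rewrite exprn_gt0 // rho_gt0.
    have e2 : 0 < e ^+ 2 by rewrite exprn_gt0.
    rewrite -[leRHS]invrK lef_pV2 ?posrE ?invr_gt0 ?divr_gt0 ?mulr_gt0 //; last first.
      by rewrite ltr_wpDr ?sqr_ge0.
    rewrite invf_div expr_div_n ler_wpDl //.
    by apply: ler_wpM2l; [exact: ltW|rewrite lef_pV2 ?posrE // mulr_gt0].
  rewrite /gamma_integrand sqr_sqrtr ?(ltW t0) // [2^-1 * t]mulrC divff ?gt_eqF //.
  by rewrite le_eqVlt; apply/orP; left; apply/eqP; field; rewrite !gt_eqF.
- by apply: integrable_scale => //; apply: integrable_gamma_integrand.
Qed.

Lemma exact_mass j k e : 0 < e ->
  \int[mu]_(t in @ray R) (exact_mult k t * gh (2 * j).+1 (e / rho t)) =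
  2 * (Num.sqrt 2)^-1 ^+ k * ((-4) ^+ j * j`!%:R * Num.sqrt pi - odd_primitive j e).
Proof.
move=> e0; pose c : R := (Num.sqrt 2)^-1 ^+ k; rewrite -/c.
(* For v = e / rho one has dv / v = - (r^2 / rho^2) dt, which is the exact multiplier up to the
   factor -2c. As t runs from 0 to infinity, v decreases from infinity to e. *)
pose F t : R := - (2 * c) * odd_primitive j (e / rho t).
transitivity (- (2 * c) * odd_primitive j e -
   (- (2 * c) * ((-4) ^+ j * j`!%:R * Num.sqrt pi))); last by ring.
apply: (@improper_FTC R (fun t => exact_mult k t * gh (2 * j).+1 (e / rho t)) F
  (- (2 * c) * odd_primitive j e) (- (2 * c) * ((-4) ^+ j * j`!%:R * Num.sqrt pi))).
- move=> t t0; have r0 := rho_gt0 t0; have v0 : 0 < e / rho t by rewrite divr_gt0.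
  have d1 : is_derive t 1 (fun t => e / rho t) (- (e * expR (- t) ^+ 2) / rho t ^+ 3).
    have D := is_derive_rho t0; have rn : rho t != 0 by rewrite gt_eqF.
    apply: is_derive_eq; rewrite /GRing.scale /=; field.
    by [].
  have d2 := @is_derive_comp_eq R (odd_primitive j) (fun t => e / rho t) t _ _ _
    (is_derive_odd_primitive j v0) d1 erefl.
  rewrite /F; apply: is_derive_eq; rewrite /GRing.scale /= /exact_mult -/c.
  move: (gh _ _) => G; field; by rewrite !gt_eqF.
- move=> t t0; apply: cvgM; first exact: continuous_exact_mult.
  by apply: (@continuous_gh_comp _ (fun t => e / rho t) t); exact: continuous_scaled.
- exact: integrable_exact_mass.
- apply: cvgM; first exact: cvg_cst.
  have ce : {for e, continuous (odd_primitive j)}.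
    exact: is_derive_continuous (is_derive_odd_primitive j e0).
  have H : e / rho t @[t --> +oo] --> e.
    rewrite -[X in _ --> X]divr1; apply: cvgM; first exact: cvg_cst.
    by apply: cvgV; [exact: oner_neq0|exact: rho_cvg_pinfty].
  by apply: (cvg_comp _ _ H); exact: ce.
- apply: cvgM; first exact: cvg_cst.
  apply: (@cvg_comp _ _ _ (fun t => e / rho t) (odd_primitive j) _ +oo).
    exact: rhoV_cvg_pinfty.
  exact: odd_primitive_cvg_pinfty.
Qed.

End LocalMass.

(** * The limit of the local mass *)

Section LocalMassLimit.
Variable R : realType.
Implicit Types (t x y u v e : R) (j k n : nat).
Notation mu := (@lebesgue_measure R).
Notation gh := (@gauss_hermite R).

Let mray : measurable (@ray R : set (measurableTypeR R)) := measurable_itv _.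

(** Boundary values of the primitive at y = x + e and y = x - e, where u = - q x - e / rho and u = -
    q x + e / rho. *)
Definition local_mass k x e t : R := ray_mult k.+1 t *
  (gh k (- (drift t * x) - e / rho t) - gh k (- (drift t * x) + e / rho t)).

Lemma local_massE k x e t : local_mass k x e t = shifted_mass k x e t + centred_mass k e t.
Proof. by rewrite /local_mass /shifted_mass /centred_mass; ring. Qed.

Lemma centred_mass_even k e t : ~~ odd k -> centred_mass k e t = 0.
Proof.
move=> ko; rewrite /centred_mass gauss_hermiteN -signr_odd (negbTE ko) mul1r.
by rewrite subrr mulr0.
Qed.

(** Error of passing to the exact multiplier at order 2j+2. It is bounded independently of e and
    tends to 0 pointwise with e, since gh_(2j+1) vanishes at 0. *)
Definition mass_defect j e t : R :=
  (ray_mult (2 * j).+2 t - exact_mult (2 * j).+2 t) * gh (2 * j).+1 (e / rho t).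

Lemma centred_mass_odd j e t : centred_mass (2 * j).+1 e t =
  -2 * mass_defect j e t + -2 * (exact_mult (2 * j).+2 t * gh (2 * j).+1 (e / rho t)).
Proof.
rewrite /centred_mass /mass_defect gauss_hermiteN -signr_odd /= mul2n odd_double /=.
by move: (gh _ _) (ray_mult _ _) (exact_mult _ _) => G m m'; ring.
Qed.

Lemma mass_defect_dom j : exists2 C, 0 <= C & forall e t, 0 < t ->
  `|mass_defect j e t| <= C * gamma_integrand 2 2^-1 t.
Proof.
have [C C0 hC] := @gauss_hermite_bounded R (2 * j).+1.
exists ((2 * j).+2%:R * C) => [|e t t0]; first by rewrite mulr_ge0.
rewrite /mass_defect normrM mulrAC; apply: ler_pM => //.
exact: ray_mult_exact.
Qed.

Lemma continuous_mass_defect j e t : 0 < t -> {for t, continuous (mass_defect j e)}.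
Proof.
move=> t0; apply: cvgM.
  by apply: cvgB; [exact: continuous_ray_mult|exact: continuous_exact_mult].
by apply: (@continuous_gh_comp R _ (fun t => e / rho t) t); exact: continuous_scaled.
Qed.

Lemma integrable_mass_defect j e :
  mu.-integrable (@ray R) (EFin \o mass_defect j e).
Proof.
have [C C0 hC] := mass_defect_dom j.
apply: (@integrable_dominated _ _ _ mu (@ray R) _ (fun t => C * gamma_integrand 2 2^-1 t)) => //.
- by apply: measurable_ray_fun => t; exact: continuous_mass_defect.
- by move=> t /rayP t0; exact: hC.
- by apply: integrable_scale => //; exact: integrable_gamma_integrand.
Qed.

Lemma integrable_centred_mass k e : 0 < e ->
  mu.-integrable (@ray R) (EFin \o centred_mass k e).
Proof.
move=> e0; have [ko|ko] := boolP (odd k); last first.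
  have : mu.-integrable (@ray R) (EFin \o (fun=> 0 : R)) by exact: integrable0.
  by apply: eq_integrable => // t _ /=; rewrite centred_mass_even.
have -> : k = (2 * k./2).+1 by rewrite mul2n -[LHS]odd_double_half ko.
move: k./2 => j.
have i1 := integrable_scale (-2) mray (integrable_mass_defect j e).
have i2 := integrable_scale (-2) mray (integrable_exact_mass (2 * j).+1 (2 * j).+2 e0).
have := integrableD mray i1 i2; apply: eq_integrable => // t _ /=.
by rewrite -EFinD -centred_mass_odd.
Qed.

Lemma integrable_local_mass k x e : 0 < e ->
  mu.-integrable (@ray R) (EFin \o local_mass k x e).
Proof.
move=> e0; have := integrableD mray (integrable_shifted_mass k x e) (integrable_centred_mass k e0).
by apply: eq_integrable => // t _ /=; rewrite -EFinD -local_massE.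
Qed.

Section ShrinkingRadius.
Variable e_ : nat -> R.
Hypothesis e_gt0 : forall n, 0 < e_ n.
Hypothesis e_cvg : e_ n @[n --> \oo] --> (0 : R).

Lemma mass_defect_cvg0 j :
  (\int[mu]_(t in @ray R) mass_defect j (e_ n) t) @[n --> \oo] --> (0 : R).
Proof.
have [C C0 hC] := mass_defect_dom j.
rewrite [X in _ --> X](_ : _ = \int[mu]_(t in @ray R) 0); last by rewrite Rintegral_cst // mul0r.
apply: (@Rintegral_dominated_cvg _ _ _ mu (@ray R) _ _ (fun t => C * gamma_integrand 2 2^-1 t)) => //.
- by move=> n; apply: measurable_ray_fun => t; exact: continuous_mass_defect.
- move=> t /rayP t0.
  have E : 0 = (ray_mult (2 * j).+2 t - exact_mult (2 * j).+2 t) * gh (2 * j).+1 0.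
    by rewrite gauss_hermite_odd0 mulr0.
  rewrite [X in _ --> X]E; apply: cvgM; first exact: cvg_cst.
  have := @gh_radius_cvg R _ e_cvg (2 * j).+1 0 t.
  by under eq_fun do rewrite add0r.
- by apply: integrable_scale => //; exact: integrable_gamma_integrand.
- by move=> n t /rayP t0; exact: hC.
Qed.

Lemma centred_mass_cvg k : (-1) ^+ k.+1 / Num.sqrt pi *
  (\int[mu]_(t in @ray R) centred_mass k (e_ n) t) @[n --> \oo] -->
  Gamma_fun (k.+1%:R / 2 : R) * hermite_riesz_const R k.+1.
Proof.
rewrite /hermite_riesz_const /=; have [ko|ko] := boolP (odd k); last first.
  rewrite mulr0 (_ : (fun n => _) = cst 0); first exact: cvg_cst.
  apply/funext => n; transitivity ((-1) ^+ k.+1 / Num.sqrt pi * (\int[mu]_(t in @ray R) (0 : R))).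
    by congr (_ * _); apply: eq_Rintegral => t _; rewrite centred_mass_even.
  by rewrite Rintegral_cst // mul0r mulr0.
have -> : k = (2 * k./2).+1 by rewrite mul2n -[LHS]odd_double_half ko.
move: k./2 => j; rewrite (_ : (2 * j).+2 = (2 * j.+1)%N); last by rewrite mulnS.
rewrite Gamma_fact (_ : uphalf _ = j.+1); last by rewrite mul2n /= doubleK.
pose c : R := (Num.sqrt 2)^-1 ^+ (2 * j).+2.
have cE : c = 2^-1 ^+ j.+1.
  have e2 : (2 * j).+2 = (2 * j.+1)%N by rewrite mulnS.
  by rewrite /c e2 exprM exprVn sqr_sqrt2.
have p0 : Num.sqrt pi != 0 :> R by rewrite gt_eqF // sqrtr_gt0 pi_gt0.
pose a n : R := (Num.sqrt pi)^-1 * (-2 * (\int[mu]_(t in @ray R) mass_defect j (e_ n) t) +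
   -2 * (2 * c * ((-4) ^+ j * j`!%:R * Num.sqrt pi - odd_primitive j (e_ n)))).
rewrite (_ : (fun n => _) = a); last first.
  apply/funext => n; rewrite /a exprM sqrrN expr1n expr1n mul1r; congr (_ * _).
  have i1 := integrable_scale (-2) mray (integrable_mass_defect j (e_ n)).
  have i2 := integrable_exact_mass (2 * j).+1 (2 * j).+2 (e_gt0 n).
  rewrite -(exact_mass _ _ (e_gt0 n)) -!RintegralZl //; last exact: integrable_mass_defect.
  rewrite -RintegralD //; last exact: integrable_scale.
  by apply: eq_Rintegral => t _; exact: centred_mass_odd.
(* Since c = 2^(-(j+1)), the limit is -4 c (-4)^j j! = (-2)^(j+1) j!, that is, (-2)^(k/2) Gamma(k/2)
   for the order k = 2j+2. *)
rewrite [X in _ --> X](_ : _ = (Num.sqrt pi)^-1 * (-2 * 0 +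
   -2 * (2 * c * ((-4) ^+ j * j`!%:R * Num.sqrt pi - 0)))); last first.
  have q4 : (-4) ^+ j = (-2) ^+ j * 2 ^+ j :> R by rewrite -exprMn mulNr -natrM.
  rewrite cE q4 2!exprS exprVn; have h2 : 2 ^+ j != 0 :> R by rewrite expf_neq0.
  rewrite /=; move: (2 ^+ j) h2 ((-2) ^+ j) (Num.sqrt pi) p0 => p p1 q s s0.
  by field; rewrite s0 p1.
apply: cvgM; first exact: cvg_cst.
apply: cvgD; apply: cvgM; [exact: cvg_cst|exact: mass_defect_cvg0|exact: cvg_cst|].
apply: cvgM; first exact: cvg_cst.
apply: cvgB; first exact: cvg_cst.
by have /cvg_at_rightP := @odd_primitive_cvg0 R j; apply.
Qed.

Lemma local_mass_cvg k x : (-1) ^+ k.+1 / Num.sqrt pi *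
  (\int[mu]_(t in @ray R) local_mass k x (e_ n) t) @[n --> \oo] -->
  Gamma_fun (k.+1%:R / 2 : R) * hermite_riesz_const R k.+1.
Proof.
rewrite -[X in _ --> X]add0r -[X in _ --> X + _](mulr0 ((-1) ^+ k.+1 / Num.sqrt pi)).
rewrite (_ : (fun n => _) = (fun n => (-1) ^+ k.+1 / Num.sqrt pi *
  (\int[mu]_(t in @ray R) shifted_mass k x (e_ n) t) + (-1) ^+ k.+1 / Num.sqrt pi *
  (\int[mu]_(t in @ray R) centred_mass k (e_ n) t))).
  apply: cvgD; last exact: centred_mass_cvg.
  by apply: cvgM; [exact: cvg_cst|exact: shifted_mass_cvg0].
apply/funext => n; rewrite -mulrDr -RintegralD //.
- by congr (_ * _); apply: eq_Rintegral => t _; exact: local_massE.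
- exact: integrable_shifted_mass.
- exact: integrable_centred_mass.
Qed.

End ShrinkingRadius.

End LocalMassLimit.

(** * Splitting the test function and passing to the principal value *)

Section PrincipalValue.
Variable R : realType.
Implicit Types (t x y u v e A K : R) (j k n : nat) (f g : R -> R).
Notation mu := (@lebesgue_measure R).
Notation gh := (@gauss_hermite R).

Let mray : measurable (@ray R : set (measurableTypeR R)) := measurable_itv _.

Lemma continuous_vanish_bounded A f : continuous f -> vanish_out A f ->
  exists2 B, 0 <= B & forall y, `|f y| <= B.
Proof.
move=> cf vf; have [A0|A0] := ltP A 0.
  by exists 0 => // y; rewrite vf ?normr0 // (lt_le_trans A0).
have AA : - A <= A by rewrite ge0_cp.
have cA : {within `[- A, A], continuous (fun y => `|f y|)}.
  apply: continuous_subspaceT => y; apply: cvg_norm; exact: cf.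
have [c _ hc] := EVT_max AA cA.
exists `|f c| => // y; have [yA|yA] := leP `|y| A; last by rewrite vf ?normr0.
by apply: hc; rewrite in_itv /= -ler_norml.
Qed.

Lemma smooth_lipschitz A f : smooth f -> vanish_out A f ->
  exists2 K, 0 <= K & forall x y, `|f x - f y| <= K * `|x - y|.
Proof.
move=> sf vf; have v1 : vanish_out A (f^`()%classic).
  (* Outside the support f' + x f reduces to f'. *)
  move=> x Ax; have := vanish_lower vf Ax; rewrite /hermite_lower vf // mulr0 addr0.
  exact.
have c1 : continuous (f^`()%classic).
  by move=> x; apply: derivable_continuous; exact: (sf 1%N x).
have [K K0 hK] := continuous_vanish_bounded c1 v1; exists K => // x y.
apply: (mvt_lipschitz _ hK) => z; apply: derivable_is_derive1; exact: (sf 0%N z).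
Qed.

(* The solution of (d/dy + y) w = 0 normalised at x: it turns the kernel in y
   into an exact derivative. *)
Definition weight_at x y : R := expR ((x ^+ 2 - y ^+ 2) / 2).

Lemma weight_at_lipschitz x : exists2 K, 0 <= K &
  forall y z, `|weight_at x y - weight_at x z| <= K * `|y - z|.
Proof.
exists (expR (x ^+ 2 / 2)) => [|y z]; first exact: expR_ge0.
have D (w : R) : is_derive w 1 (weight_at x) (- w * weight_at x w).
  rewrite mulrC; apply: (@is_derive_expR_comp R (fun y => (x ^+ 2 - y ^+ 2) / 2)).
  by apply: is_derive_eq; rewrite /GRing.scale /=; field.
apply: (mvt_lipschitz D) => w.
rewrite normrM normrN [`|weight_at _ _|]ger0_norm ?expR_ge0 //.
have -> : weight_at x w = expR (x ^+ 2 / 2) * expR (- (w ^+ 2 / 2)).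
  by rewrite -expRD /weight_at; congr expR; ring.
rewrite mulrCA ler_piMr ?expR_ge0 // expRN ler_pdivrMr ?expR_gt0 // mul1r.
(* |w| <= 1 + w^2/2 <= e^(w^2/2), so the derivative of the weight is bounded. *)
apply: le_trans (expR_ge1Dx _); have := sqr_ge0 (`|w| - 1).
by have := real_normK (num_real w); nra.
Qed.

Lemma continuous_weight_at x : continuous (weight_at x).
Proof.
move=> y; apply: (@continuous_comp _ _ _ (fun y => (x ^+ 2 - y ^+ 2) / 2) expR).
  apply: cvgM; last exact: cvg_cst.
  by apply: cvgB; [exact: cvg_cst|exact: exprn_continuous].
exact: continuous_expR.
Qed.

Lemma weight_atK x y : expR ((y ^+ 2 - x ^+ 2) / 2) * weight_at x y = 1.
Proof. by rewrite /weight_at -expRD -[RHS]expR0; congr expR; ring. Qed.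

Lemma continuous_riesz_heat_arg k x t : continuous (riesz_heat k x t).
Proof.
move=> y; apply: cvgM.
  apply: cvgM; first exact: cvg_cst.
  apply: (@continuous_comp _ _ _ (fun y => (y ^+ 2 - x ^+ 2) / 2) expR).
    apply: cvgM; last exact: cvg_cst.
    by apply: cvgB; [exact: exprn_continuous|exact: cvg_cst].
  exact: continuous_expR.
apply: (@continuous_comp _ _ _ (kernel_arg x t) (gh k)); last exact: continuous_gauss_hermite.
by apply: cvgM; [apply: cvgB; [exact: cvg_cst|exact: cvg_id]|exact: cvg_cst].
Qed.

Lemma riesz_heat_local k x e t : 0 < t -> 0 < e ->
  \int[mu]_(y in `[x - e, x + e]) (riesz_heat k.+1 x t y * weight_at x y) =
  (-1) ^+ k.+1 / Num.sqrt pi * local_mass k x e t.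
Proof.
move=> t0 e0; have r0 := rho_gt0 t0; have rn : rho t != 0 by rewrite gt_eqF.
pose c : R := (-1) ^+ k.+1 / Num.sqrt pi * ray_mult k.+1 t.
pose F y : R := c * gh k (kernel_arg x t y).
have FE : F (x + e) - F (x - e) = (-1) ^+ k.+1 / Num.sqrt pi * local_mass k x e t.
  rewrite /F /c /local_mass /kernel_arg /drift.
  have -> : (expR (- t) * x - (x + e)) / rho t = - ((1 - expR (- t)) / rho t * x) - e / rho t.
    by field.
  have -> : (expR (- t) * x - (x - e)) / rho t = - ((1 - expR (- t)) / rho t * x) + e / rho t.
    by field.
  by ring.
rewrite -FE /Rintegral; transitivity (fine (F (x + e) - F (x - e))%:E) => //.
congr (fine _); apply: (@FTC2_seg R
  (fun y => riesz_heat k.+1 x t y * weight_at x y) F).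
- by rewrite ltrBlDr -addrA ltrDl addr_gt0.
- move=> y _.
  have D1 : is_derive y 1 (kernel_arg x t) (- (rho t)^-1).
    by rewrite /kernel_arg; apply: is_derive_eq; rewrite /GRing.scale /=; field.
  have D2 := @is_derive_comp_eq R (gh k) (kernel_arg x t) y _ _ _
    (is_derive_gauss_hermite k _) D1 erefl.
  rewrite /F; apply: is_derive_eq; rewrite /GRing.scale /= /riesz_heat.
  transitivity (c * (gh k.+1 (kernel_arg x t y) / rho t) *
    (expR ((y ^+ 2 - x ^+ 2) / 2) * weight_at x y)).
    by rewrite weight_atK; ring.
  rewrite /c; move: (expR _) (weight_at x y) (gh _ _) (ray_mult _ _) ((-1) ^+ k.+1) => p q G m s.
  by ring.
- move=> y _; apply: cvgM; first exact: continuous_riesz_heat_arg.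
  exact: continuous_weight_at.
Qed.

Definition near_seg x e : set R := `[x - e, x + e].

Lemma near_segP x e y : near_seg x e y <-> `|y - x| <= e.
Proof. by rewrite /near_seg /= in_itv /= ler_distl. Qed.

Lemma near_segC x e : [set y | e < `|x - y|] = ~` near_seg x e.
Proof.
apply/seteqP; split => y /=.
  by move=> h /near_segP; rewrite distrC leNgt h.
by move=> /near_segP /negP; rewrite -ltNge distrC.
Qed.

Lemma measurable_near_seg x e : measurable (near_seg x e : set (measurableTypeR R)).
Proof. exact: measurable_itv. Qed.

Lemma measurable_patchT (D : set (measurableTypeR R)) (g : measurableTypeR R -> R) :
  measurable D -> measurable_fun setT g -> measurable_fun setT (g \_ D).
Proof.
by move=> mD mg; apply/(measurable_restrictT _ mD); exact: measurable_funS mg.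
Qed.

(** Where |y - x| > e, a bound B on |f| is at most (B / e) |y - x|. *)
Lemma lip_at_far x A f e : continuous f -> vanish_out A f -> 0 < e ->
  exists K, lip_at x A K (f \_ (~` near_seg x e)).
Proof.
move=> cf vf e0; have [B B0 hB] := continuous_vanish_bounded cf vf.
exists (B / e); split.
- apply: measurable_patchT; last exact: continuous_measurable_fun.
  by apply: measurableC; exact: measurable_near_seg.
- by move=> y Ay; rewrite patchE vf //; case: ifP.
- move=> y; rewrite patchE; case: ifPn => [|_].
    rewrite inE /= => /near_segP /negP; rewrite -ltNge => h.
    by apply: le_trans (hB y) _; rewrite mulrAC ler_pdivlMr // ler_wpM2l // ltW.
  by rewrite normr0 mulr_ge0 // divr_ge0 // ltW.
Qed.

(** The weight has no compact support, so the remainder is cut at the fixed radius 1. Radii e <= 1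
    then share one support bound and one constant. *)
Definition near_remainder f x : R -> R :=
  (fun y => f y - f x * weight_at x y) \_ (near_seg x 1).

(** The weight equals 1 at y = x, so the remainder vanishes there and inherits a Lipschitz constant
    from f and from the weight. K precedes e, as required for domination when e tends to 0. *)
Lemma lip_at_near x A f : smooth f -> vanish_out A f -> exists K, forall e,
  lip_at x (`|x| + 1) K (near_remainder f x \_ (near_seg x e)).
Proof.
move=> sf vf; have [K1 K10 h1] := smooth_lipschitz sf vf.
have [K2 K20 h2] := weight_at_lipschitz x.
exists (K1 + `|f x| * K2) => e; split.
- apply: measurable_patchT; first exact: measurable_near_seg.
  apply: measurable_patchT; first exact: measurable_near_seg.
  apply: continuous_measurable_fun => y.
  apply: cvgB; first exact: smooth_continuous.
  by apply: cvgM; [exact: cvg_cst|exact: continuous_weight_at].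
- move=> y Ay; rewrite patchE /near_remainder patchE.
  rewrite (_ : (y \in near_seg x 1) = false) ?if_same //; apply/negbTE/negP.
  rewrite inE => /near_segP h; move: Ay; rewrite ltNge => /negP; apply.
  by rewrite -[leLHS]/`|y| -[y in leLHS](subrK x) addrC (le_trans (ler_normD _ _)) // lerD2l.
- move=> y; have K0 : 0 <= K1 + `|f x| * K2 by rewrite addr_ge0 // mulr_ge0.
  have z : `|0 : R| <= (K1 + `|f x| * K2) * `|y - x| by rewrite normr0 mulr_ge0.
  rewrite patchE /near_remainder patchE; case: ifP => // _; case: ifP => // _.
  have -> : f y - f x * weight_at x y = (f y - f x) - f x * (weight_at x y - weight_at x x).
    by rewrite /weight_at subrr mul0r expR0; ring.
  apply: le_trans (ler_normB _ _) _; rewrite mulrDl lerD //.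
  by rewrite normrM -mulrA ler_wpM2l.
Qed.

Lemma near_far_split f x e y : e <= 1 -> f y = (f \_ (~` near_seg x e)) y +
  (((fun y => f x * weight_at x y) \_ (near_seg x e)) y +
  (near_remainder f x \_ (near_seg x e)) y).
Proof.
move=> e1; rewrite !patchE in_setC; case: ifPn => [ny|ny] /=.
  by rewrite (negbTE ny) !addr0.
move: ny; rewrite negbK => ny; rewrite ny /near_remainder patchE ifT.
  by rewrite add0r addrC subrK.
by move: ny; rewrite !inE => /near_segP h; apply/near_segP; exact: le_trans h e1.
Qed.

Lemma patch_mull D (h g : R -> R) y : ((fun y => h y * g y) \_ D) y = h y * (g \_ D) y.
Proof. by rewrite !patchE; case: ifP => // _; rewrite mulr0. Qed.

(** Moving the cut-off from the domain of integration onto f produces a test function to which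
    [kernel_fubini] applies. *)
Lemma hermite_riesz_truncE k x A f e : continuous f -> vanish_out A f -> 0 < e ->
  hermite_riesz_trunc k f x e = (Gamma_fun (k%:R / 2 : R))^-1 *
    \int[mu]_y (riesz_kernel k x y * (f \_ (~` near_seg x e)) y).
Proof.
move=> cf vf e0; have [K lf] := lip_at_far x cf vf e0.
have [ik _ _] := kernel_fubini k lf.
rewrite /hermite_riesz_trunc near_segC Rintegral_mkcond -RintegralZl //.
apply: eq_Rintegral => y _.
by rewrite (patch_mull _ (hermite_riesz_kernel k x)) hermite_riesz_kernelE mulrA.
Qed.

Lemma heat_lower_pairing k x A f t : continuous f -> vanish_out A f -> 0 < t ->
  Num.sqrt t ^+ k / t * \int[mu]_y (heat_kernel_lower k t x y * f y) =
  \int[mu]_y (riesz_heat k x t y * f y).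
Proof.
move=> cf vf t0; set a := Num.sqrt t ^+ k / t.
have a0 : a != 0 by rewrite gt_eqF // divr_gt0 // exprn_gt0 // sqrtr_gt0.
have i : mu.-integrable setT (EFin \o (fun y => riesz_heat k x t y * f y)).
  apply: (@integrable_vanish R A) => [y|]; last exact: vanish_mull.
  by apply: cvgM; [exact: continuous_riesz_heat_arg|exact: cf].
rewrite [X in a * X](_ : _ = a^-1 * \int[mu]_y (riesz_heat k x t y * f y)).
  by rewrite mulVKf.
rewrite -RintegralZl //; apply: eq_Rintegral => y _.
by rewrite -riesz_heatE // -/a -mulrA mulKf.
Qed.

Lemma integrable_add (D : set (measurableTypeR R)) f g : measurable D ->
  mu.-integrable D (EFin \o f) -> mu.-integrable D (EFin \o g) ->
  mu.-integrable D (EFin \o (fun y => f y + g y)).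
Proof. by move=> mD i1 i2; exact: (integrableD mD i1 i2). Qed.

Definition remainder_pairing k f x e t : R :=
  \int[mu]_y (riesz_heat k x t y * (near_remainder f x \_ (near_seg x e)) y).

Lemma riesz_heat_split k x A f e t : smooth f -> vanish_out A f -> 0 < e -> e <= 1 -> 0 < t ->
  \int[mu]_y (riesz_heat k.+1 x t y * f y) =
  \int[mu]_y (riesz_heat k.+1 x t y * (f \_ (~` near_seg x e)) y) +
  (f x * ((-1) ^+ k.+1 / Num.sqrt pi) * local_mass k x e t + remainder_pairing k.+1 f x e t).
Proof.
move=> sf vf e0 e1 t0; have cf := smooth_continuous sf.
have [K lf] := lip_at_far x cf vf e0; have [K' lg] := lip_at_near x sf vf.
have [C C0 hC] := riesz_heat_pairing k.+1 x A K; have [i1 _] := hC _ lf t t0.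
have [C' C'0 hC'] := riesz_heat_pairing k.+1 x (`|x| + 1) K'; have [i3 _] := hC' _ (lg e) t t0.
pose w y := f x * (riesz_heat k.+1 x t y * weight_at x y).
have cw : continuous (fun y => riesz_heat k.+1 x t y * weight_at x y).
  by move=> y; apply: cvgM; [exact: continuous_riesz_heat_arg|exact: continuous_weight_at].
have iw := @integrable_seg R _ (x - e) (x + e) cw.
have mN := measurable_near_seg x e.
have i2 : mu.-integrable setT (EFin \o (w \_ (near_seg x e))).
  have := integrable_scale (f x) mN iw; rewrite (integrable_mkcond _ mN).
  by apply: eq_integrable => // y _; rewrite /= !patchE; case: ifP.
have -> : f x * ((-1) ^+ k.+1 / Num.sqrt pi) * local_mass k x e t =
   \int[mu]_y (w \_ (near_seg x e)) y.
  by rewrite -mulrA -riesz_heat_local // -RintegralZl // Rintegral_mkcond.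
rewrite /remainder_pairing -(RintegralD measurableT i2 i3).
rewrite -(RintegralD measurableT i1 (integrable_add measurableT i2 i3)).
apply: eq_Rintegral => y _; rewrite [in LHS](near_far_split f x y e1) !mulrDr.
congr (_ + (_ + _)); rewrite !patchE; case: ifP => _; last by rewrite mulr0.
by rewrite /w mulrCA.
Qed.

(** An identity for each fixed e, not a limit: the far part is folded back by Fubini into the
    truncated integral, while the near parts stay as t-integrals, in which e can tend to 0. *)
Lemma hermite_riesz_split k x A f e : smooth f -> vanish_out A f -> 0 < e -> e <= 1 ->
  Gamma_fun (k.+1%:R / 2 : R) * hermite_riesz k.+1 f x =
  Gamma_fun (k.+1%:R / 2 : R) * hermite_riesz_trunc k.+1 f x e +
  (f x * ((-1) ^+ k.+1 / Num.sqrt pi * \int[mu]_(t in @ray R) local_mass k x e t) +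
   \int[mu]_(t in @ray R) remainder_pairing k.+1 f x e t).
Proof.
move=> sf vf e0 e1; have cf := smooth_continuous sf.
have [K lf] := lip_at_far x cf vf e0; have [K' lg] := lip_at_near x sf vf.
have [_ i1 E1] := kernel_fubini k.+1 lf.
have i3 : mu.-integrable (@ray R) (EFin \o remainder_pairing k.+1 f x e).
  by have [_] := kernel_fubini k.+1 (lg e).
have i2 := integrable_scale (f x * ((-1) ^+ k.+1 / Num.sqrt pi)) mray (integrable_local_mass k x e0).
rewrite hermite_riesz_heat //; last by exists A.
rewrite (hermite_riesz_truncE _ _ cf vf e0) mulVKf; last by rewrite gt_eqF // Gamma_half_gt0.
rewrite -E1 mulrA -RintegralZl //; last exact: integrable_local_mass.
rewrite -(RintegralD mray i2 i3) -(RintegralD mray i1 (integrable_add mray i2 i3)).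
apply: eq_Rintegral => t; rewrite inE => /rayP t0.
by rewrite (heat_lower_pairing _ _ cf vf t0) (riesz_heat_split k x sf vf e0 e1 t0).
Qed.

(** Dominated convergence twice: in y for fixed t, because the shrinking intervals leave only the
    point x, where the remainder is 0; then in t, with the majorant C [ray_dom] common to all
    radii. *)
Lemma remainder_cvg0 k x A f (e_ : nat -> R) : smooth f -> vanish_out A f ->
  (forall n, 0 < e_ n) -> e_ n @[n --> \oo] --> (0 : R) ->
  \int[mu]_(t in @ray R) remainder_pairing k f x (e_ n) t @[n --> \oo] --> (0 : R).
Proof.
move=> sf vf e_gt0 e_cvg; have [K lg] := lip_at_near x sf vf.
have [C C0 hC] := riesz_heat_pairing k x (`|x| + 1) K.
have mP n : measurable_fun (@ray R : set (measurableTypeR R)) (remainder_pairing k f x (e_ n)).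
  by have [_ /integrableP[/measurable_EFinP]] := kernel_fubini k (lg (e_ n)).
have gx : near_remainder f x x = 0.
  by rewrite /near_remainder patchE /weight_at subrr mul0r expR0 mulr1 subrr if_same.
rewrite [X in _ --> X](_ : _ = \int[mu]_(t in @ray R) 0); last by rewrite Rintegral_cst // mul0r.
apply: (@Rintegral_dominated_cvg _ _ _ mu (@ray R) _ _ (fun t => C * ray_dom t)) => //.
- move=> t /rayP t0.
  rewrite [X in _ --> X](_ : _ = \int[mu]_(y in [set: measurableTypeR R]) 0); last first.
    by rewrite Rintegral_cst // mul0r.
  have [i1 _] := hC _ (lg 1) t t0.
  apply: (@Rintegral_dominated_cvg _ _ _ mu setT _ _
    (fun y => `|riesz_heat k x t y * (near_remainder f x \_ (near_seg x 1)) y|)) => //.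
  + by move=> n; have [/integrableP[/measurable_EFinP]] := hC _ (lg (e_ n)) t t0.
  + move=> y _; have [->|yx] := eqVneq y x.
      rewrite (_ : (fun n => _) = cst 0); first exact: cvg_cst.
      by apply/funext => n /=; rewrite patchE gx if_same mulr0.
    have d0 : 0 < `|y - x| by rewrite normr_gt0 subr_eq0.
    apply: cvg_near_cst; near=> n; rewrite patchE ifF ?mulr0 //; apply/negbTE/negP.
    rewrite inE => /near_segP; apply/negP; rewrite -ltNge; near: n.
    exact: (cvgr_lt _ e_cvg).
  + exact: (integrable_abse i1).
  + move=> n y _; rewrite patchE; case: ifP => [yn|_]; last by rewrite mulr0 normr0.
    by rewrite patchE; case: ifPn => // yn'; rewrite /near_remainder patchE (negbTE yn').
- by apply: integrable_scale => //; exact: integrable_ray_dom.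
- move=> n t /rayP t0; have [i1 le1] := hC _ (lg (e_ n)) t t0.
  apply: le_trans le1; apply: norm_Rintegral_le => //.
    by have /integrableP[/measurable_EFinP] := i1.
  exact: (integrable_abse i1).
Unshelve. all: by end_near. Qed.

Lemma hermite_riesz_trunc_cvg k x f : smooth f -> (exists A, vanish_out A f) ->
  hermite_riesz_trunc k.+1 f x e @[e --> 0^'+] -->
  hermite_riesz k.+1 f x - hermite_riesz_const R k.+1 * f x.
Proof.
move=> sf [A vf]; set G := Gamma_fun (k.+1%:R / 2 : R).
have G0 : G != 0 by rewrite gt_eqF // Gamma_half_gt0.
pose T e := hermite_riesz k.+1 f x - G^-1 *
  (f x * ((-1) ^+ k.+1 / Num.sqrt pi * \int[mu]_(t in @ray R) local_mass k x e t) +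
   \int[mu]_(t in @ray R) remainder_pairing k.+1 f x e t).
have E : \forall e \near 0^'+, T e = hermite_riesz_trunc k.+1 f x e.
  near=> e; have e0 : 0 < e by near: e; exact: nbhs_right_gt.
  have e1 : e <= 1 by near: e; exact: nbhs_right_le.
  apply: (mulfI G0); rewrite /T mulrBr mulVKf //.
  by rewrite (hermite_riesz_split k x sf vf e0 e1) addrK.
apply: cvg_trans (near_eq_cvg E) _; apply/cvg_at_rightP => e_ [e_gt0 e_cvg].
apply: cvgB; first exact: cvg_cst.
rewrite (_ : _ * f x = G^-1 * (f x * (G * hermite_riesz_const R k.+1) + 0)); last by field.
apply: cvgM; first exact: cvg_cst.
apply: cvgD; last exact: remainder_cvg0 sf vf e_gt0 e_cvg.
by apply: cvgM; [exact: cvg_cst|exact: local_mass_cvg].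
Unshelve. all: by end_near. Qed.

End PrincipalValue.

Theorem proposition2p2 (R : realType) (k : nat) (hk : (1 <= k)%N)
    (f : R -> R) (hf : Cc_infty f) :
  \forall x \ae (@lebesgue_measure R),
    cvg (hermite_riesz_trunc k f x e @[e --> 0^'+]) /\
    hermite_riesz k f x =
      hermite_riesz_const R k * f x +
      lim (hermite_riesz_trunc k f x e @[e --> 0^'+]).
Proof.
apply: aeW => x; case: k hk => // k _.
have [A _ vf] := Cc_infty_vanish hf.
have h := @hermite_riesz_trunc_cvg R k x f (Cc_infty_smooth hf) (ex_intro _ A vf).
split; first by apply/cvg_ex; eexists; exact: h.
by rewrite (cvg_lim _ h) // addrC subrK.
Qed.
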